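(* Let $\mathcal C$ be a semisimple strict rigid C*-tensor category with at most countably many isomorphism classes of simple objects, and let $(\pi,H)$ be a (non-degenerate) $*$-representation of the fusion algebra $\mathbb C[\mathrm{Irr}(\mathcal C)]\cong\mathcal A_{0,0}$ on a Hilbert space. Then the following are equivalent: (1) there exists a non-degenerate $*$-representation of the tube algebra $\mathcal A$ whose restriction to $\mathcal A_{0,0}$ (acting on the range of $p_0$) is unitarily equivalent to $(\pi,H)$; (2) $(\pi,H)$ is admissible in the sense of Popa and Vaes, i.e. every vector state $[X]\mapsto\langle\pi([X])\xi,\xi\rangle$ ($\xi\in H$, $\|\xi\|=1$) is an admissible state.
   Context: Categories. $\mathcal C$ is a C*-category with finite-dimensional morphism spaces $Mor(X,Y)$, finite direct sums and subobjects, a strict tensor functor $\otimes$ compatible with $*$, simple tensor unit $id$, duals, and at most countably many isomorphism classes of simple objects. $\mathrm{Irr}(\mathcal C)$ is the set of isomorphism classes of simple objects, $X_k$ a chosen representative of $k\in \mathrm{Irr}(\mathcal C)$, $0$ the class of the unit, $X_0=id$. $d$ is the statistical dimension; $R_\alpha\in Mor(id,\overline \alpha\otimes \alpha)$, $\overline R_\alpha\in Mor(id,\alpha\otimes\overline \alpha)$ are standard solutions of the conjugate equations for an object $\alpha$; $R_k=R_{X_k}$, $\overline R_k=\overline R_{X_k}$, and $\overline X_k$ is identified with $X_{\overline k}$. The fusion algebra $\mathbb C[\mathrm{Irr}(\mathcal C)]$ has basis the classes $[X]$ of simple objects, product given by the fusion rules and $[X]^*=[\overline X]$. Tube algebra.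 $\mathcal A=\bigoplus_{i,j,k\in \mathrm{Irr}(\mathcal C)}\mathcal A^k_{i,j}$, $\mathcal A^k_{i,j}=Mor(X_k\otimes X_i,X_j\otimes X_k)$, $\mathcal A_{i,j}=\bigoplus_k\mathcal A^k_{i,j}$, a $*$-algebra with product $$(x\cdot y)^k_{i,j}=\sum_{s,m,l\in \mathrm{Irr}(\mathcal C)}\ \sum_{V\in onb(X_k,X_m\otimes X_l)}(1_j\otimes V^* )(x^m_{s,j}\otimes 1_l)(1_m\otimes y^l_{i,s})(V\otimes 1_i)$$ and involution $$(x^\#)^k_{i,j}=(\overline R_k^*\otimes 1_j\otimes 1_k)(1_k\otimes (x^{\overline k}_{j,i})^*\otimes 1_k)(1_k\otimes 1_i\otimes R_k),$$ where $onb(X_k,\beta)$ is an orthonormal basis of $Mor(X_k,\beta)$ for the inner product $\eta^*\xi=\langle\xi,\eta\rangle 1_{X_k}$. Put $p_k=1_{X_k}\in\mathcal A^0_{k,k}$; $\mathcal A_{k,k}=p_k\mathcal Ap_k$. The fusion algebra is identified with $\mathcal A_{0,0}$ via $[X_k]\mapsto 1_{X_k}\in\mathcal A^k_{0,0}$. A non-degenerate $*$-representation is a $*$-homomorphism $\pi:\mathcal A\to B(H)$ such that $\pi(\mathcal A)\xi=0$ implies $\xi=0$. Multipliers. A multiplier on $\mathcal C$ is a family of linear maps $\Theta_{\alpha,\beta}:End(\alpha\otimes\beta)\to End(\alpha\otimes\beta)$ ($\alpha,\beta\in Obj(\mathcal C)$) such that each $\Theta_{\alpha,\beta}$ is $End(\alpha)\otimes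 End(\beta)$-bimodular and $\Theta_{\alpha_1\otimes\alpha_2,\beta_1\otimes\beta_2}(1\otimes X\otimes1)=1\otimes\Theta_{\alpha_2,\beta_1}(X)\otimes1$ for all objects $\alpha_i,\beta_i$ and $X\in End(\alpha_2\otimes\beta_1)$. It is a cp-multiplier if every $\Theta_{\alpha,\beta}$ is completely positive. Multipliers are in bijection with functions $\psi:\mathrm{Irr}(\mathcal C)\to\mathbb C$ via $\psi\mapsto\Theta^\psi$: for $x\in End(\alpha\otimes\beta)$ let $\hat x=(R_\alpha^*\otimes1_\beta\otimes1_{\overline\beta})(1_{\overline\alpha}\otimes x\otimes1_{\overline\beta})(1_{\overline\alpha\otimes\alpha}\otimes\overline R_\beta)\in Mor(\overline\alpha\otimes\alpha,\beta\otimes\overline\beta)$ (a linear bijection $x\mapsto \hat x$); then $\Theta^\psi_{\alpha,\beta}(x)$ is the unique element with $\widehat{\Theta^\psi_{\alpha,\beta}(x)}=\sum_{k\in \mathrm{Irr}(\mathcal C)}\psi(X_k)\,\hat x\,P^k_{\overline\alpha\alpha}$, where $P^k_{\overline\alpha\alpha}\in End(\overline\alpha\otimes\alpha)$ is the central projection onto the sum of all subobjects isomorphic to $X_k$. The function $\psi$ is called a cp-multiplier if $\Theta^\psi$ is. Admissible state: a function $\phi:\mathrm{Irr}(\mathcal C)\to\mathbb C$, normalized by $\phi(id)=1$, such that $X\mapsto\phi(X)/d(X)$ is a cp-multiplier. *)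

(* Defs.v *)
From HB Require Import structures.
From mathcomp Require Import all_boot all_order all_algebra.
From mathcomp Require Import all_classical reals.
From mathcomp Require Import topology normedtype.
From mathcomp Require Import complex.

Set Implicit Arguments.
Unset Strict Implicit.
Unset Printing Implicit Defensive.

Import Order.TTheory GRing.Theory Num.Theory.
Import numFieldNormedType.Exports.

Local Open Scope classical_set_scope.
Local Open Scope ring_scope.
Local Open Scope complex_scope.

Reserved Notation "g ∘ f" (at level 40, left associativity).
Reserved Notation "X ⊗ Y" (at level 36, right associativity).
Reserved Notation "f ⊠ g" (at level 36, right associativity).
Reserved Notation "f ^†" (at level 2, format "f ^†").

Section DirectSum.
Context {K : nzRingType} {T : Type} (V : T -> lmodType K).

Record dsum := DSum {
  dsfun :> forall t, V t;
  dsum_finite : finite_set [set t | dsfun t != 0] }.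

HB.instance Definition _ := gen_eqMixin dsum.
HB.instance Definition _ := gen_choiceMixin dsum.

Lemma dsumP (x y : dsum) : (forall t, x t = y t) -> x = y.
Proof.
case: x y => [f ff] [g gg] /= fg.
have {}fg : f = g by apply: functional_extensionality_dep.
by case: g / fg gg => gg; congr DSum; exact: Prop_irrelevance.
Qed.

Lemma dsum_zero_subproof : finite_set [set t | (0 : V t) != 0].
Proof.
by rewrite [X in finite_set X](_ : _ = set0) // -subset0 => t /=; rewrite eqxx.
Qed.
Definition dsum_zero := DSum dsum_zero_subproof.

Lemma dsum_opp_subproof (x : dsum) : finite_set [set t | - x t != 0].
Proof.
by apply: sub_finite_set (dsum_finite x) => t /=; rewrite oppr_eq0.
Qed.
Definition dsum_opp x := DSum (dsum_opp_subproof x).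

Lemma dsum_add_subproof (x y : dsum) : finite_set [set t | x t + y t != 0].
Proof.
apply: (@sub_finite_set _ _ ([set t | x t != 0] `|` [set t | y t != 0])).
  move=> t /= xy; case: (eqVneq (x t) 0) => [x0|]; last by left.
  by right; move: xy; rewrite x0 add0r.
by rewrite finite_setU; split; exact: dsum_finite.
Qed.
Definition dsum_add x y := DSum (dsum_add_subproof x y).

Lemma dsum_scale_subproof (a : K) (x : dsum) : finite_set [set t | a *: x t != 0].
Proof.
apply: sub_finite_set (dsum_finite x) => t /=.
by apply: contra_neq => ->; rewrite scaler0.
Qed.
Definition dsum_scale a x := DSum (dsum_scale_subproof a x).

Lemma dsum_addA : associative dsum_add.
Proof. by move=> x y z; apply: dsumP => t; exact: addrA. Qed.
Lemma dsum_addC : commutative dsum_add.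
Proof. by move=> x y; apply: dsumP => t; exact: addrC. Qed.
Lemma dsum_add0 : left_id dsum_zero dsum_add.
Proof. by move=> x; apply: dsumP => t; exact: add0r. Qed.
Lemma dsum_addN : left_inverse dsum_zero dsum_opp dsum_add.
Proof. by move=> x; apply: dsumP => t; exact: addNr. Qed.
HB.instance Definition _ :=
  GRing.isZmodule.Build dsum dsum_addA dsum_addC dsum_add0 dsum_addN.

Lemma dsum_scaleA a b x : dsum_scale a (dsum_scale b x) = dsum_scale (a * b) x.
Proof. by apply: dsumP => t; exact: scalerA. Qed.
Lemma dsum_scale1 : left_id 1 dsum_scale.
Proof. by move=> x; apply: dsumP => t; exact: scale1r. Qed.
Lemma dsum_scaleDr : right_distributive dsum_scale +%R.
Proof. by move=> a x y; apply: dsumP => t; exact: scalerDr. Qed.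
Lemma dsum_scaleDl x : {morph dsum_scale^~ x : a b / a + b}.
Proof. by move=> a b; apply: dsumP => t; exact: scalerDl. Qed.
HB.instance Definition _ := GRing.Zmodule_isLmodule.Build K dsum
  dsum_scaleA dsum_scale1 dsum_scaleDr dsum_scaleDl.

End DirectSum.

Section Single.
Context {K : nzRingType} {T : eqType} (V : T -> lmodType K).

Definition single_fun (t : T) (v : V t) (s : T) : V s :=
  match t =P s with
  | ReflectT e => ecast s (V s) e v
  | ReflectF _ => 0
  end.

Lemma single_subproof t (v : V t) : finite_set [set s | single_fun v s != 0].
Proof.
apply: (@sub_finite_set _ _ [set t]); last exact: finite_set1.
by move=> s /=; rewrite /single_fun; case: eqP => [e _|_]; rewrite ?eqxx.
Qed.

Definition single t (v : V t) : dsum V := DSum (single_subproof v).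

End Single.

Arguments single {K T} V t v.

Section CStarCategory.
Variable R : realType.

Record catOps := CatOps {
  obj :> Type;
  Mor : obj -> obj -> vectType R[i];
  idm : forall X, Mor X X;
  comp : forall X Y Z, Mor Y Z -> Mor X Y -> Mor X Z;
  adj : forall X Y, Mor X Y -> Mor Y X;
  mnorm : forall X Y, Mor X Y -> R }.

End CStarCategory.

Arguments Mor {R c} X Y.
Arguments idm {R c} X.
Notation "g ∘ f" := (comp g f) : ring_scope.
Notation "f ^†" := (adj f) : ring_scope.

Section CStarAxioms.
Context {R : realType}.

(* Completeness of the norms is automatic in finite dimension. *)
Record cstar_axioms (C : catOps R) : Prop := CStarAxioms {
  compA : forall (X Y Z W : C) (h : Mor Z W) (g : Mor Y Z) (f : Mor X Y),
    h ∘ (g ∘ f) = (h ∘ g) ∘ f;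
  comp1m : forall (X Y : C) (f : Mor X Y), idm Y ∘ f = f;
  compm1 : forall (X Y : C) (f : Mor X Y), f ∘ idm X = f;
  comp_linearl : forall (X Y Z : C) (a : R[i]) (g h : Mor Y Z) (f : Mor X Y),
    (a *: g + h) ∘ f = a *: (g ∘ f) + h ∘ f;
  comp_linearr : forall (X Y Z : C) (a : R[i]) (h : Mor Y Z) (f g : Mor X Y),
    h ∘ (a *: f + g) = a *: (h ∘ f) + h ∘ g;
  adjK : forall (X Y : C) (f : Mor X Y), f^†^† = f;
  adj_comp : forall (X Y Z : C) (g : Mor Y Z) (f : Mor X Y),
    (g ∘ f)^† = f^† ∘ g^†;
  adj_antilinear : forall (X Y : C) (a : R[i]) (f g : Mor X Y),
    (a *: f + g)^† = Num.conj a *: f^† + g^†;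
  mnormD : forall (X Y : C) (f g : Mor X Y), mnorm (f + g) <= mnorm f + mnorm g;
  mnormZ : forall (X Y : C) (a : R[i]) (f : Mor X Y),
    mnorm (a *: f) = complex.Re `|a| * mnorm f;
  mnorm_eq0 : forall (X Y : C) (f : Mor X Y), mnorm f = 0 -> f = 0;
  mnorm_comp : forall (X Y Z : C) (g : Mor Y Z) (f : Mor X Y),
    mnorm (g ∘ f) <= mnorm g * mnorm f;
  mnorm_cstar : forall (X Y : C) (f : Mor X Y), mnorm (f^† ∘ f) = mnorm f ^+ 2;
  adj_comp_pos : forall (X Y : C) (f : Mor X Y),
    exists g : Mor X X, f^† ∘ f = g^† ∘ g }.

(* Finite direct sums. A zero object is provided by the subobject of p = 0. *)
Definition has_direct_sums (C : catOps R) : Prop :=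
  forall X Y : C, exists (Z : C) (u : Mor X Z) (v : Mor Y Z),
    [/\ u^† ∘ u = idm X, v^† ∘ v = idm Y & u ∘ u^† + v ∘ v^† = idm Z].

Definition has_subobjects (C : catOps R) : Prop :=
  forall (X : C) (p : Mor X X), p ∘ p = p -> p^† = p ->
    exists (Y : C) (v : Mor Y X), v^† ∘ v = idm Y /\ v ∘ v^† = p.

Definition simple (C : catOps R) (X : C) : Prop :=
  \dim (fullv : {vspace Mor X X}) = 1%N.

Definition isomorphic (C : catOps R) (X Y : C) : Prop :=
  exists (f : Mor X Y) (g : Mor Y X), g ∘ f = idm X /\ f ∘ g = idm Y.

(* The identity morphism along an equality of objects. In a strict tensor
   category it makes (X ⊗ Y) ⊗ Z and X ⊗ (Y ⊗ Z), which are equal but not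
   convertible, interchangeable. *)
Definition eqm (C : catOps R) (X Y : C) (e : X = Y) : Mor X Y :=
  ecast Y (Mor X Y) e (idm X).

End CStarAxioms.

Section TensorOps.
Variable R : realType.

Record tensorOps := TensorOps {
  tcat :> catOps R;
  tunit : tcat;
  tens : tcat -> tcat -> tcat;
  tensm : forall X X' Y Y' : tcat,
    Mor X X' -> Mor Y Y' -> Mor (tens X Y) (tens X' Y');
  tensA : forall X Y Z, tens (tens X Y) Z = tens X (tens Y Z);
  tens1o : forall X, tens tunit X = X;
  tenso1 : forall X, tens X tunit = X }.

End TensorOps.

Arguments tunit {R t}.
Arguments tensA {R t} X Y Z.
Arguments tens1o {R t} X.
Arguments tenso1 {R t} X.
Notation "X ⊗ Y" := (tens X Y) : ring_scope.
Notation "f ⊠ g" := (tensm f g) : ring_scope.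

Section Tensor.
Context {R : realType}.

Record tensor_axioms (C : tensorOps R) : Prop := TensorAxioms {
  tensm_id : forall X Y : C, idm X ⊠ idm Y = idm (X ⊗ Y);
  tensm_comp : forall (X X' X'' Y Y' Y'' : C) (f' : Mor X' X'') (f : Mor X X')
      (g' : Mor Y' Y'') (g : Mor Y Y'),
    (f' ∘ f) ⊠ (g' ∘ g) = (f' ⊠ g') ∘ (f ⊠ g);
  tensm_linearl : forall (X X' Y Y' : C) (a : R[i]) (f g : Mor X X')
      (h : Mor Y Y'),
    (a *: f + g) ⊠ h = a *: (f ⊠ h) + g ⊠ h;
  tensm_linearr : forall (X X' Y Y' : C) (a : R[i]) (h : Mor X X')
      (f g : Mor Y Y'),
    h ⊠ (a *: f + g) = a *: (h ⊠ f) + h ⊠ g;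
  tensm_adj : forall (X X' Y Y' : C) (f : Mor X X') (g : Mor Y Y'),
    (f ⊠ g)^† = f^† ⊠ g^†;
  tensmA : forall (X X' Y Y' Z Z' : C) (f : Mor X X') (g : Mor Y Y')
      (h : Mor Z Z'),
    eqm (tensA X' Y' Z') ∘ ((f ⊠ g) ⊠ h) = (f ⊠ (g ⊠ h)) ∘ eqm (tensA X Y Z);
  tensm1o : forall (X X' : C) (f : Mor X X'),
    eqm (tens1o X') ∘ (idm tunit ⊠ f) = f ∘ eqm (tens1o X);
  tensmo1 : forall (X X' : C) (f : Mor X X'),
    eqm (tenso1 X') ∘ (f ⊠ idm tunit) = f ∘ eqm (tenso1 X) }.

Section Duality.
Context {C : tensorOps R}.

Lemma tensA4 (X Y Z W : C) : (X ⊗ Y) ⊗ (Z ⊗ W) = X ⊗ ((Y ⊗ Z) ⊗ W).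
Proof. by rewrite !tensA. Qed.

(* 1 ⊗ f ⊗ 1, with source and target bracketed as products of two pairs *)
Definition mid (X W : C) {Y Z Y' Z' : C} (f : Mor (Y ⊗ Z) (Y' ⊗ Z')) :
    Mor ((X ⊗ Y) ⊗ (Z ⊗ W)) ((X ⊗ Y') ⊗ (Z' ⊗ W)) :=
  eqm (esym (tensA4 X Y' Z' W)) ∘ (idm X ⊠ (f ⊠ idm W)) ∘ eqm (tensA4 X Y Z W).

(* (R^* ⊗ 1)(1 ⊗ Rb) = 1 on Xb and (Rb^* ⊗ 1)(1 ⊗ R) = 1 on X *)
Definition conjugate_eqs (X Xb : C) (r : Mor tunit (Xb ⊗ X))
    (rb : Mor tunit (X ⊗ Xb)) : Prop :=
  eqm (tens1o Xb) ∘ (r^† ⊠ idm Xb) ∘ eqm (esym (tensA Xb X Xb))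
    ∘ (idm Xb ⊠ rb) ∘ eqm (esym (tenso1 Xb)) = idm Xb /\
  eqm (tens1o X) ∘ (rb^† ⊠ idm X) ∘ eqm (esym (tensA X Xb X))
    ∘ (idm X ⊠ r) ∘ eqm (esym (tenso1 X)) = idm X.

(* Standard solutions in the sense of Longo and Roberts: orthogonal sums of
   solutions for simple objects, normalized by |r| = |rb|. *)
Definition standard (X Xb : C) (r : Mor tunit (Xb ⊗ X))
    (rb : Mor tunit (X ⊗ Xb)) : Prop :=
  conjugate_eqs r rb /\
  exists (n : nat) (S Sb : 'I_n -> C)
    (w : forall a, Mor (S a) X) (wb : forall a, Mor (Sb a) Xb)
    (s : forall a, Mor tunit (Sb a ⊗ S a))
    (sb : forall a, Mor tunit (S a ⊗ Sb a)),
    [/\ forall a, [/\ simple (S a), conjugate_eqs (s a) (sb a)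
                    & mnorm (s a) = mnorm (sb a)],
        (forall a, (w a)^† ∘ w a = idm (S a)) /\
        \sum_a w a ∘ (w a)^† = idm X,
        (forall a, (wb a)^† ∘ wb a = idm (Sb a)) /\
        \sum_a wb a ∘ (wb a)^† = idm Xb,
        r = \sum_a (wb a ⊠ w a) ∘ s a
      & rb = \sum_a (w a ⊠ wb a) ∘ sb a].

End Duality.
End Tensor.

Lemma addxx_eq0 (V : zmodType) (x : V) : x = x + x -> x = 0.
Proof. by move=> /esym h; apply: (addrI x); rewrite addr0. Qed.

Section CStarTheory.
Context {R : realType} {C : catOps R} (hC : cstar_axioms C).
Implicit Types X Y Z : C.

Lemma comp0m X Y Z (f : Mor X Y) : (0 : Mor Y Z) ∘ f = 0.
Proof.
have := comp_linearl hC 1 (0 : Mor Y Z) 0 f.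
by rewrite !scale1r addr0 => /addxx_eq0.
Qed.

Lemma compm0 X Y Z (g : Mor Y Z) : g ∘ (0 : Mor X Y) = 0.
Proof.
have := comp_linearr hC 1 g (0 : Mor X Y) 0.
by rewrite !scale1r addr0 => /addxx_eq0.
Qed.

Lemma compZm X Y Z a (g : Mor Y Z) (f : Mor X Y) : (a *: g) ∘ f = a *: (g ∘ f).
Proof. by have := comp_linearl hC a g 0 f; rewrite comp0m !addr0. Qed.

Lemma compmZ X Y Z a (g : Mor Y Z) (f : Mor X Y) : g ∘ (a *: f) = a *: (g ∘ f).
Proof. by have := comp_linearr hC a g f 0; rewrite compm0 !addr0. Qed.

Lemma comp_suml X Y Z I (r : seq I) P (F : I -> Mor Y Z) (f : Mor X Y) :
  (\sum_(a <- r | P a) F a) ∘ f = \sum_(a <- r | P a) F a ∘ f.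
Proof.
apply: (big_morph (fun g => g ∘ f)); last exact: comp0m.
by move=> g h; have := comp_linearl hC 1 g h f; rewrite !scale1r.
Qed.

Lemma adj0 X Y : (0 : Mor X Y)^† = 0.
Proof.
have := adj_antilinear hC 1 (0 : Mor X Y) 0.
by rewrite rmorph1 !scale1r addr0 => /addxx_eq0.
Qed.

Lemma adj_idm X : (idm X)^† = idm X.
Proof.
have := congr1 (fun f => f^†) (compm1 hC (idm X)^†).
by rewrite /= (adj_comp hC) !(adjK hC) (compm1 hC).
Qed.

Lemma adj_comp_eq0 X Y (f : Mor X Y) : f^† ∘ f = 0 -> f = 0.
Proof.
move=> f0; apply: (mnorm_eq0 hC); apply/eqP.
rewrite -sqrf_eq0 -(mnorm_cstar hC) f0.
have := mnormZ hC 0 (0 : Mor X X).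
by rewrite scale0r normr0 /= mul0r => ->.
Qed.

Lemma idm_neq0 X : simple X -> idm X != 0.
Proof.
move=> sX; apply/eqP => id0.
have: (fullv : {vspace Mor X X}) = 0%VS.
  apply/eqP; rewrite -subv0; apply/subvP => f _.
  by rewrite -(compm1 hC f) id0 compm0 mem0v.
by move=> f0; move: sX; rewrite /simple f0 dimv0.
Qed.

Lemma simple_scalar X (f : Mor X X) : simple X -> exists a, f = a *: idm X.
Proof.
move=> sX; have : f \in (fullv : {vspace Mor X X}) by rewrite memvf.
have /eqP <- : (<[idm X]> == fullv)%VS.
  by rewrite eqEdim subvf dim_vline idm_neq0 // sX.
by move=> /vlineP[a ->]; exists a.
Qed.

Lemma schur X Y (f : Mor X Y) : simple X -> simple Y -> f != 0 -> isomorphic X Y.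
Proof.
move=> sX sY f0.
have [a fa] := simple_scalar (f^† ∘ f) sX.
have [b fb] := simple_scalar (f ∘ f^†) sY.
have a0 : a != 0.
  by apply: contra_neq f0 => a0; apply: adj_comp_eq0; rewrite fa a0 scale0r.
have ab : a = b.
  have: (f ∘ f^†) ∘ f = f ∘ (f^† ∘ f) by rewrite (compA hC).
  rewrite fa fb compZm compmZ (comp1m hC) (compm1 hC) => /eqP.
  by rewrite -subr_eq0 -scalerBl scaler_eq0 subr_eq0 (negbTE f0) orbF => /eqP.
exists f, (a^-1 *: f^†); split.
  by rewrite compZm fa scalerA mulVf // scale1r.
by rewrite compmZ fb -ab scalerA mulVf // scale1r.
Qed.

Lemma finite_simple_sub (I : choiceType) (X : I -> C) Y :
  (forall a, simple (X a)) -> (forall a b, isomorphic (X a) (X b) -> a = b) ->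
  finite_set [set a | exists f : Mor (X a) Y, f != 0].
Proof.
move=> sX iX; set A := [set a | _]; apply: contrapT => /infinite_set_fset.
move=> /(_ (\dim (fullv : {vspace Mor Y Y})).+1)[B BA sB].
have {B BA sB} [s [us sA ss]] : exists s : seq I,
    [/\ uniq s, forall a, a \in s -> A a
      & (\dim (fullv : {vspace Mor Y Y}) < size s)%N].
  by exists (finmap.enum_fset B); split; [exact: finmap.fset_uniq|exact: BA|].
have fE a : exists f : Mor (X a) Y, a \in s -> f != 0.
  have [aB|] := boolP (a \in s); last by exists 0.
  by have [f f0] := sA a aB; exists f.
pose f a := sval (cid (fE a)).
have f0 a : a \in s -> f a != 0 := svalP (cid (fE a)).
pose p a := f a ∘ (f a)^†.
have orth a b : a != b -> (f a)^† ∘ f b = 0.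
  move=> ab; apply/eqP; apply: contra_neqT ab => fab; apply/esym/iX.
  exact: schur fab.
have free_p : free (in_tuple [seq p a | a <- s]).
  apply/freeP => c c0 i.
  have szs : size [seq p a | a <- s] = size s by rewrite size_map.
  have nts (l : 'I_(size [seq p a | a <- s])) : (l < size s)%N by rewrite -szs.
  have [a0 _] : exists a, a \in s.
    by exists (tnth (in_tuple s) (cast_ord szs i)); exact: mem_tnth.
  have nthE (l : 'I_(size [seq p a | a <- s])) :
    [seq p a | a <- s]`_l = p (nth a0 s l) by rewrite (nth_map a0).
  set a := nth a0 s i.
  have aB : a \in s by apply: mem_nth.
  move: c0 => /(congr1 (fun g => (f a)^† ∘ (g ∘ f a))).
  rewrite comp0m compm0 comp_suml.
  rewrite (big_morph (fun g => (f a)^† ∘ g) (id1 := 0) (op1 := +%R)); first last.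
  - exact: compm0.
  - by move=> g h; have := comp_linearr hC 1 (f a)^† g h; rewrite !scale1r.
  rewrite (bigD1 i) //= big1 => [|l li]; last first.
    rewrite nthE compZm compmZ /p -!(compA hC) (orth _ a) ?compm0 ?scaler0 //.
    by rewrite nth_uniq //.
  rewrite addr0 nthE compZm compmZ => /eqP; rewrite scaler_eq0 => /orP[/eqP//|].
  move=> /eqP; rewrite /p -!(compA hC) (compA hC (f a)^†) => h.
  have : f a = 0.
    apply: adj_comp_eq0; apply: adj_comp_eq0.
    by rewrite (adj_comp hC) (adjK hC).
  by move/eqP; rewrite (negbTE (f0 _ aB)).
have := dimvS (subvf <<in_tuple [seq p a | a <- s]>>).
move: free_p; rewrite /free => /eqP ->.
rewrite size_tuple size_map => /(leq_trans _) => /(_ _ ss).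
by rewrite ltnn.
Qed.

End CStarTheory.

Section Coherence.
Context {R : realType} {C : tensorOps R}.
Context (hC : cstar_axioms C) (hT : tensor_axioms C).
Implicit Types X Y Z W : C.

(* Equality of morphisms up to the identifications of objects by strictness. *)
Definition heq X Y X' Y' (f : Mor X Y) (g : Mor X' Y') : Prop :=
  exists (eX : X = X') (eY : Y = Y'), eqm eY ∘ f = g ∘ eqm eX.

Lemma eqm_id X (e : X = X) : eqm e = idm X.
Proof. by rewrite (Prop_irrelevance e erefl). Qed.

Lemma heq_refl X Y (f : Mor X Y) : heq f f.
Proof. by exists erefl, erefl; rewrite !eqm_id (comp1m hC) (compm1 hC). Qed.

Lemma heq_eq X Y (f g : Mor X Y) : heq f g -> f = g.
Proof. by case=> eX [eY]; rewrite !eqm_id (comp1m hC) (compm1 hC). Qed.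

Lemma heq_sym X Y X' Y' (f : Mor X Y) (g : Mor X' Y') : heq f g -> heq g f.
Proof.
case=> eX [eY]; case: X' / eX g; case: Y' / eY => g.
by rewrite !eqm_id (comp1m hC) (compm1 hC) => ->; exact: heq_refl.
Qed.

Lemma heq_trans X Y X' Y' X'' Y'' (f : Mor X Y) (g : Mor X' Y')
  (h : Mor X'' Y'') : heq f g -> heq g h -> heq f h.
Proof.
case=> eX [eY]; case: X' / eX g; case: Y' / eY => g.
by rewrite !eqm_id (comp1m hC) (compm1 hC) => ->.
Qed.

Lemma heq_comp X Y Y1 Z X' Y' Y1' Z' (f : Mor X Y) (e : Y = Y1) (g : Mor Y1 Z)
    (f' : Mor X' Y') (e' : Y' = Y1') (g' : Mor Y1' Z') :
  heq g g' -> heq f f' -> heq (g ∘ eqm e ∘ f) (g' ∘ eqm e' ∘ f').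
Proof.
case=> eX [eY]; case: Y1' / eX e' g'; case: Z' / eY => e' g'.
rewrite !eqm_id (comp1m hC) (compm1 hC) => ->.
case=> {}eX [{}eY]; case: X' / eX f'; case: Y' / eY e' => e' f'.
rewrite !eqm_id (comp1m hC) (compm1 hC) => ->.
by rewrite (Prop_irrelevance e e'); exact: heq_refl.
Qed.

Lemma heq_tens X Y Z W X' Y' Z' W' (f : Mor X Y) (f' : Mor X' Y')
    (g : Mor Z W) (g' : Mor Z' W') :
  heq f f' -> heq g g' -> heq (f ⊠ g) (f' ⊠ g').
Proof.
case=> eX [eY]; case: X' / eX f'; case: Y' / eY => f'.
rewrite !eqm_id (comp1m hC) (compm1 hC) => ->.
case=> eX [eY]; case: Z' / eX g'; case: W' / eY => g'.
rewrite !eqm_id (comp1m hC) (compm1 hC) => ->.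
exact: heq_refl.
Qed.

Lemma heq_eqml X Y Y' (f : Mor X Y) (e : Y = Y') : heq (eqm e ∘ f) f.
Proof. by case: Y' / e; rewrite eqm_id (comp1m hC); exact: heq_refl. Qed.

Lemma heq_eqmr X X' Y (f : Mor X' Y) (e : X = X') : heq (f ∘ eqm e) f.
Proof. by case: X' / e f => f; rewrite eqm_id (compm1 hC); exact: heq_refl. Qed.

Lemma heq_tensA X X' Y Y' Z Z' (f : Mor X X') (g : Mor Y Y') (h : Mor Z Z') :
  heq ((f ⊠ g) ⊠ h) (f ⊠ (g ⊠ h)).
Proof. by exists (tensA _ _ _), (tensA _ _ _); exact: (tensmA hT). Qed.

Lemma heq_tens1o X X' (f : Mor X X') : heq (idm (tunit : C) ⊠ f) f.
Proof. by exists (tens1o _), (tens1o _); exact: (tensm1o hT). Qed.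

Lemma heq_tenso1 X X' (f : Mor X X') : heq (f ⊠ idm (tunit : C)) f.
Proof. by exists (tenso1 _), (tenso1 _); exact: (tensmo1 hT). Qed.

Lemma heq0 X Y X' Y' (f : Mor X Y) : heq f (0 : Mor X' Y') -> f = 0.
Proof.
case=> eX [eY]; case: X' / eX; case: Y' / eY.
by rewrite !eqm_id (comp1m hC) (compm1 hC).
Qed.

Lemma heq_0 X Y X' Y' : X = X' -> Y = Y' -> heq (0 : Mor X Y) (0 : Mor X' Y').
Proof. by move=> -> ->; exact: heq_refl. Qed.

Lemma tens0m X X' Y Y' (g : Mor Y Y') : (0 : Mor X X') ⊠ g = 0.
Proof.
by have := tensm_linearl hT 1 (0 : Mor X X') 0 g; rewrite !scale1r addr0 => /addxx_eq0.
Qed.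

Lemma tensm0 X X' Y Y' (f : Mor X X') : f ⊠ (0 : Mor Y Y') = 0.
Proof.
by have := tensm_linearr hT 1 f (0 : Mor Y Y') 0; rewrite !scale1r addr0 => /addxx_eq0.
Qed.

Lemma eqm_adj X Y (e : X = Y) : (eqm e)^† = eqm (esym e).
Proof. by case: Y / e; exact: (adj_idm hC). Qed.

Lemma eqm_tensl X X' Z (e : X = X') :
  eqm e ⊠ idm Z = eqm (f_equal (fun W => W ⊗ Z) e).
Proof. by case: X' / e; rewrite !eqm_id (tensm_id hT). Qed.

Lemma eqm_tensr X X' Z (e : X = X') :
  idm Z ⊠ eqm e = eqm (f_equal (fun W => Z ⊗ W) e).
Proof. by case: X' / e; rewrite !eqm_id (tensm_id hT). Qed.

Lemma tensm_compl X Y Z W (g : Mor Y Z) (f : Mor X Y) :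
  (g ∘ f) ⊠ idm W = (g ⊠ idm W) ∘ (f ⊠ idm W).
Proof. by rewrite -(tensm_comp hT) (comp1m hC). Qed.

Lemma tensm_compr X Y Z W (g : Mor Y Z) (f : Mor X Y) :
  idm W ⊠ (g ∘ f) = (idm W ⊠ g) ∘ (idm W ⊠ f).
Proof. by rewrite -(tensm_comp hT) (comp1m hC). Qed.

Lemma heq_compl1 X Y Z W (g : Mor Y Z) (f : Mor X Y) :
  heq g (idm W) -> heq (g ∘ f) f.
Proof.
case=> eX [eY eg]; apply: heq_trans (heq_sym (heq_eqml (g ∘ f) eY)) _.
by rewrite (compA hC) eg (comp1m hC); exact: heq_eqml.
Qed.

Lemma dual_inj X X' Y (r : Mor tunit (Y ⊗ X)) (rb : Mor tunit (X ⊗ Y))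
    (r' : Mor tunit (Y ⊗ X')) (rb' : Mor tunit (X' ⊗ Y)) :
  simple X -> simple X' ->
  conjugate_eqs r rb -> conjugate_eqs r' rb' -> isomorphic X X'.
Proof.
move=> sX sX' [cr _] [_ cr'].
set a := (rb^† ⊠ idm X') ∘ eqm (esym (tensA X Y X')) ∘ (idm X ⊠ r').
have [a0|a0] := eqVneq a 0; last first.
  apply: (schur hC (f := eqm (tens1o X') ∘ a ∘ eqm (esym (tenso1 X)))) => //.
  apply: contra_neq a0 => a0; apply: (heq0 (X' := X) (Y' := X')).
  rewrite -a0; apply: heq_sym; apply: heq_trans (heq_eqmr _ _) _.
  exact: heq_eqml.
suff r0 : r' = 0.
  move: cr'; rewrite r0 tensm0 (compm0 hC) (comp0m hC) => /esym/eqP.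
  by rewrite (negbTE (idm_neq0 hC sX')).
pose B := (idm Y ⊠ (rb^† ⊠ idm X')) ∘ eqm (tensA4 Y X Y X').
have BE : heq (B ∘ (r ⊠ idm (Y ⊗ X'))) (idm (Y ⊗ X')).
  have adjE : heq ((idm Y ⊠ rb^†) ∘ eqm (tensA Y X Y) ∘ (r ⊠ idm Y)) (idm Y).
    have := congr1 (fun f => f^†) cr; rewrite /=.
    rewrite !(adj_comp hC) !(tensm_adj hT) !(adj_idm hC) !(adjK hC) !eqm_adj.
    rewrite !esymK => h; rewrite -[X in heq _ X]h.
    apply: heq_sym; apply: heq_trans (heq_eqml _ _) _.
    rewrite !(compA hC); apply: heq_trans (heq_eqmr _ _) _.
    exact: heq_refl.
  apply: (@heq_trans _ _ _ _ _ _ _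
    (((idm Y ⊠ rb^†) ∘ eqm (tensA Y X Y) ∘ (r ⊠ idm Y)) ⊠ idm X')).
    rewrite !tensm_compl eqm_tensl.
    apply: heq_comp; first by apply: heq_sym; exact: heq_tensA.
    rewrite -(tensm_id hT); apply: heq_sym; exact: heq_tensA.
  rewrite -(tensm_id hT); apply: heq_tens => //; exact: heq_refl.
have B0 : B ∘ (idm (Y ⊗ X) ⊠ r') = 0.
  apply: (@heq0 _ _ (Y ⊗ (X ⊗ tunit)) (Y ⊗ (tunit ⊗ X'))).
  rewrite -(tensm0 _ _ (idm Y)) -a0 /a.
  rewrite !tensm_compr eqm_tensr.
  apply: heq_comp; first exact: heq_refl.
  by rewrite -(tensm_id hT); exact: heq_tensA.
apply: (heq0 (X' := tunit) (Y' := Y ⊗ X')).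
apply: heq_trans (heq_sym (heq_tens1o r')) _.
apply: heq_trans (heq_sym (heq_compl1 (idm tunit ⊠ r') BE)) _.
rewrite -(compA hC) -(tensm_comp hT) (compm1 hC) (comp1m hC).
rewrite -[r](comp1m hC) -[r'](compm1 hC) (tensm_comp hT) (compA hC) B0.
rewrite (comp0m hC); apply: heq_0; first by rewrite tens1o.
by rewrite tens1o.
Qed.

End Coherence.

Section Category.
Variable R : realType.

Record cstarTensorCategory := CStarTensorCategory {
  ctcOps :> tensorOps R;
  ctc_cstar : cstar_axioms ctcOps;
  ctc_tensor : tensor_axioms ctcOps;
  ctc_sums : has_direct_sums ctcOps;
  ctc_subobjects : has_subobjects ctcOps;
  ctc_unit : simple (tunit : ctcOps);
  ctc_duals : forall X : ctcOps, exists (Xb : ctcOps)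
    (r : Mor tunit (Xb ⊗ X)) (rb : Mor tunit (X ⊗ Xb)), conjugate_eqs r rb }.

(* Orthonormality for the inner product η^* ξ = <ξ, η> 1 on Mor(X, Y). *)
Definition is_onb (C : catOps R) (X Y : C) (b : seq (Mor X Y)) : Prop :=
  basis_of fullv b /\
  forall m n : 'I_(size b), (b`_m)^† ∘ b`_n = (m == n)%:R *: idm X.

(* The choices made once and for all for a given category: representatives
   X_k of the classes of simple objects, duals and standard solutions, and
   orthonormal bases of the spaces Mor(X_k, Y). *)
Record catChoices (C : cstarTensorCategory) := CatChoices {
  Irr : countType;
  rep : Irr -> C;
  rep_simple : forall k, simple (rep k);
  rep_inj : forall k l, isomorphic (rep k) (rep l) -> k = l;
  rep_surj : forall X : C, simple X -> exists k, isomorphic X (rep k);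
  irr0 : Irr;
  rep0 : rep irr0 = tunit;
  dual : C -> C;
  sol : forall X, Mor tunit (dual X ⊗ X);
  solb : forall X, Mor tunit (X ⊗ dual X);
  sol_standard : forall X, standard (sol X) (solb X);
  bar : Irr -> Irr;
  dual_rep : forall k, dual (rep k) = rep (bar k);
  onb : forall (k : Irr) (Y : C), seq (Mor (rep k) Y);
  onbP : forall k Y, is_onb (onb k Y) }.

End Category.


Section Choices.
Context {R : realType} {C : cstarTensorCategory R} (D : catChoices C).
Local Notation X_ k := (rep k).

Definition irr_sol (k : Irr D) : Mor tunit (X_ (bar k) ⊗ X_ k) :=
  (eqm (dual_rep k) ⊠ idm (X_ k)) ∘ sol D (X_ k).

Definition irr_solb (k : Irr D) : Mor tunit (X_ k ⊗ X_ (bar k)) :=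
  (idm (X_ k) ⊠ eqm (dual_rep k)) ∘ solb D (X_ k).

(* For a standard solution R_X^* R_X = d(X) 1, so that d(X) = |R_X|^2. *)
Definition sdim (X : C) : R := mnorm (sol D X) ^+ 2.

Lemma irr_sol_conj k : conjugate_eqs (irr_sol k) (irr_solb k).
Proof.
suff conj_eqm Y Z (e : Y = Z) (r : Mor tunit (Y ⊗ X_ k)) rb :
    conjugate_eqs r rb ->
    conjugate_eqs ((eqm e ⊠ idm (X_ k)) ∘ r) ((idm (X_ k) ⊠ eqm e) ∘ rb).
  by apply: conj_eqm; have [] := sol_standard D (X_ k).
case: Z / e; rewrite !eqm_id !(tensm_id (ctc_tensor C)).
by rewrite !(comp1m (ctc_cstar C)).
Qed.

Lemma barK : involutive (@bar _ _ D).
Proof.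
move=> k; apply/esym/(@rep_inj _ _ D).
have [h1 h2] := irr_sol_conj (bar k).
apply: (dual_inj (ctc_cstar C) (ctc_tensor C)) (irr_sol_conj k) (conj h2 h1);
  exact: rep_simple.
Qed.

Lemma finite_irr_sub (Y : C) :
  finite_set [set k : Irr D | exists f : Mor (X_ k) Y, f != 0].
Proof.
apply: (finite_simple_sub (ctc_cstar C)); first exact: rep_simple.
exact: rep_inj.
Qed.

(* The projection onto the sum of all subobjects of Y isomorphic to X_k: by the
   lemmas below it is a central projection that fixes all morphisms X_k -> Y. *)
Definition isotypic (k : Irr D) (Y : C) : Mor Y Y :=
  \sum_(V <- onb k Y) V ∘ V^†.

Lemma isotypic_comp k (Y : C) (f : Mor (X_ k) Y) : isotypic k Y ∘ f = f.
Proof.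
have hC := ctc_cstar C; have [bb on] := onbP k Y.
rewrite [f in LHS](coord_basis (X := in_tuple (onb k Y)) bb (memvf f)).
rewrite [RHS](coord_basis (X := in_tuple (onb k Y)) bb (memvf f)).
have compD : {morph comp (isotypic k Y) : g h / g + h}.
  by move=> X g h; have := comp_linearr hC 1 (isotypic k Y) g h; rewrite !scale1r.
rewrite (big_morph _ (compD _) (@compm0 _ _ hC _ _ _ _)); apply: eq_bigr => m _.
rewrite (compmZ hC) /isotypic (comp_suml hC) (big_nth 0) big_mkord.
rewrite (bigD1 m) //= big1 => [|n nm].
  by rewrite addr0 -(compA hC) on eqxx scale1r (compm1 hC).
by rewrite -(compA hC) on (negbTE nm) scale0r (compm0 hC).
Qed.

Lemma isotypic_idem k (Y : C) : isotypic k Y ∘ isotypic k Y = isotypic k Y.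
Proof.
have hC := ctc_cstar C.
have compD : {morph comp (isotypic k Y) : g h / g + h}.
  by move=> X g h; have := comp_linearr hC 1 (isotypic k Y) g h; rewrite !scale1r.
rewrite [X in _ ∘ X]/isotypic (big_morph _ (compD _) (@compm0 _ _ hC _ _ _ _)).
by apply: eq_bigr => V _; rewrite (compA hC) isotypic_comp.
Qed.

Lemma isotypic_adj k (Y : C) : (isotypic k Y)^† = isotypic k Y.
Proof.
have hC := ctc_cstar C.
have adjD : {morph (fun f : Mor Y Y => f^†) : g h / g + h}.
  move=> g h; have := adj_antilinear hC 1 g h.
  by rewrite scale1r rmorph1 scale1r.
rewrite /isotypic (big_morph _ adjD (adj0 hC Y Y)).
by apply: eq_bigr => V _; rewrite (adj_comp hC) (adjK hC).
Qed.

Lemma isotypic_central k (Y : C) (f : Mor Y Y) :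
  f ∘ isotypic k Y = isotypic k Y ∘ f.
Proof.
have hC := ctc_cstar C; pose P := isotypic k Y.
have PfP (g : Mor Y Y) : g ∘ P = P ∘ g ∘ P.
  have compD (h : Mor Y Y) : {morph (fun f : Mor Y Y => h ∘ f) : f g / f + g}.
    by move=> f1 f2; have := comp_linearr hC 1 h f1 f2; rewrite !scale1r.
  rewrite {1 3}/P /isotypic !(big_morph _ (compD _) (@compm0 _ _ hC _ _ _ _)).
  apply: eq_bigr => V _; rewrite (compA hC) -[in LHS](isotypic_comp (g ∘ V)).
  by rewrite !(compA hC).
have := congr1 (fun g => g^†) (PfP f^†).
by rewrite /= !(adj_comp hC) !(adjK hC) !isotypic_adj (compA hC) -PfP => ->.
Qed.

End Choices.

Section TubeAlgebra.
Context {R : realType} {C : cstarTensorCategory R} (D : catChoices C).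
Local Notation X_ k := (rep k).
Local Notation I := (Irr D).

(* A^k_{i,j}, with (i, j, k) encoded as ((i, j), k) *)
Definition tube_space (t : I * I * I) : lmodType R[i] :=
  Mor (X_ t.2 ⊗ X_ t.1.1) (X_ t.1.2 ⊗ X_ t.2).

Definition tube := dsum tube_space.

Definition tube_mul_term (x y : tube) (i j k s m l : I) :
    Mor (X_ k ⊗ X_ i) (X_ j ⊗ X_ k) :=
  \sum_(V <- onb k (X_ m ⊗ X_ l))
    (idm (X_ j) ⊠ V^†) ∘ eqm (tensA (X_ j) (X_ m) (X_ l))
    ∘ (x (s, j, m) ⊠ idm (X_ l)) ∘ eqm (esym (tensA (X_ m) (X_ s) (X_ l)))
    ∘ (idm (X_ m) ⊠ y (i, s, l)) ∘ eqm (tensA (X_ m) (X_ l) (X_ i))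
    ∘ (V ⊠ idm (X_ i)).

Definition tube_mul_fun (x y : tube) (t : I * I * I) : tube_space t :=
  \sum_(u \in [set: I * I * I])
    tube_mul_term x y t.1.1 t.1.2 t.2 u.1.1 u.1.2 u.2.

Lemma tube_mul_subproof x y : finite_set [set t | tube_mul_fun x y t != 0].
Proof.
have hC := ctc_cstar C; have hT := ctc_tensor C.
pose F (u v : I * I * I) := [set (v.1.1, u.1.2, k) |
  k in [set k : I | exists f : Mor (X_ k) (X_ u.2 ⊗ X_ v.2), f != 0]].
apply: (@sub_finite_set _ _ (\bigcup_(u in [set u | x u != 0])
   \bigcup_(v in [set v | y v != 0]) F u v)); last first.
  apply: bigcup_finite => [|u _]; first exact: dsum_finite.
  apply: bigcup_finite => [|v _]; first exact: dsum_finite.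
  exact/finite_image/finite_irr_sub.
move=> [[i j] k] /=; apply: contra_neqP => nF; apply: fsbig1 => -[[s m] l] _ /=.
rewrite /tube_mul_term big1_seq // => V _.
have [x0|x0] := eqVneq (x (s, j, m)) 0.
  by rewrite x0 (tens0m hT) !(comp0m hC, compm0 hC).
have [y0|y0] := eqVneq (y (i, s, l)) 0.
  by rewrite y0 (tensm0 hT) !(comp0m hC, compm0 hC).
have [->|V0] := eqVneq V 0.
  by rewrite (tens0m hT) (compm0 hC).
by case: nF; exists (s, j, m) => //; exists (i, s, l) => //; exists k => //; exists V.
Qed.

Definition tube_mul (x y : tube) : tube := DSum (tube_mul_subproof x y).

Definition tube_star_fun (x : tube) (t : I * I * I) : tube_space t :=
  let i := t.1.1 in let j := t.1.2 in let k := t.2 in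
  eqm (tens1o (X_ j ⊗ X_ k))
  ∘ ((irr_solb k)^† ⊠ idm (X_ j ⊗ X_ k))
  ∘ mid (X_ k) (X_ k) (x (j, i, bar k))^†
  ∘ (idm (X_ k ⊗ X_ i) ⊠ irr_sol k)
  ∘ eqm (esym (tenso1 (X_ k ⊗ X_ i))).

Lemma tube_star_subproof x : finite_set [set t | tube_star_fun x t != 0].
Proof.
have hC := ctc_cstar C; have hT := ctc_tensor C.
apply: (@sub_finite_set _ _ [set (t.1.2, t.1.1, bar t.2) | t in [set t | x t != 0]]).
  move=> [[i j] k] /= xt; exists (j, i, bar k); last by rewrite /= barK.
  apply: contra_neq xt => x0; rewrite /tube_star_fun /= x0 /mid.
  by rewrite (adj0 hC) (tens0m hT) (tensm0 hT) !(comp0m hC, compm0 hC).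
exact/finite_image/dsum_finite.
Qed.

Definition tube_star (x : tube) : tube := DSum (tube_star_subproof x).

Lemma tube_unit_subproof (k : I) : X_ (irr0 D) ⊗ X_ k = X_ k ⊗ X_ (irr0 D).
Proof. by rewrite rep0 tens1o tenso1. Qed.

(* p_k is 1_{X_k} in A^0_{k,k} = Mor(1 ⊗ X_k, X_k ⊗ 1) *)
Definition tube_p (k : I) : tube :=
  single tube_space (k, k, irr0 D) (eqm (tube_unit_subproof k)).

(* 1_{X_k} in A^k_{0,0} = Mor(X_k ⊗ 1, 1 ⊗ X_k) *)
Definition tube_irr (k : I) : tube :=
  single tube_space (irr0 D, irr0 D, k) (eqm (esym (tube_unit_subproof k))).

Definition fusion_space (_ : I) : lmodType R[i] := R[i]^o.

Definition fusion := dsum fusion_space.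

Definition fusion_irr (k : I) : fusion :=
  single fusion_space k (1 : R[i]).

Definition fusion_coef (k i j : I) : nat :=
  \dim (fullv : {vspace Mor (X_ k) (X_ i ⊗ X_ j)}).

Definition fusion_mul_fun (a b : fusion) (k : I) : R[i]^o :=
  \sum_(u \in [set: I * I]) a u.1 * b u.2 * (fusion_coef k u.1 u.2)%:R.

Lemma fusion_mul_subproof a b : finite_set [set k | fusion_mul_fun a b k != 0].
Proof.
pose F (i j : I) := [set k : I | exists f : Mor (X_ k) (X_ i ⊗ X_ j), f != 0].
apply: (@sub_finite_set _ _ (\bigcup_(i in [set i | a i != 0])
   \bigcup_(j in [set j | b j != 0]) F i j)); last first.
  apply: bigcup_finite => [|i _]; first exact: dsum_finite.
  apply: bigcup_finite => [|j _]; first exact: dsum_finite.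
  exact: finite_irr_sub.
move=> k /=; apply: contra_neqP => nF; apply: fsbig1 => -[i j] _ /=.
have [->|a0] := eqVneq (a i) 0; first by rewrite !mul0r.
have [->|b0] := eqVneq (b j) 0; first by rewrite mulr0 mul0r.
suff -> : fusion_coef k i j = 0%N by rewrite mulr0.
apply/eqP; rewrite /fusion_coef dimv_eq0 -vpick0; apply: contra_notT nF => f0.
by exists i => //; exists j => //; eexists; exact: f0.
Qed.

Definition fusion_mul (a b : fusion) : fusion := DSum (fusion_mul_subproof a b).

Lemma fusion_star_subproof (a : fusion) :
  finite_set [set k | Num.conj (a (bar k)) != 0].
Proof.
apply: (@sub_finite_set _ _ [set bar k | k in [set k | a k != 0]]).
  move=> k /= ak; exists (bar k); last exact: barK.
  by apply: contra_neq ak => ->; rewrite rmorph0.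
exact/finite_image/dsum_finite.
Qed.

(* [X_k]^* = [X_(bar k)], extended antilinearly *)
Definition fusion_star (a : fusion) : fusion :=
  @DSum _ _ fusion_space _ (fusion_star_subproof a).

(* the identification of C[Irr(C)] with A_{0,0} *)
Definition fusion_tube (a : fusion) : tube :=
  \sum_(k \in [set: I]) a k *: tube_irr k.

End TubeAlgebra.

Section Representations.
Variable R : realType.

Record hilbertSpace := HilbertSpace {
  hspace :> completeNormedModType R[i];
  hdot : {dot hspace for Num.conj};
  hdot_norm : forall x : hspace, hdot x x = `|x| ^+ 2 }.

Record nondeg_star_rep (A : lmodType R[i]) (mul : A -> A -> A) (star : A -> A)
    (H : hilbertSpace) (pi : A -> {linear H -> H}) : Prop := NondegStarRep {
  rep_bounded : forall a, continuous (pi a);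
  rep_linear : forall (c : R[i]) (a b : A) (v : H),
    pi (c *: a + b) v = c *: pi a v + pi b v;
  rep_mul : forall (a b : A) (v : H), pi (mul a b) v = pi a (pi b v);
  rep_star : forall (a : A) (v w : H),
    hdot H (pi (star a) v) w = hdot H v (pi a w);
  rep_nondeg : forall v : H, (forall a, pi a v = 0) -> v = 0 }.

Context {C : cstarTensorCategory R} (D : catChoices C).

(* Unitary equivalence of pi with the restriction of rho to A_{0,0}, acting on
   the range of rho(p_0): U is a unitary of H onto that range. *)
Definition restricts_to (K : hilbertSpace) (rho : tube D -> {linear K -> K})
    (H : hilbertSpace) (pi : fusion D -> {linear H -> H}) : Prop :=
  exists U : {linear H -> K},
    [/\ forall v w : H, hdot K (U v) (U w) = hdot H v w,
        range U = range (rho (tube_p (irr0 D)))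
      & forall (a : fusion D) (v : H), rho (fusion_tube a) (U v) = U (pi a v)].

End Representations.

Section Multipliers.
Context {R : realType} {C : cstarTensorCategory R}.

Definition endo_family := forall X Y : C,
  Mor (X ⊗ Y) (X ⊗ Y) -> Mor (X ⊗ Y) (X ⊗ Y).

Record is_multiplier (Th : endo_family) : Prop := IsMultiplier {
  mult_linear : forall X Y, linear (Th X Y);
  mult_bimodular : forall (X Y : C) (a a' : Mor X X) (b b' : Mor Y Y)
      (x : Mor (X ⊗ Y) (X ⊗ Y)),
    Th X Y ((a ⊠ b) ∘ x ∘ (a' ⊠ b')) = (a ⊠ b) ∘ Th X Y x ∘ (a' ⊠ b');
  mult_tens : forall (X1 X2 Y1 Y2 : C) (x : Mor (X2 ⊗ Y1) (X2 ⊗ Y1)),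
    Th (X1 ⊗ X2) (Y1 ⊗ Y2) (mid X1 Y2 x) = mid X1 Y2 (Th X2 Y1 x) }.

(* a = b^* b in the C*-algebra M_n(End(X)) *)
Definition mx_positive (X : C) (n : nat) (a : 'M[Mor X X]_n) : Prop :=
  exists b : 'M[Mor X X]_n, forall p q, a p q = \sum_r (b r p)^† ∘ b r q.

Definition completely_positive (X : C) (T : Mor X X -> Mor X X) : Prop :=
  forall (n : nat) (a : 'M[Mor X X]_n), mx_positive a -> mx_positive (map_mx T a).

Definition is_cp_multiplier (Th : endo_family) : Prop :=
  is_multiplier Th /\ forall X Y, completely_positive (Th X Y).

Variable D : catChoices C.

Definition hat (X Y : C) (x : Mor (X ⊗ Y) (X ⊗ Y)) :
    Mor (dual D X ⊗ X) (Y ⊗ dual D Y) :=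
  eqm (tens1o (Y ⊗ dual D Y))
  ∘ ((sol D X)^† ⊠ idm (Y ⊗ dual D Y))
  ∘ mid (dual D X) (dual D Y) x
  ∘ (idm (dual D X ⊗ X) ⊠ solb D Y)
  ∘ eqm (esym (tenso1 (dual D X ⊗ X))).

(* Th is the multiplier attached to psi; it is unique since hat is bijective *)
Definition multiplier_of (psi : Irr D -> R[i]) (Th : endo_family) : Prop :=
  forall (X Y : C) (x : Mor (X ⊗ Y) (X ⊗ Y)),
    hat (Th X Y x) =
    \sum_(k \in [set: Irr D]) psi k *: (hat x ∘ isotypic k (dual D X ⊗ X)).

Definition cp_function (psi : Irr D -> R[i]) : Prop :=
  exists2 Th : endo_family, multiplier_of psi Th & is_cp_multiplier Th.

Definition admissible_state (phi : Irr D -> R[i]) : Prop :=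
  phi (irr0 D) = 1 /\ cp_function (fun k => phi k / (sdim D (rep k))%:C).

Definition admissible_rep (H : hilbertSpace R)
    (pi : fusion D -> {linear H -> H}) : Prop :=
  forall v : H, `|v| = 1 ->
    admissible_state (fun k => hdot H (pi (fusion_irr k) v) v).

End Multipliers.

(* Main.v *)
(** The proof goes through fusion algebra valued kernels. For x : X -> Y ⊗ X and
    y : X' -> Y ⊗ X', bending y^* around X' and composing with x gives an endomorphism
    of X'^- ⊗ X; counting its multiplicities yields an element [kern y x] of the fusion
    algebra. Tubes act on such morphisms, with kern y (a.x) = kern (a^#.y) x, and both
    conditions turn out to be equivalent to
      (P)  <π(kern x x) ξ, ξ> >= 0  for all x : X -> Y ⊗ X and all ξ in H.

    (1) => (P): by decomposing X and Y, x corresponds to an element a of A_{0,i}, and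
    the left-hand side is the squared norm of the vector a ξ.

    (P) => (1): direct sums upgrade (P) to positivity of (π(kern x_q x_p)) on families
    of vectors from one cyclic subspace, and splitting H into nearly orthogonal cyclic
    parts gives it on all families. The resulting form on pairs (x, ξ) is completed to
    a Hilbert space on which the tube algebra acts; its part of weight 0 is H.

    (2) <=> (P): let r, r' be standard solutions for β and x_p = (b_p ⊗ 1)(1 ⊗ r') with
    b_p defined on β^- ⊗ β. Sphericality of the categorical trace shows that the
    multiplier Θ of φ/d satisfies r^* Θ(b_p^* b_q) r = Σ_k φ(k) kern(x_p, x_q)(k). So
    complete positivity gives (P), and by Frobenius reciprocity it only has to be
    tested on expressions of this form. *)

Require Import Defs.
From HB Require Import structures.
From mathcomp Require Import all_boot all_order all_algebra.
From mathcomp Require Import all_classical reals.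
From mathcomp Require Import topology normedtype sequences complex ring.
From mathcomp Require Import spectral.

Set Implicit Arguments.
Unset Strict Implicit.
Unset Printing Implicit Defensive.

Import Order.TTheory GRing.Theory Num.Theory.
Import numFieldNormedType.Exports.

Local Open Scope classical_set_scope.
Local Open Scope ring_scope.

(** * Positive sesquilinear forms *)

(** The objects [X] and [Y] of a kernel are arbitrary, and morphisms slide around the annulus. So
    isometries cancel, a finite family of generators becomes a single one, and the sum over
    orthonormal bases in the product of the tube algebra collapses to a resolution of the identity.
    Positivity alone does not make tubes bounded on a pre-Hilbert space: the bound comes from
    writing c kern(h, g) - kern(f.h, f.g) as kern(b.h, b.g) for another tube b, whose target weight
    need not be simple. Cyclic parts of H are only approximated, because a nearly minimal distance
    suffices for a finite list of vectors and the errors tend to zero. Generators are mere labels of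
    copies of H; the relations between them hold modulo null vectors, which the completion removes.
    The factor d in an admissible state is the weight that turns multiplicity traces into the
    categorical trace. From (1) to (P) the form built for the converse is used again, as a bare
    sesquilinear form: its values at vacuum vectors are computable before its sign is known. *)

Section PositiveForms.
Context {C : numClosedFieldType} {V : lmodType C}.

Record psd_form (Q : V -> V -> C) : Prop := PsdForm {
  psd_linl : forall a u v w, Q (a *: u + v) w = a * Q u w + Q v w;
  psd_linr : forall a u v w, Q w (a *: u + v) = a^* * Q w u + Q w v;
  psd_ge0 : forall u, 0 <= Q u u }.

Section Theory.
Variables (Q : V -> V -> C) (hQ : psd_form Q).

Lemma psdDl u v w : Q (u + v) w = Q u w + Q v w.
Proof. by have := psd_linl hQ 1 u v w; rewrite scale1r mul1r. Qed.
Lemma psdDr u v w : Q w (u + v) = Q w u + Q w v.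
Proof. by have := psd_linr hQ 1 u v w; rewrite scale1r rmorph1 mul1r. Qed.
Lemma psd0l w : Q 0 w = 0.
Proof. by apply: (addrI (Q 0 w)); rewrite -psdDl !addr0. Qed.
Lemma psd0r w : Q w 0 = 0.
Proof. by apply: (addrI (Q w 0)); rewrite -psdDr !addr0. Qed.
Lemma psdZl a u w : Q (a *: u) w = a * Q u w.
Proof. by have := psd_linl hQ a u 0 w; rewrite psd0l !addr0. Qed.
Lemma psdZr a u w : Q w (a *: u) = a^* * Q w u.
Proof. by have := psd_linr hQ a u 0 w; rewrite psd0r !addr0. Qed.
Lemma psdNl u w : Q (- u) w = - Q u w.
Proof. by rewrite -scaleN1r psdZl mulN1r. Qed.
Lemma psdNr u w : Q w (- u) = - Q w u.
Proof. by rewrite -scaleN1r psdZr rmorphN rmorph1 mulN1r. Qed.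
Lemma psdBl u v w : Q (u - v) w = Q u w - Q v w.
Proof. by rewrite psdDl psdNl. Qed.
Lemma psdBr u v w : Q w (u - v) = Q w u - Q w v.
Proof. by rewrite psdDr psdNr. Qed.

Lemma psd_sumr I (r : seq I) P (F : I -> V) w :
  Q w (\sum_(i <- r | P i) F i) = \sum_(i <- r | P i) Q w (F i).
Proof. by apply: (big_morph (Q w)) => [u v|]; [exact: psdDr|exact: psd0r]. Qed.

Lemma psd_suml I (r : seq I) P (F : I -> V) w :
  Q (\sum_(i <- r | P i) F i) w = \sum_(i <- r | P i) Q (F i) w.
Proof.
by apply: (big_morph (Q^~ w)) => [u v|]; [exact: psdDl|exact: psd0l].
Qed.

(* Polarization: Q (u + t v) (u + t v) is real for t = 1 and t = i. *)
Lemma psd_herm u v : Q v u = (Q u v)^*.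
Proof.
have key t : t * Q v u + t^* * Q u v \is Num.real.
  have := psd_ge0 hQ (u + t *: v).
  rewrite psdDl !psdDr !psdZl !psdZr => /ger0_real.
  have -> : Q u u + t^* * Q u v + (t * Q v u + t * (t^* * Q v v)) =
    (t * Q v u + t^* * Q u v) + (Q u u + (`|t| ^+ 2) * Q v v).
    by rewrite normCK -!mulrA; ring.
  have re0 : Q u u + `|t| ^+ 2 * Q v v \is Num.real.
    by rewrite ger0_real // addr_ge0 ?mulr_ge0 ?exprn_ge0 ?psd_ge0.
  by move=> h; have := rpredB h re0; rewrite addrK.
have /CrealP := key 1; have /CrealP := key 'i.
rewrite !rmorph1 !mul1r !rmorphD !rmorphM /= conjCK conjCi => e2 e1.
move: e2; rewrite !mulNr => e2.
have {}e2 : (Q u v)^* - (Q v u)^* = Q v u - Q u v.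
  apply: (mulfI (neq0Ci C)); rewrite !mulrBr -e2 addrC; ring.
have := congr2 +%R e1 e2.
have -> : (Q v u)^* + (Q u v)^* + ((Q u v)^* - (Q v u)^*) = (Q u v)^* *+ 2 by ring.
have -> : Q v u + Q u v + (Q v u - Q u v) = Q v u *+ 2 by ring.
by move=> /eqP; rewrite eqrMn2r //= => /eqP ->.
Qed.

Definition pnorm u := sqrtC (Q u u).

Lemma pnorm_ge0 u : 0 <= pnorm u. Proof. by rewrite sqrtC_ge0 psd_ge0. Qed.
Lemma pnorm_sqr u : pnorm u ^+ 2 = Q u u. Proof. by rewrite sqrtCK. Qed.

Lemma pnorm_le u c : 0 <= c -> Q u u <= c ^+ 2 -> pnorm u <= c.
Proof.
by move=> c0 h; rewrite -(@ler_pXn2r _ 2) ?nnegrE ?pnorm_ge0 // pnorm_sqr.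
Qed.

Lemma psd_cauchy_schwarz u v : `|Q u v| <= pnorm u * pnorm v.
Proof.
have uu := psd_ge0 hQ u; have vv := psd_ge0 hQ v.
have key a b : 0 <= `|a| ^+ 2 * Q u u - (a * b^* * Q u v) - (a^* * b * (Q u v)^*)
    + `|b| ^+ 2 * Q v v.
  have := psd_ge0 hQ (a *: u - b *: v).
  rewrite psdBl !psdBr !psdZl !psdZr (psd_herm u v) !normCK => h.
  by apply: le_trans h _; rewrite le_eqVlt; apply/orP; left; apply/eqP; ring.
rewrite -(@ler_pXn2r _ 2) ?nnegrE ?mulr_ge0 ?pnorm_ge0 // exprMn !pnorm_sqr.
have [v0|v0] := eqVneq (Q v v) 0.
  rewrite v0 mulr0; have [-> |q0] := eqVneq (Q u v) 0; first by rewrite normr0 expr0n.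
  (* Since [Q v v = 0], the expression in [key] is affine in [b]; this [b] gives it the value -1. *)
  have := key 1 ((Q u u + 1) / (2 * (Q u v)^*)).
  rewrite v0 mulr0 addr0 normr1 expr1n !mul1r rmorph1 !mul1r.
  have -> : ((Q u u + 1) / (2 * (Q u v)^*))^* * Q u v = (Q u u + 1) / 2.
    rewrite !(rmorphM, fmorphV, rmorphD, rmorph1) /= conjCK.
    by rewrite (CrealP (ger0_real uu)); field; rewrite q0.
  have -> : (Q u u + 1) / (2 * (Q u v)^*) * (Q u v)^* = (Q u u + 1) / 2.
    by field; rewrite conjC_eq0.
  have -> : Q u u - (Q u u + 1) / 2 - (Q u u + 1) / 2 = -1 :> C by field.
  by rewrite oppr_ge0 ler10.
have vp : 0 < Q v v by rewrite lt_def v0.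
(* This choice of coefficients leaves [Q v v] times the Gram determinant of [u] and [v]. *)
have := key (Q v v) (Q u v).
have -> : `|Q v v| = Q v v by rewrite ger0_norm.
have -> : (Q v v)^* = Q v v by apply/CrealP/ger0_real.
have -> : Q v v ^+ 2 * Q u u - Q v v * (Q u v)^* * Q u v - Q v v * Q u v * (Q u v)^*
    + `|Q u v| ^+ 2 * Q v v = Q v v * (Q u u * Q v v - `|Q u v| ^+ 2).
  by rewrite normCK; ring.
by rewrite pmulr_rge0 // subr_ge0.
Qed.

Lemma pnormD u v : pnorm (u + v) <= pnorm u + pnorm v.
Proof.
apply: pnorm_le; first by rewrite addr_ge0 ?pnorm_ge0.
rewrite psdDl !psdDr (psd_herm u v) sqrrD !pnorm_sqr.
have -> : Q u u + Q u v + ((Q u v)^* + Q v v) = Q u u + Q v v + (Q u v + (Q u v)^*).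
  by ring.
have -> : Q u u + pnorm u * pnorm v *+ 2 + Q v v = Q u u + Q v v + pnorm u * pnorm v *+ 2.
  by ring.
rewrite lerD2l.
have re : Q u v + (Q u v)^* \is Num.real by apply/CrealP; rewrite rmorphD /= conjCK addrC.
apply: le_trans (real_ler_norm re) _; apply: le_trans (ler_normD _ _) _.
by rewrite norm_conjC -mulr2n lerMn2r /= psd_cauchy_schwarz.
Qed.

Lemma pnormZ a u : pnorm (a *: u) = `|a| * pnorm u.
Proof.
rewrite /pnorm psdZl psdZr mulrA -normCK rootCMl ?exprn_ge0 //.
by rewrite exprCK.
Qed.

Lemma pnormN u : pnorm (- u) = pnorm u.
Proof. by rewrite -scaleN1r pnormZ normrN1 mul1r. Qed.

Lemma pnorm0 : pnorm 0 = 0.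
Proof. by rewrite /pnorm psd0l sqrtC0. Qed.

Lemma pnorm_sum I (r : seq I) P (F : I -> V) :
  pnorm (\sum_(i <- r | P i) F i) <= \sum_(i <- r | P i) pnorm (F i).
Proof.
apply: (big_ind2 (fun u c => pnorm u <= c)) => [|u a v b ua vb|//].
  by rewrite pnorm0.
exact: le_trans (pnormD _ _) (lerD ua vb).
Qed.

End Theory.
End PositiveForms.

(** * Limits of sequences of scalars *)

Section Tends.
Context {C : numClosedFieldType}.
Implicit Types (u v : nat -> C) (l m : C).

Definition tends u l := forall e, 0 < e ->
  exists N, forall n, (N <= n)%N -> `|u n - l| < e.

Lemma small_eq0 (x : C) : (forall e, 0 < e -> `|x| < e) -> x = 0.
Proof.
move=> h; apply/eqP; rewrite -normr_le0; apply/negPn/negP => x0.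
have xp : 0 < `|x| by rewrite normr_gt0; apply: contraNneq x0 => ->; rewrite normr0.
by have := h _ xp; rewrite ltxx.
Qed.

Lemma tends_unique u l m : tends u l -> tends u m -> l = m.
Proof.
move=> ul um; apply/eqP; rewrite -subr_eq0; apply/eqP/small_eq0 => e e0.
have e2 : 0 < e / 2 by rewrite divr_gt0.
have [N hN] := ul _ e2; have [M hM] := um _ e2.
have := hN (maxn N M) (leq_maxl _ _); have := hM (maxn N M) (leq_maxr _ _).
set x := u _ => hm hl; have -> : l - m = (x - m) - (x - l) by ring.
by rewrite (splitr e); apply: le_lt_trans (ler_normB _ _) _; exact: ltrD.
Qed.

Lemma tends_cst l : tends (fun=> l) l.
Proof. by move=> e e0; exists 0%N => n _; rewrite subrr normr0. Qed.

Lemma eq_tends u v l : u =1 v -> tends u l -> tends v l.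
Proof.
by move=> uv ul e /ul[N h]; exists N => n /h; rewrite uv.
Qed.

Lemma tendsD u v l m : tends u l -> tends v m -> tends (fun n => u n + v n) (l + m).
Proof.
move=> ul vm e e0; have e2 : 0 < e / 2 by rewrite divr_gt0.
have [N hN] := ul _ e2; have [M hM] := vm _ e2; exists (maxn N M) => n.
rewrite geq_max => /andP[/hN h1 /hM h2]; rewrite opprD addrACA (splitr e).
by apply: le_lt_trans (ler_normD _ _) _; exact: ltrD.
Qed.

Lemma tendsZ a u l : tends u l -> tends (fun n => a * u n) (a * l).
Proof.
move=> ul e e0; have a1 : 0 < `|a| + 1 by rewrite ltr_wpDl.
have [N hN] := ul (e / (`|a| + 1)) (divr_gt0 e0 a1); exists N => n /hN.
rewrite -mulrBr normrM ltr_pdivlMr // mulrC => h; apply: le_lt_trans h.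
by rewrite ler_wpM2r // lerDl.
Qed.

Lemma tends_conj u l : tends u l -> tends (fun n => (u n)^*) l^*.
Proof.
by move=> ul e /ul[N h]; exists N => n /h; rewrite -rmorphB norm_conjC.
Qed.

(* Limits of nonnegative elements are nonnegative, since [0 <= x] is the
   equation [`|x| = x]. *)
Lemma tends_ge0 u l : tends u l -> (forall n, 0 <= u n) -> 0 <= l.
Proof.
move=> ul u0; suff -> : l = `|l| by [].
apply/eqP; rewrite -subr_eq0; apply/eqP/small_eq0 => e e0.
have e2 : 0 < e / 2 by rewrite divr_gt0.
have [N /(_ N (leqnn _)) h] := ul _ e2.
have -> : l - `|l| = (l - u N) + (`|u N| - `|l|) by rewrite (ger0_norm (u0 N)); ring.
rewrite [e]splitr; apply: le_lt_trans (ler_normD _ _) _; apply: ltrD.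
  by rewrite distrC.
by apply: le_lt_trans h; exact: ler_dist_dist.
Qed.

Lemma tends_squeeze u v : (forall n, `|u n| <= v n) -> tends v 0 -> tends u 0.
Proof.
move=> uv v0 e /v0[N h]; exists N => n /h; rewrite !subr0 => {}h.
by apply: le_lt_trans h; rewrite (le_trans (uv n)) // real_ler_norm // ger0_real // (le_trans
  _ (uv n)).
Qed.

End Tends.

Section ComplexComplete.
Variable R : realType.
Implicit Types u : nat -> R[i].

Lemma Re_le_norm (z : R[i]) : (`|complex.Re z|)%:C%C <= `|z|.
Proof.
by rewrite normc_def lecR -sqrtr_sqr ler_wsqrtr // lerDl sqr_ge0.
Qed.

Lemma Im_le_norm (z : R[i]) : (`|complex.Im z|)%:C%C <= `|z|.
Proof.
by rewrite normc_def lecR -sqrtr_sqr ler_wsqrtr // lerDr sqr_ge0.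
Qed.

Lemma real_cauchy_tends (x : nat -> R) :
  (forall e, 0 < e -> exists N, forall n m, (N <= n)%N -> (N <= m)%N ->
     `|x n - x m| < e) ->
  exists l, forall e, 0 < e -> exists N, forall n, (N <= n)%N -> `|x n - l| < e.
Proof.
move=> hx; have : cvg (x @ \oo).
  apply: cauchy_cvg; apply: cauchy_exP => e e0.
  have [N h] := hx e e0; exists (x N); exists N => // n /= Nn.
  exact: h.
move=> /cvg_ex[l /cvgrPdist_lt h]; exists l => e e0.
by have [N _ hN] := h e e0; exists N => n Nn; rewrite distrC; exact: hN.
Qed.

Lemma complex_cauchy_tends u :
  (forall e, 0 < e -> exists N, forall n m, (N <= n)%N -> (N <= m)%N ->
     `|u n - u m| < e) ->
  exists l, tends u l.
Proof.
move=> hu.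
have [e e0|a ha] := @real_cauchy_tends (fun n => complex.Re (u n)).
  have [|N h] := hu e%:C%C; first by rewrite ltcR.
  exists N => n m nN mN; have := h n m nN mN.
  rewrite -ltcR; apply: le_lt_trans; have := Re_le_norm (u n - u m).
  by rewrite raddfB.
have [e e0|b hb] := @real_cauchy_tends (fun n => complex.Im (u n)).
  have [|N h] := hu e%:C%C; first by rewrite ltcR.
  exists N => n m nN mN; have := h n m nN mN.
  rewrite -ltcR; apply: le_lt_trans; have := Im_le_norm (u n - u m).
  by rewrite raddfB.
exists (Complex a b) => e e0.
have er : e = (complex.Re e)%:C%C by rewrite RRe_real // gtr0_real.
have e2 : 0 < complex.Re e / 2 by rewrite divr_gt0 // -ltcR -er.
have [N hN] := ha _ e2; have [M hM] := hb _ e2; exists (maxn N M) => n.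
rewrite geq_max => /andP[/hN h1 /hM h2].
rewrite er (complexE (u n - _)); apply: le_lt_trans (ler_normD _ _) _.
rewrite normrM.
have nE (x : R) : `|x%:C%C| = (`|x|)%:C%C.
  by rewrite normc_def /= expr0n addr0 sqrtr_sqr.
have -> : `|'i%C| = 1 :> R[i].
  by rewrite normc_def /= expr0n add0r expr1n sqrtr1.
rewrite !nE mul1r -rmorphD ltcR (splitr (complex.Re e)).
by rewrite !raddfB /=; exact: ltrD.
Qed.

End ComplexComplete.

(** * Hilbert space completion *)

Section CauchySequences.
Context {R : realType} {V : lmodType R[i]} (Q : V -> V -> R[i]).
Variable hQ : psd_form Q.
Local Notation "`[ u ]" := (pnorm Q u).

Definition qcauchy (u : nat -> V) := forall e, 0 < e ->
  exists N, forall n m, (N <= n)%N -> (N <= m)%N -> `[u n - u m] < e.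

Lemma qcauchy_comb a u v :
  qcauchy u -> qcauchy v -> qcauchy (fun n => a *: u n + v n).
Proof.
move=> cu cv e e0; have a1 : 0 < `|a| + 1 by rewrite ltr_wpDl.
have e2 : 0 < e / 2 by rewrite divr_gt0.
have [N hN] := cu _ (divr_gt0 e2 a1); have [M hM] := cv _ e2.
exists (maxn N M) => n m; rewrite !geq_max => /andP[nN nM] /andP[mN mM].
have -> : a *: u n + v n - (a *: u m + v m) = a *: (u n - u m) + (v n - v m).
  by rewrite scalerBr opprD addrACA.
apply: le_lt_trans (pnormD hQ _ _) _; rewrite (splitr e); apply: ltrD; last exact: hM.
rewrite (pnormZ hQ); have := hN n m nN mN; rewrite ltr_pdivlMr // mulrC.
by apply: le_lt_trans; rewrite ler_wpM2r ?(pnorm_ge0 hQ) // lerDl.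
Qed.

Lemma qcauchy_cst v : qcauchy (fun=> v).
Proof. by move=> e e0; exists 0%N => n m _ _; rewrite subrr (pnorm0 hQ). Qed.

Lemma qcauchy_bounded u : qcauchy u -> exists2 B, 0 < B & forall n, `[u n] <= B.
Proof.
move=> /(_ 1 ltr01)[N hN].
exists (\sum_(k < N.+1) `[u k] + 1).
  by rewrite ltr_wpDl // sumr_ge0 // => k _; exact: pnorm_ge0 hQ _.
have le k : (k < N.+1)%N -> `[u k] <= \sum_(k < N.+1) `[u k].
  move=> kN; rewrite (bigD1 (Ordinal kN)) //= lerDl sumr_ge0 // => l _.
  exact: pnorm_ge0 hQ _.
move=> n; have [nN|nN] := ltnP n N.+1; first by rewrite (le_trans (le n nN)) // lerDl.
rewrite -[u n](subrK (u N)); apply: le_trans (pnormD hQ _ _) _.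
rewrite addrC lerD // ?le // ltW //; exact: hN (ltnW nN) _.
Qed.

Lemma qcauchy_form u v : qcauchy u -> qcauchy v ->
  exists l, tends (fun n => Q (u n) (v n)) l.
Proof.
move=> cu cv; have [B B0 hB] := qcauchy_bounded cu.
have [B' B'0 hB'] := qcauchy_bounded cv.
apply: complex_cauchy_tends => e e0; have e2 : 0 < e / 2 by rewrite divr_gt0.
have [N hN] := cu _ (divr_gt0 e2 B'0); have [M hM] := cv _ (divr_gt0 e2 B0).
exists (maxn N M) => n m; rewrite !geq_max => /andP[nN nM] /andP[mN mM].
have -> : Q (u n) (v n) - Q (u m) (v m) = Q (u n - u m) (v n) + Q (u m) (v n - v m).
  by rewrite (psdBl hQ) (psdBr hQ) addrA subrK.
apply: le_lt_trans (ler_normD _ _) _; rewrite (splitr e); apply: ltrD.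
  apply: le_lt_trans (psd_cauchy_schwarz hQ _ _) _.
  have := hN n m nN mN; rewrite ltr_pdivlMr //; apply: le_lt_trans.
  by rewrite ler_wpM2l ?(pnorm_ge0 hQ).
apply: le_lt_trans (psd_cauchy_schwarz hQ _ _) _.
have := hM n m nM mM; rewrite ltr_pdivlMr // mulrC; apply: le_lt_trans.
by rewrite ler_wpM2r ?(pnorm_ge0 hQ).
Qed.

(** Split [Q (u n) (u n)] as [Q (u n) (u n - u N) + Q (u n) (u N)]: the first term is small because
    [u] is Cauchy and bounded, the second by weak convergence. Hence a functional determines its
    representing sequence up to null sequences. *)
Lemma qcauchy_weak0 u : qcauchy u -> (forall v, tends (fun n => Q (u n) v) 0) ->
  tends (fun n => `[u n]) 0.
Proof.
move=> cu u0 e e0; have [B B0 hB] := qcauchy_bounded cu.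
have e2 : 0 < e ^+ 2 / 2 by rewrite divr_gt0 ?exprn_gt0.
have [N hN] := cu _ (divr_gt0 e2 B0); have [M hM] := u0 (u N) _ e2.
exists (maxn N M) => n; rewrite geq_max => /andP[nN nM].
rewrite subr0 ger0_norm ?(pnorm_ge0 hQ) //.
rewrite -(@ltr_pXn2r _ 2) ?nnegrE ?(pnorm_ge0 hQ) ?(ltW e0) // pnorm_sqr.
rewrite -[Q _ _]ger0_norm ?(psd_ge0 hQ) //.
have -> : Q (u n) (u n) = Q (u n) (u n - u N) + Q (u n) (u N).
  by rewrite (psdBr hQ) subrK.
apply: le_lt_trans (ler_normD _ _) _; rewrite (splitr (e ^+ 2)); apply: ltrD.
  apply: le_lt_trans (psd_cauchy_schwarz hQ _ _) _.
  have := hN n N nN (leqnn _); rewrite ltr_pdivlMr // mulrC; apply: le_lt_trans.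
  by rewrite ler_wpM2r ?(pnorm_ge0 hQ).
by have := hM n nM; rewrite subr0.
Qed.

(* The completion of [V] is realized as a space of linear functionals on the
   conjugate of [V]: the Cauchy sequence [u] becomes [v |-> lim Q (u n) v]. *)
Definition represents (u : nat -> V) (f : V -> R[i]) :=
  qcauchy u /\ forall v, tends (fun n => Q (u n) v) (f v).

Lemma represents_comb a u v f g : represents u f -> represents v g ->
  represents (fun n => a *: u n + v n) (fun w => a * f w + g w).
Proof.
move=> [cu hu] [cv hv]; split; first exact: qcauchy_comb.
move=> w; apply: eq_tends (tendsD (tendsZ a (hu w)) (hv w)) => n.
by rewrite (psd_linl hQ).
Qed.

Lemma represents_cst v : represents (fun=> v) (Q v).
Proof. by split; [exact: qcauchy_cst|move=> w; exact: tends_cst]. Qed.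

Lemma represents_unique u v f : represents u f -> represents v f ->
  tends (fun n => `[u n - v n]) 0.
Proof.
move=> hu hv; have [c h] := represents_comb (-1) hv hu.
apply: (@eq_tends _ (fun n => `[-1 *: v n + u n])) => [n|].
  by rewrite scaleN1r addrC.
by apply: qcauchy_weak0 => // w; have := h w; rewrite mulN1r addNr.
Qed.

(** Indexing the type by the proof [h] lets the Hilbert space structure, which is derived from
    positivity, be attached to it. *)
Record completion_of (h : psd_form Q) := Completion {
  cfun : V -> R[i];
  cfunP : exists u, represents u cfun }.
Local Notation completion := (completion_of hQ).

HB.instance Definition _ := gen_eqMixin completion.
HB.instance Definition _ := gen_choiceMixin completion.

Lemma completion_ext (f g : completion) : cfun f =1 cfun g -> f = g.
Proof.
case: f g => [f hf] [g hg] /= /funext fg; case: g / fg hg => hg.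
by congr Completion; exact: Prop_irrelevance.
Qed.

Lemma comp_comb_subproof a (f g : completion) :
  exists u, represents u (fun w => a * cfun f w + cfun g w).
Proof.
have [u hu] := cfunP f; have [v hv] := cfunP g.
by exists (fun n => a *: u n + v n); exact: represents_comb.
Qed.
Definition comp_comb a f g : completion := Completion hQ (comp_comb_subproof a f g).

Definition comp_embed v : completion :=
  Completion hQ (ex_intro (fun u => represents u (Q v)) _ (represents_cst v)).
Definition comp_zero := comp_embed 0.
Definition comp_add := comp_comb 1.
Definition comp_opp f := comp_comb (-1) f comp_zero.
Definition comp_scale a f := comp_comb a f comp_zero.

Lemma comp_addA : associative comp_add.
Proof. by move=> f g h; apply: completion_ext => w /=; ring. Qed.
Lemma comp_addC : commutative comp_add.
Proof. by move=> f g; apply: completion_ext => w /=; ring. Qed.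
Lemma comp_add0 : left_id comp_zero comp_add.
Proof. by move=> f; apply: completion_ext => w /=; rewrite (psd0l hQ); ring. Qed.
Lemma comp_addN : left_inverse comp_zero comp_opp comp_add.
Proof. by move=> f; apply: completion_ext => w /=; rewrite (psd0l hQ); ring. Qed.
HB.instance Definition _ :=
  GRing.isZmodule.Build completion comp_addA comp_addC comp_add0 comp_addN.

Lemma comp_scaleA a b f : comp_scale a (comp_scale b f) = comp_scale (a * b) f.
Proof. by apply: completion_ext => w /=; rewrite (psd0l hQ); ring. Qed.
Lemma comp_scale1 : left_id 1 comp_scale.
Proof. by move=> f; apply: completion_ext => w /=; rewrite (psd0l hQ); ring. Qed.
Lemma comp_scaleDr : right_distributive comp_scale +%R.
Proof. by move=> a f g; apply: completion_ext => w /=; rewrite (psd0l hQ); ring. Qed.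
Lemma comp_scaleDl f : {morph comp_scale^~ f : a b / a + b}.
Proof. by move=> a b; apply: completion_ext => w /=; rewrite (psd0l hQ); ring. Qed.
HB.instance Definition _ := GRing.Zmodule_isLmodule.Build R[i] completion
  comp_scaleA comp_scale1 comp_scaleDr comp_scaleDl.

Lemma cfun_comb a f g w : cfun (a *: f + g) w = a * cfun f w + cfun g w.
Proof. by rewrite /= (psd0l hQ); ring. Qed.

Definition crepr (f : completion) : nat -> V := sval (cid (cfunP f)).
Lemma creprP f : represents (crepr f) (cfun f).
Proof. exact: svalP (cid (cfunP f)). Qed.

Lemma comp_embed_linear : linear comp_embed.
Proof.
by move=> a u v; apply: completion_ext => w; rewrite cfun_comb /= (psd_linl hQ).
Qed.
HB.instance Definition _ := GRing.isLinear.Build _ _ _ _ comp_embed comp_embed_linear.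

Definition cdot (f g : completion) : R[i] :=
  sval (cid (qcauchy_form (creprP f).1 (creprP g).1)).

(** Two representatives of one functional differ by a null sequence, so by Cauchy-Schwarz the limit
    does not depend on the representatives picked by [crepr]. *)
Lemma cdotP f g u v : represents u (cfun f) -> represents v (cfun g) ->
  tends (fun n => Q (u n) (v n)) (cdot f g).
Proof.
move=> hu hv; rewrite /cdot; case: cid => l /= hl.
have small (x y : nat -> V) : tends (fun n => `[x n]) 0 -> qcauchy y ->
    tends (fun n => Q (x n) (y n)) 0 /\ tends (fun n => Q (y n) (x n)) 0.
  move=> x0 /qcauchy_bounded[B B0 hB].
  have := tendsZ B x0; rewrite mulr0 => Bx0.
  split; apply: (tends_squeeze _ Bx0) => n; apply: le_trans (psd_cauchy_schwarz hQ _ _) _.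
    by rewrite mulrC ler_wpM2r ?(pnorm_ge0 hQ).
  by rewrite ler_wpM2r ?(pnorm_ge0 hQ).
have [h1 _] := small _ _ (represents_unique hu (creprP f)) hv.1.
have [_ h2] := small _ _ (represents_unique hv (creprP g)) (creprP f).1.
have := tendsD hl (tendsD h1 h2); rewrite !addr0; apply: eq_tends => n.
by rewrite (psdBl hQ) (psdBr hQ); ring.
Qed.

Lemma cdot_linl a f g h : cdot (a *: f + g) h = a * cdot f h + cdot g h.
Proof.
have hf := creprP f; have hg := creprP g; have hh := creprP h.
have hfg : represents (fun n => a *: crepr f n + crepr g n) (cfun (a *: f + g)).
  have := represents_comb a hf hg.
  by congr represents; apply/funext => w; rewrite cfun_comb.
apply: tends_unique (cdotP hfg hh) _.
apply: eq_tends (tendsD (tendsZ a (cdotP hf hh)) (cdotP hg hh)) => n.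
by rewrite (psd_linl hQ).
Qed.

Lemma cdot_herm f g : cdot g f = (cdot f g)^*.
Proof.
have hf := creprP f; have hg := creprP g.
apply: tends_unique (cdotP hg hf) _.
by apply: eq_tends (tends_conj (cdotP hf hg)) => n; rewrite -(psd_herm hQ).
Qed.

Lemma cdot_psd : psd_form cdot.
Proof.
split=> [a f g h|a f g h|f]; first exact: cdot_linl.
  by rewrite cdot_herm cdot_linl rmorphD rmorphM /= (cdot_herm f h) (cdot_herm g h).
by apply: tends_ge0 (cdotP (creprP f) (creprP f)) _ => n; exact: psd_ge0.
Qed.

Lemma cdot_embed f v : cdot f (comp_embed v) = cfun f v.
Proof.
apply: tends_unique (@cdotP f (comp_embed v) _ _ (creprP f) (represents_cst v)) _.
exact: (creprP f).2.
Qed.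

(** By Cauchy-Schwarz a null vector is orthogonal to every [comp_embed v], and these inner products
    are the values of [f]. *)
Lemma cdot_eq0 f : cdot f f = 0 -> f = 0.
Proof.
move=> f0; apply: completion_ext => v.
have : cdot f (comp_embed v) = 0.
  apply/eqP; rewrite -normr_le0.
  have := psd_cauchy_schwarz cdot_psd f (comp_embed v).
  by rewrite {1}/pnorm f0 sqrtC0 mul0r.
by rewrite cdot_embed => ->; rewrite /= (psd0l hQ).
Qed.

Definition cnorm f := pnorm cdot f.

Lemma cnorm_embed v : cnorm (comp_embed v) = `[v].
Proof. by rewrite /cnorm /pnorm cdot_embed. Qed.

HB.instance Definition _ := Lmodule_isNormed.Build R[i] completion
  (pnormD cdot_psd) (pnormZ cdot_psd)
  (fun f (h : pnorm cdot f = 0) =>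
     cdot_eq0 (etrans (esym (pnorm_sqr cdot f)) (etrans (congr1 (fun c => c ^+ 2) h) (expr0n _
       _)))).

End CauchySequences.

Section CompletionHilbert.
Context {R : realType} {V : lmodType R[i]} (Q : V -> V -> R[i]).
Variable hQ : psd_form Q.
Local Notation completion := (completion_of hQ).

Lemma tends_shift (u : nat -> R[i]) l N : tends u l -> tends (fun n => u (n + N)%N) l.
Proof.
move=> ul e /ul[M h]; exists M => n Mn; apply: h.
exact: leq_trans Mn (leq_addr _ _).
Qed.

Lemma completion_normE (f : completion) : `|f| = pnorm (@cdot _ _ _ hQ) f.
Proof. by []. Qed.

Lemma represents_approx (f : completion) u : represents Q u (cfun f) ->
  forall e, 0 < e -> exists N, forall n, (N <= n)%N -> `|f - comp_embed hQ (u n)| < e.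
Proof.
move=> fu e e0; have e2 : 0 < e / 2 by rewrite divr_gt0.
have [N hN] := fu.1 _ e2; exists N => n Nn.
(* Limits preserve only weak inequalities, so the bound is proved with [e / 2]. *)
apply: (@le_lt_trans _ _ (e / 2)); last by rewrite ltr_pdivrMr // ltr_pMr // ltr1n.
apply: pnorm_le; [exact: cdot_psd|exact: ltW|].
have hr : represents Q (fun m => -1 *: u n + u m) (cfun (f - comp_embed hQ (u n))).
  have := represents_comb hQ (-1) (represents_cst hQ (u n)) fu.
  congr represents; apply/funext => w.
  by rewrite [f - _]addrC -(scaleN1r (comp_embed hQ (u n))) cfun_comb.
rewrite -subr_ge0.
have h := tendsD (tends_cst ((e / 2) ^+ 2)) (tendsZ (-1) (cdotP hr hr)).
rewrite mulN1r in h; apply: tends_ge0 (tends_shift N h) _ => m /=.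
rewrite mulN1r subr_ge0 scaleN1r addrC -pnorm_sqr.
rewrite ler_pXn2r ?nnegrE ?(pnorm_ge0 hQ) ?(ltW e2) //.
by apply/ltW/hN => //; exact: leq_addl.
Qed.

Lemma comp_embed_dense (f : completion) e : 0 < e ->
  exists v, `|f - comp_embed hQ v| < e.
Proof.
move=> e0; have [u hu] := cfunP f.
by have [N h] := represents_approx hu e0; exists (u N); exact: h.
Qed.

(** A diagonal argument: take points [x n] whose balls of radius [1/(n+1)] belong to [F], and
    vectors [v n] of the original space equally close to them. The sequence [v] is Cauchy, and the
    functional it represents is the limit. *)
Lemma completion_complete (F : set_system completion) :
  ProperFilter F -> cauchy F -> cvg F.
Proof.
move=> FF /cauchyP F_cauchy.
pose r (n : nat) : R[i] := n.+1%:R^-1.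
have r0 n : 0 < r n by rewrite invr_gt0 ltr0n.
have rlt e : 0 < e -> exists N, forall n, (N <= n)%N -> r n < e.
  move=> e0; have er : e = (complex.Re e)%:C%C by rewrite RRe_real // gtr0_real.
  have e0' : 0 < complex.Re e by rewrite -ltcR -er.
  exists (Num.truncn (complex.Re e)^-1) => n Nn.
  rewrite /r er -(rmorph_nat (real_complex R)) -fmorphV ltcR.
  rewrite invf_plt ?posrE ?ltr0n // (lt_le_trans (truncnS_gt _)) // ler_nat ltnS //.
have x_ex n : exists x, F (ball x (r n)) by exact: F_cauchy.
pose x n := sval (cid (x_ex n)).
have xP n : F (ball (x n) (r n)) := svalP (cid (x_ex n)).
have v_ex n := comp_embed_dense (x n) (r0 n).
pose v n := sval (cid (v_ex n)).
have vP n : `|x n - comp_embed hQ (v n)| < r n := svalP (cid (v_ex n)).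
have xx n m : `|x n - x m| < r n + r m.
  have [z []] := filter_ex (filterI (xP n) (xP m)).
  rewrite -!ball_normE /= => h1 h2; have -> : x n - x m = (x n - z) - (x m - z).
    by rewrite opprB addrA subrK.
  by apply: le_lt_trans (ler_normB _ _) _; exact: ltrD.
have cv : qcauchy Q v.
  move=> e e0; have e4 : 0 < e / 4 by rewrite divr_gt0.
  have [N hN] := rlt _ e4; exists N => n m nN mN.
  rewrite -(cnorm_embed hQ) -[cnorm _]completion_normE raddfB.
  have -> : comp_embed hQ (v n) - comp_embed hQ (v m) =
      (x m - comp_embed hQ (v m)) - (x n - comp_embed hQ (v n)) + (x n - x m).
    rewrite opprB addrA -(addrA (x m - _)) subrK addrAC [x m - _ - _]addrAC.
    by rewrite subrr add0r addrC.
  have -> : e = e / 4 + e / 4 + (e / 4 + e / 4) by field.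
  apply: le_lt_trans (ler_normD _ _) _; apply: ltrD.
    apply: le_lt_trans (ler_normB _ _) _.
    by apply: ltrD; [exact: lt_trans (vP m) (hN _ mN)|exact: lt_trans (vP n) (hN _ nN)].
  by apply: lt_trans (xx n m) _; rewrite ltrD ?hN.
have f_ex w : exists l, tends (fun n => Q (v n) w) l.
  exact: (qcauchy_form hQ cv (qcauchy_cst hQ w)).
have fP : represents Q v (fun w => sval (cid (f_ex w))).
  by split=> // w; exact: svalP (cid (f_ex w)).
pose f : completion := Completion hQ (ex_intro (fun u => represents Q u _) v fP).
apply/cvg_ex; exists f; apply/fcvgrPdist_lt => e e0.
have e3 : 0 < e / 3 by rewrite divr_gt0.
have [N hN] := rlt _ e3; have [M hM] := @represents_approx f v fP _ e3.
pose n := maxn N M; have := xP n; apply: filterS => y.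
rewrite -ball_normE /= => xy.
have -> : f - y = (f - comp_embed hQ (v n)) - (x n - comp_embed hQ (v n)) + (x n - y).
  by rewrite opprB !addrA !subrK.
have -> : e = e / 3 + e / 3 + e / 3 by field.
apply: le_lt_trans (ler_normD _ _) _; apply: ltrD.
  apply: le_lt_trans (ler_normB _ _) _; apply: ltrD; first by apply: hM; exact: leq_maxr.
  by apply: lt_trans (vP n) (hN _ _); exact: leq_maxl.
by apply: lt_trans xy (hN _ _); exact: leq_maxl.
Qed.

HB.instance Definition _ := Uniform_isComplete.Build completion completion_complete.

Lemma cdot_bilinear : bilinear_for *%R (Num.conj \; *%R) (@cdot _ _ _ hQ).
Proof.
by split=> [f a g h|f a g h]; [exact: cdot_linl|exact: (psd_linr (cdot_psd hQ))].
Qed.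
HB.instance Definition _ := bilinear_isBilinear.Build R[i] completion completion R[i]
  *%R (Num.conj \; *%R) (@cdot _ _ _ hQ) cdot_bilinear.
Lemma cdot_hermitian (f g : completion) :
  cdot f g = (-1) ^+ false * Num.conj (cdot g f).
Proof. by rewrite mul1r cdot_herm. Qed.
HB.instance Definition _ := isHermitianSesquilinear.Build R[i] completion false
  Num.conj (@cdot _ _ _ hQ) cdot_hermitian.
Lemma cdot_gt0 (f : completion) : f != 0 -> 0 < cdot f f.
Proof.
move=> f0; rewrite lt_def (psd_ge0 (cdot_psd hQ)) andbT.
by apply: contra_neq f0; exact: cdot_eq0.
Qed.
HB.instance Definition _ := isDotProduct.Build R[i] completion (@cdot _ _ _ hQ) cdot_gt0.

Lemma cdot_norm (f : completion) : cdot f f = `|f| ^+ 2.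
Proof. by rewrite completion_normE pnorm_sqr. Qed.

Definition completion_hilbert : hilbertSpace R :=
  @HilbertSpace R completion (@cdot _ _ _ hQ) cdot_norm.

End CompletionHilbert.

Theorem hilbert_completion (R : realType) (V : lmodType R[i]) (Q : V -> V -> R[i]) :
  psd_form Q ->
  exists (K : hilbertSpace R) (j : {linear V -> K}),
    (forall u v, hdot K (j u) (j v) = Q u v) /\
    forall (f : K) e, 0 < e -> exists v, `|f - j v| < e.
Proof.
move=> hQ; exists (completion_hilbert hQ), (comp_embed hQ); split=> [u v|f e e0].
  exact: (cdot_embed (comp_embed hQ u)).
exact: comp_embed_dense.
Qed.

(** * Bounded operators and their extension from dense subspaces *)

Section BoundedOperators.
Context {R : realType}.

Lemma bounded_continuous (K K' : normedModType R[i]) (T : {linear K -> K'}) c :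
  0 <= c -> (forall f, `|T f| <= c * `|f|) -> continuous T.
Proof.
move=> c0 hT f; apply/cvgrPdist_lt => e e0.
have c1 : 0 < c + 1 by rewrite ltr_wpDl.
have := nbhsx_ballx f (e / (c + 1)) (divr_gt0 e0 c1).
apply: filterS => g; rewrite -ball_normE /= ltr_pdivlMr // => fg.
rewrite -raddfB; apply: le_lt_trans (hT _) _; apply: le_lt_trans fg.
by rewrite mulrC ler_wpM2l // lerDl.
Qed.

Lemma continuous_bounded (K K' : normedModType R[i]) (T : {linear K -> K'}) :
  continuous T -> exists2 c, 0 <= c & forall f, `|T f| <= c * `|f|.
Proof.
move=> /(_ 0)/cvgrPdist_lt/(_ 1 ltr01); rewrite linear0 => /nbhs_ballP[d /= d0 hd].
exists (2 / d) => [|f]; first by rewrite divr_ge0 // ltW.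
have [->|f0] := eqVneq f 0; first by rewrite linear0 !normr0 mulr0.
have fp : 0 < `|f| by rewrite normr_gt0.
have kp : 0 < d / (2 * `|f|) by rewrite divr_gt0 // mulr_gt0.
have := hd ((d / (2 * `|f|)) *: f); rewrite -ball_normE /= sub0r normrN.
rewrite sub0r normrN linearZ /= !normrZ gtr0_norm //.
have -> : d / (2 * `|f|) * `|f| = d / 2 by field; rewrite gt_eqF.
move=> /(_ _)/ltW h; have := h _; rewrite ltr_pdivrMr // ltr_pMr // ltr1n.
move=> /(_ isT); rewrite -ler_pdivlMl //; congr (_ <= _).
by field; rewrite (gt_eqF d0) normr_eq0.
Qed.

(** The order of [R[i]] is partial; this quotient replaces the minimum of two positive numbers. *)
Lemma parallel_lt (d e : R[i]) : 0 < d -> 0 < e ->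
  d * e / (d + e) < d /\ d * e / (d + e) < e.
Proof.
move=> d0 e0; rewrite !ltr_pdivrMr ?addr_gt0 //; split.
  by rewrite mulrDr ltrDr mulr_gt0.
by rewrite mulrDr mulrC ltrDl mulr_gt0.
Qed.

(** The images under [L] of the sets of [u] with [j u] close to [f] form a Cauchy filter base, and
    [T f] is its limit. The map [j] may have a kernel, which the bound forces [L] to kill. *)
Lemma bounded_extension (K K' : completeNormedModType R[i]) (V : lmodType R[i])
    (j : {linear V -> K}) (L : {linear V -> K'}) c :
  0 <= c -> (forall (f : K) e, 0 < e -> exists v, `|f - j v| < e) ->
  (forall u, `|L u| <= c * `|j u|) ->
  exists T : {linear K -> K'},
    (forall f, `|T f| <= c * `|f|) /\ forall u, T (j u) = L u.
Proof.
move=> c0 jd hL; have c1 : 0 < c + 1 by rewrite ltr_wpDl.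
have hL1 u v e : 0 < e -> `|j u - j v| < e / (c + 1) -> `|L u - L v| < e.
  move=> e0; rewrite ltr_pdivlMr // -!raddfB => h.
  apply: le_lt_trans (hL _) _; apply: le_lt_trans h.
  by rewrite mulrC ler_wpM2l // lerDl.
have ex f : exists g : K', forall e, 0 < e -> exists2 d, 0 < d &
    forall u, `|f - j u| < d -> `|g - L u| < e.
  pose F := filter_from [set d : R[i] | 0 < d]
    (fun d => L @` [set u | `|f - j u| < d]).
  have FF : ProperFilter F.
    apply: filter_from_proper.
      apply: filter_from_filter; first by exists 1 => /=.
      move=> d d' /= d0 d'0; exists (d * d' / (d + d')).
        by rewrite /= divr_gt0 ?mulr_gt0 ?addr_gt0.
      have [h1 h2] := parallel_lt d0 d'0.
      move=> _ /= [u uh <-]; split; exists u => //; exact: lt_trans uh _.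
    by move=> d d0; have [u hu] := jd f d d0; exists (L u), u.
  have : cvg F.
    apply: cauchy_cvg; apply: cauchy_exP => e e0.
    have d0 : 0 < e / (c + 1) / 2 by rewrite !divr_gt0.
    have [v hv] := jd f _ d0; exists (L v), (e / (c + 1) / 2) => //.
    move=> _ [u /= hu <-]; rewrite -ball_normE /=; apply: hL1 => //.
    have -> : j v - j u = (f - j u) - (f - j v) by rewrite opprB [RHS]addrC addrA subrK.
    by rewrite [X in _ < X]splitr; apply: le_lt_trans (ler_normB _ _) _; exact: ltrD.
  move=> /cvg_ex[g /fcvgrPdist_lt hg]; exists g => e e0.
  by have [d d0 hd] := hg e e0; exists d => // u hu; apply: hd; exists u.
pose T f := sval (cid (ex f)).
have TP f : forall e, 0 < e -> exists2 d, 0 < d &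
    forall u, `|f - j u| < d -> `|T f - L u| < e := svalP (cid (ex f)).
have near2 f e : 0 < e -> exists u, `|f - j u| < e /\ `|T f - L u| < e.
  move=> e0; have [d d0 hd] := TP f e e0.
  have de0 : 0 < d * e / (d + e) by rewrite divr_gt0 ?mulr_gt0 ?addr_gt0.
  have [u hu] := jd f _ de0; exists u; split.
    exact: lt_trans hu (parallel_lt d0 e0).2.
  by apply: hd; exact: lt_trans hu (parallel_lt d0 e0).1.
have small0 (x : K') : (forall e, 0 < e -> `|x| < e) -> x = 0.
  move=> h; apply/eqP; rewrite -normr_eq0; apply/eqP; apply: small_eq0 => e e0.
  by rewrite normr_id; exact: h.
have Tj u : T (j u) = L u.
  apply/eqP; rewrite -subr_eq0; apply/eqP; apply: small0 => e e0.
  by have [d d0 hd] := TP (j u) e e0; apply: hd; rewrite subrr normr0.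
have Tlin : linear T.
  move=> a f g; apply/eqP; rewrite -subr_eq0; apply/eqP; apply: small0 => e e0.
  have a1 : 0 < `|a| + 1 by rewrite ltr_wpDl.
  have e2 : 0 < e / 2 by rewrite divr_gt0.
  have [d d0 hd] := TP (a *: f + g) _ e2.
  (* Errors below [m] in both arguments give an error below both [d] and [e / 2] in the combination
     with coefficient [a]. *)
  pose m := d * (e / 2) / (d + e / 2) / (`|a| + 1).
  have m0 : 0 < m by exact: divr_gt0 (divr_gt0 (mulr_gt0 d0 e2) (addr_gt0 d0 e2)) a1.
  have mE : (`|a| + 1) * m = d * (e / 2) / (d + e / 2).
    by rewrite /m mulrC divfK ?gt_eqF.
  have [md me] := parallel_lt d0 e2; rewrite -mE in md me.
  have comb (W : normedModType R[i]) (x y : W) : `|x| < m -> `|y| < m ->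
      `|a *: x + y| < (`|a| + 1) * m.
    move=> xm ym; apply: le_lt_trans (ler_normD _ _) _; rewrite normrZ mulrDl mul1r.
    by rewrite ler_ltD // ler_wpM2l // ltW.
  have [u [fu Tu]] := near2 f m m0; have [v [gv Tv]] := near2 g m m0.
  have /hd h : `|a *: f + g - j (a *: u + v)| < d.
    rewrite linearP opprD addrACA -scalerBr.
    by apply: lt_trans (comb _ _ _ fu gv) md.
  have := comb _ _ _ Tu Tv => h'.
  have -> : T (a *: f + g) - (a *: T f + T g) =
      (T (a *: f + g) - L (a *: u + v)) - (a *: (T f - L u) + (T g - L v)).
    have -> : a *: (T f - L u) + (T g - L v) = (a *: T f + T g) - L (a *: u + v).
      by rewrite scalerBr addrACA -opprD (linearP L).
    by rewrite opprB addrA subrK.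
  rewrite (splitr e); apply: le_lt_trans (ler_normB _ _) _.
  by apply: ltrD => //; exact: lt_trans h' me.
pose Tl : {linear K -> K'} := HB.pack T (GRing.isLinear.Build _ _ _ _ T Tlin).
exists Tl; split=> [f|u]; last exact: Tj.
rewrite -[Tl f]/(T f).
have key e : 0 < e -> `|T f| <= c * `|f| + e.
  move=> e0; have m0 : 0 < e / (c + 1) by rewrite divr_gt0.
  have [u [fu Tu]] := near2 f _ m0.
  rewrite -[T f](subrK (L u)); apply: le_trans (ler_normD _ _) _.
  have ju : `|j u| <= `|f| + e / (c + 1).
    rewrite -[j u](subrK f); apply: le_trans (ler_normD _ _) _.
    by rewrite addrC lerD2l distrC ltW.
  apply: le_trans (lerD (ltW Tu) (hL u)) _.
  apply: le_trans (lerD (lexx _) (ler_wpM2l c0 ju)) _.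
  by rewrite mulrDr addrCA lerD2l -[X in X + _]mul1r -mulrDl addrC mulrC divfK ?gt_eqF.
(* In a partial order, letting [e] tend to 0 requires the difference to be known to be real. *)
have re : `|T f| - c * `|f| \is Num.real.
  by rewrite rpredB ?normr_real // ger0_real // mulr_ge0.
rewrite -subr_le0; have [//|hp] := real_leP re (real0 _).
have /key : 0 < (`|T f| - c * `|f|) / 2 by rewrite divr_gt0.
rewrite -lerBlDl => h.
have : (`|T f| - c * `|f|) / 2 < `|T f| - c * `|f|.
  by rewrite ltr_pdivrMr // ltr_pMr // ltr1n.
by move=> /(le_lt_trans h); rewrite ltxx.
Qed.

End BoundedOperators.

(** * Approximate orthogonal projections *)

Section NearProjection.
Context {R : realType} {V W : lmodType R[i]}.
Variables (Q : V -> V -> R[i]) (hQ : psd_form Q) (L : W -> V).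
Hypothesis linL : forall a u v, L (a *: u + v) = a *: L u + L v.

Lemma near_orthogonal y z e : 0 <= e ->
  (forall t, Q y y <= Q (y - t *: z) (y - t *: z) + e ^+ 2) ->
  `|Q y z| <= e * pnorm Q z.
Proof.
move=> e0 h; have [w0|w0] := eqVneq (pnorm Q z) 0.
  by have := psd_cauchy_schwarz hQ y z; rewrite w0 !mulr0.
have wp : 0 < pnorm Q z by rewrite lt_def w0 pnorm_ge0.
(* This coefficient minimizes the distance from [y] to the multiples of [z]. *)
set q := Q y z; set n := pnorm Q z; have := h (q / n ^+ 2).
rewrite (psdBl hQ) !(psdBr hQ) !(psdZl hQ) !(psdZr hQ).
rewrite (psd_herm hQ y z) -(pnorm_sqr Q z) -/n -/q.
have nc : n^* = n by apply: CrealP; rewrite ger0_real // pnorm_ge0.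
have n2c : (n ^+ 2)^* = n ^+ 2 by rewrite rmorphXn /= nc.
rewrite fmorph_div /= n2c.
rewrite -!addrA lerDl -/n.
have -> : - (q^* / n ^+ 2 * q) + (- (q / n ^+ 2 * q^* - q / n ^+ 2 * (q^* / n ^+ 2 * n ^+ 2))
  + e ^+ 2)
  = e ^+ 2 - (`|q| / n) ^+ 2.
  rewrite expr_div_n normCK; field; exact: w0.
rewrite subr_ge0 ler_pXn2r ?nnegrE ?divr_ge0 ?pnorm_ge0 //.
by rewrite ler_pdivrMr.
Qed.

(** The range of [L] need not be closed, so [u] only minimizes the squared distance to [v] up to
    [e ^+ 2]. Comparison with [L 0] bounds [v - L u], hence [L u]; comparison with [u + t *: w]
    gives near orthogonality. *)
Lemma near_projection v e : 0 < e ->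
  exists u, pnorm Q (L u) <= pnorm Q v *+ 2 + e /\
    forall w, `|Q (v - L u) (L w)| <= e * pnorm Q (L w).
Proof.
move=> e0; pose f u : R := complex.Re (Q (v - L u) (v - L u)).
have fE u : Q (v - L u) (v - L u) = (f u)%:C%C.
  by rewrite RRe_real // ger0_real // psd_ge0.
have eE : e = (complex.Re e)%:C%C by rewrite RRe_real // gtr0_real.
have re0 : 0 < complex.Re e by move: e0; rewrite eE ltcR.
have L0 : L 0 = 0.
  by have := linL (-1) 0 0; rewrite scaler0 addr0 scaleN1r addNr.
have hS : has_inf (range f).
  split; first by exists (f 0), 0.
  by exists 0 => _ [u _ <-]; rewrite -lecR -fE; exact: psd_ge0.
have lbS u : inf (range f) <= f u by apply: ge_inf; [case: hS|exists u].
have [_ [u _ <-] hu] := inf_adherent (exprn_gt0 2 re0) hS.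
exists u; have near w : Q (v - L u) (v - L u) <= Q (v - L w) (v - L w) + e ^+ 2.
  rewrite !fE eE -rmorphXn -rmorphD lecR ltW //.
  by apply: lt_le_trans hu _; rewrite lerD2r.
have vu : pnorm Q (v - L u) <= pnorm Q v + e.
  apply: (pnorm_le hQ); first by rewrite addr_ge0 ?pnorm_ge0 // ltW.
  apply: le_trans (near 0) _; rewrite L0 subr0 -(pnorm_sqr Q v) sqrrD -addrAC lerDl.
  by rewrite mulrn_wge0 // mulr_ge0 ?pnorm_ge0 // ltW.
split=> [|w].
  rewrite -[L u](subKr v); apply: le_trans (pnormD hQ _ _) _.
  by rewrite (pnormN hQ) mulr2n -addrA lerD2l.
apply: (near_orthogonal (ltW e0)) => t; have := near (u + t *: w).
by rewrite [u + _]addrC linL opprD [- _ - L u]addrC addrA.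
Qed.

End NearProjection.

(** For [s >= 0] the distance from [S] to its modulus is at most twice the distance from [S] to [s].
    The restriction [e <= 1] allows error constants independent of [e]. *)
Lemma nearly_nonneg (R : realType) (S c : R[i]) : 0 <= c ->
  (forall e, 0 < e -> e <= 1 -> exists2 s, 0 <= s & `|S - s| <= e * c) -> 0 <= S.
Proof.
move=> c0 h; suff S0 : S - `|S| = 0 by move/eqP: S0; rewrite subr_eq0 => /eqP ->.
apply: small_eq0 => r r0; have cr : 0 < c *+ 2 + r by rewrite ltr_wpDl // mulrn_wge0.
have [|s s0 hs] := h (r / (c *+ 2 + r)) (divr_gt0 r0 cr).
  by rewrite ler_pdivrMr // mul1r lerDr mulrn_wge0.
have -> : S - `|S| = (S - s) + (`|s| - `|S|) by rewrite (ger0_norm s0) addrA subrK.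
apply: le_lt_trans (ler_normD _ _) _.
have : `|(`|s| - `|S|)| <= `|S - s| by rewrite [X in _ <= X]distrC; exact: ler_dist_dist.
move=> /(lerD (lexx `|S - s|)) /le_lt_trans; apply.
rewrite -mulr2n; apply: (@le_lt_trans _ _ ((r / (c *+ 2 + r) * c) *+ 2));
  first by rewrite lerMn2r.
by rewrite -mulrnAr mulrAC ltr_pdivrMr // ltr_pM2l // ltrDl.
Qed.

(** * Algebraic direct sums *)

Section DirectSumTheory.
Context {K : nzRingType} {T : choiceType} (V : T -> lmodType K).
Implicit Types x y : dsum V.

Lemma dsum_suml I (r : seq I) P (F : I -> dsum V) t :
  (\sum_(a <- r | P a) F a) t = \sum_(a <- r | P a) F a t.
Proof. by apply: (big_morph (fun x : dsum V => x t)). Qed.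

Lemma singleE t (v : V t) : single V t v t = v.
Proof. by rewrite /= /single_fun; case: eqP => // e; rewrite (eq_axiomK e). Qed.

Lemma single_neq t s (v : V t) : t != s -> single V t v s = 0.
Proof. by rewrite /= /single_fun; case: eqP. Qed.

Lemma singleP t a (u v : V t) :
  single V t (a *: u + v) = a *: single V t u + single V t v.
Proof.
apply: dsumP => s; have [e|ts] := eqVneq t s; last first.
  rewrite single_neq // -[RHS]/(a *: single V t u s + single V t v s) !single_neq //.
  by rewrite scaler0 addr0.
case: s / e; rewrite singleE -[RHS]/(a *: single V t u t + single V t v t).
by rewrite !singleE.
Qed.

Definition dsupp x : seq T := finmap.enum_fset (fset_set [set t | x t != 0]).

Lemma dsupp_uniq x : uniq (dsupp x). Proof. exact: finmap.fset_uniq. Qed.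

Lemma mem_dsupp x t : (t \in dsupp x) = (x t != 0).
Proof. by rewrite /dsupp in_fset_set ?inE ?mem_setE //; exact: dsum_finite. Qed.

Lemma dsum_expand x : x = \sum_(t <- dsupp x) single V t (x t).
Proof.
apply: dsumP => t; rewrite dsum_suml.
have [tx|] := boolP (t \in dsupp x).
  rewrite (bigD1_seq t) ?dsupp_uniq // big1 => [|s st]; last exact: single_neq.
  by rewrite -{1}(singleE (x t)) -[LHS]addr0.
move=> tx; rewrite big1_seq => [|s /= sx]; last first.
  by apply: single_neq; apply: contraNneq tx => <-.
by apply/eqP; rewrite -[_ == _]negbK -mem_dsupp.
Qed.

Lemma dsum_additive_eq (W : zmodType) (F G : dsum V -> W) :
  {morph F : x y / x + y} -> {morph G : x y / x + y} ->
  (forall t (v : V t), F (single V t v) = G (single V t v)) -> F =1 G.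
Proof.
move=> FD GD FG x.
have F0 : F 0 = 0 by apply: (addrI (F 0)); rewrite -FD !addr0.
have G0 : G 0 = 0 by apply: (addrI (G 0)); rewrite -GD !addr0.
rewrite (dsum_expand x) (big_morph F FD F0) (big_morph G GD G0).
by apply: eq_bigr => t _; exact: FG.
Qed.

Lemma dsupp_widen (W : nmodType) (F : T -> W) x s : uniq s -> {subset dsupp x <= s} ->
  (forall t, x t = 0 -> F t = 0) -> \sum_(t <- dsupp x) F t = \sum_(t <- s) F t.
Proof.
move=> us sub F0; rewrite [RHS](bigID (mem (dsupp x)) predT) /= [X in _ + X]big1 => [|t];
  last first.
  by rewrite mem_dsupp negbK => /eqP/F0.
rewrite addr0 -[RHS]big_filter; apply: perm_big.
apply: uniq_perm => [||t]; rewrite ?filter_uniq ?dsupp_uniq //.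
by rewrite mem_filter /=; case: (boolP (t \in dsupp x)) => // /sub ->.
Qed.

Section Lift.
Variables (W : lmodType K) (F : forall t, V t -> W).
Hypothesis linF : forall t a (u v : V t), F (a *: u + v) = a *: F u + F v.

Definition dlift x : W := \sum_(t <- dsupp x) F (x t).

Lemma dlift_widen x s : uniq s -> {subset dsupp x <= s} ->
  dlift x = \sum_(t <- s) F (x t).
Proof.
move=> us sub; apply: dsupp_widen => // t ->.
by have := linF (-1) (0 : V t) 0; rewrite scaler0 addr0 scaleN1r addNr.
Qed.

Lemma dlift_linear : linear dlift.
Proof.
move=> a x y; pose s := undup (dsupp x ++ dsupp y ++ dsupp (a *: x + y)).
have us : uniq s := undup_uniq _.
rewrite !(@dlift_widen _ s) // => [|t|t|t]; rewrite ?mem_undup ?mem_cat.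
- by rewrite scaler_sumr -big_split; apply: eq_bigr => t _; exact: linF.
- by move=> ->; rewrite ?orbT.
- by move=> ->; rewrite ?orbT.
- by move=> ->; rewrite ?orbT.
Qed.

Lemma dlift_single t (v : V t) : dlift (single V t v) = F v.
Proof.
rewrite (@dlift_widen _ [:: t]) ?big_seq1 ?singleE // => s.
rewrite mem_dsupp inE; apply: contraNT; rewrite eq_sym => ts.
by rewrite single_neq.
Qed.

End Lift.
End DirectSumTheory.

Local Open Scope sesquilinear_scope.

(** * Factorization of positive semidefinite matrices *)

Section PsdFactor.
Context {F : numClosedFieldType}.

Lemma psd_mx_factor n (S : 'M[F]_n) :
  (forall c : 'I_n -> F, 0 <= \sum_i \sum_j (c i)^* * S i j * c j) ->
  exists s : 'M[F]_n, forall i j, S i j = \sum_l (s l i)^* * s l j.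
Proof.
move=> pos; pose Q (u v : 'rV[F]_n) := \sum_i \sum_j (v 0 i)^* * S i j * u 0 j.
have hQ : psd_form Q.
  split=> [a u v w|a u v w|u]; last exact: pos.
    rewrite /Q mulr_sumr -big_split; apply: eq_bigr => i _ /=.
    rewrite mulr_sumr -big_split; apply: eq_bigr => j _ /=.
    by rewrite !mxE; ring.
  rewrite /Q mulr_sumr -big_split; apply: eq_bigr => i _ /=.
  rewrite mulr_sumr -big_split; apply: eq_bigr => j _ /=.
  by rewrite !mxE rmorphD rmorphM; ring.
have Qdelta i j : Q (delta_mx 0 j) (delta_mx 0 i) = S i j.
  rewrite /Q (bigD1 i) //= (bigD1 j) //= !mxE !eqxx rmorph1 mul1r mulr1.
  rewrite big1 ?addr0 => [|k kj]; last by rewrite mxE (negbTE kj) andbF mulr0.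
  rewrite big1 ?addr0 // => k ki; rewrite big1 // => l _.
  by rewrite mxE (negbTE ki) andbF rmorph0 !mul0r.
have herm i j : (S i j)^* = S j i by rewrite -!Qdelta -(psd_herm hQ).
have norm : S \is normalmx.
  suff e : S^t* = S by apply/normalmxP; rewrite e.
  by apply/matrixP => i j; rewrite !mxE herm.
have := elimT (orthomx_spectralP (A := S)) norm; set P := spectralmx S;
  set d := spectral_diag S.
have Pu : P \is unitarymx := spectral_unitarymx S.
rewrite invmx_unitary // => SE.
(* The eigenvalue of index [l] is the value of the form at the conjugate of row [l] of [P]. *)
have d0 l : 0 <= d 0 l.
  have := pos (fun i => (P l i)^*); congr (0 <= _).
  have -> : d 0 l = (P *m S *m P^t*) l l.
    have PP : P *m P^t* = 1%:M by exact/unitarymxP.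
    rewrite SE !mulmxA PP mul1mx -mulmxA PP mulmx1.
    by rewrite mxE eqxx.
  rewrite mxE; under [RHS]eq_bigr do rewrite !mxE mulr_suml.
  rewrite exchange_big; apply: eq_bigr => i _; apply: eq_bigr => j _.
  by rewrite conjCK.
exists (\matrix_(l, j) (sqrtC (d 0 l) * P l j)) => i j.
rewrite {1}SE mxE; apply: eq_bigr => l _; rewrite !mxE rmorphM /=.
have -> : (sqrtC (d 0 l))^* = sqrtC (d 0 l).
  by apply: CrealP; rewrite ger0_real // sqrtC_ge0.
rewrite (bigD1 l) //= big1 => [|k kl]; last by rewrite !mxE (negbTE kl) mulr0n mulr0.
by rewrite addr0 !mxE eqxx mulr1n mulrACA -expr2 sqrtCK; ring.
Qed.

Lemma psd_factor (J : finType) (S : J -> J -> F) :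
  (forall c : J -> F, 0 <= \sum_i \sum_j (c i)^* * S i j * c j) ->
  exists s : J -> J -> F, forall i j, S i j = \sum_l (s l i)^* * s l j.
Proof.
move=> pos; pose M := \matrix_(i < #|J|, j < #|J|) S (enum_val i) (enum_val j).
have [c|s hs] := @psd_mx_factor _ M.
  have := pos (fun i => c (enum_rank i)); congr (0 <= _).
  rewrite (reindex (fun i : 'I_#|J| => enum_val i)) /=; last exact: onW_bij (enum_val_bij J).
  apply: eq_bigr => i _.
  rewrite (reindex (fun i : 'I_#|J| => enum_val i)) /=; last exact: onW_bij (enum_val_bij J).
  by apply: eq_bigr => j _; rewrite mxE !enum_valK.
exists (fun l i => s (enum_rank l) (enum_rank i)) => i j.
have := hs (enum_rank i) (enum_rank j); rewrite mxE !enum_rankK => ->.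
rewrite (reindex (fun i : J => enum_rank i)) //=; exact: onW_bij (enum_rank_bij J).
Qed.

End PsdFactor.

(** * Tensor calculus up to rebracketing *)

Section TensorCalculus.
Context {R : realType} {C : cstarTensorCategory R}.
Implicit Types X Y Z W A B : C.
Local Notation hC := (ctc_cstar C).
Local Notation hT := (ctc_tensor C).

Lemma cmpA X Y Z W (h : Mor Z W) (g : Mor Y Z) (f : Mor X Y) :
  h ∘ (g ∘ f) = h ∘ g ∘ f. Proof. exact: (Defs.compA hC). Qed.
Lemma cmp1m X Y (f : Mor X Y) : idm Y ∘ f = f. Proof. exact: (comp1m hC). Qed.
Lemma cmpm1 X Y (f : Mor X Y) : f ∘ idm X = f. Proof. exact: (compm1 hC). Qed.
Lemma cmpDl X Y Z (g h : Mor Y Z) (f : Mor X Y) : (g + h) ∘ f = g ∘ f + h ∘ f.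
Proof. by have := comp_linearl hC 1 g h f; rewrite !scale1r. Qed.
Lemma cmpDr X Y Z (h : Mor Y Z) (f g : Mor X Y) : h ∘ (f + g) = h ∘ f + h ∘ g.
Proof. by have := comp_linearr hC 1 h f g; rewrite !scale1r. Qed.
Lemma cmp_suml X Y Z I (r : seq I) P (F : I -> Mor Y Z) (f : Mor X Y) :
  (\sum_(a <- r | P a) F a) ∘ f = \sum_(a <- r | P a) F a ∘ f.
Proof. exact: (comp_suml hC). Qed.
Lemma cmp_sumr X Y Z I (r : seq I) P (F : I -> Mor X Y) (f : Mor Y Z) :
  f ∘ (\sum_(a <- r | P a) F a) = \sum_(a <- r | P a) f ∘ F a.
Proof.
by apply: (big_morph (fun g => f ∘ g)) => [g h|]; [exact: cmpDr|exact: (compm0 hC)].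
Qed.
Lemma mZl X Y Z a (g : Mor Y Z) (f : Mor X Y) : (a *: g) ∘ f = a *: (g ∘ f).
Proof. exact: (compZm hC). Qed.
Lemma mZr X Y Z a (g : Mor Y Z) (f : Mor X Y) : g ∘ (a *: f) = a *: (g ∘ f).
Proof. exact: (compmZ hC). Qed.
Lemma m0l X Y Z (f : Mor X Y) : (0 : Mor Y Z) ∘ f = 0.
Proof. exact: (comp0m hC). Qed.
Lemma m0r X Y Z (f : Mor Y Z) : f ∘ (0 : Mor X Y) = 0.
Proof. exact: (compm0 hC). Qed.

Lemma madjK X Y (f : Mor X Y) : f^†^† = f. Proof. exact: (adjK hC). Qed.
Lemma madjM X Y Z (g : Mor Y Z) (f : Mor X Y) : (g ∘ f)^† = f^† ∘ g^†.
Proof. exact: (adj_comp hC). Qed.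
Lemma madj1 X : (idm X)^† = idm X. Proof. exact: (adj_idm hC). Qed.
Lemma madjD X Y (f g : Mor X Y) : (f + g)^† = f^† + g^†.
Proof. by have := adj_antilinear hC 1 f g; rewrite rmorph1 !scale1r. Qed.
Lemma madj0 X Y : (0 : Mor X Y)^† = 0. Proof. exact: (adj0 hC). Qed.
Lemma madjZ X Y a (f : Mor X Y) : (a *: f)^† = Num.conj a *: f^†.
Proof. by have := adj_antilinear hC a f 0; rewrite madj0 !addr0. Qed.
Lemma madj_sum X Y I (r : seq I) P (F : I -> Mor X Y) :
  (\sum_(a <- r | P a) F a)^† = \sum_(a <- r | P a) (F a)^†.
Proof.
by apply: (big_morph (fun g => g^†)) => [g h|]; [exact: madjD|exact: madj0].
Qed.
Lemma madj_inj X Y (f g : Mor X Y) : f^† = g^† -> f = g.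
Proof. by move=> /(congr1 (fun h => h^†)); rewrite !madjK. Qed.

Lemma mt1 X Y : idm X ⊠ idm Y = idm (X ⊗ Y). Proof. exact: (tensm_id hT). Qed.
Lemma mtM X X' X'' Y Y' Y'' (f' : Mor X' X'') (f : Mor X X')
    (g' : Mor Y' Y'') (g : Mor Y Y') :
  (f' ∘ f) ⊠ (g' ∘ g) = (f' ⊠ g') ∘ (f ⊠ g).
Proof. exact: (tensm_comp hT f' f g' g). Qed.
Lemma mtadj X X' Y Y' (f : Mor X X') (g : Mor Y Y') : (f ⊠ g)^† = f^† ⊠ g^†.
Proof. exact: (tensm_adj hT). Qed.
Lemma mtDl X X' Y Y' (f g : Mor X X') (h : Mor Y Y') : (f + g) ⊠ h = f ⊠ h + g ⊠ h.
Proof. by have := tensm_linearl hT 1 f g h; rewrite !scale1r. Qed.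
Lemma mtDr X X' Y Y' (h : Mor X X') (f g : Mor Y Y') : h ⊠ (f + g) = h ⊠ f + h ⊠ g.
Proof. by have := tensm_linearr hT 1 h f g; rewrite !scale1r. Qed.
Lemma mt0l X X' Y Y' (h : Mor Y Y') : (0 : Mor X X') ⊠ h = 0.
Proof. exact: (tens0m hT). Qed.
Lemma mt0r X X' Y Y' (h : Mor X X') : h ⊠ (0 : Mor Y Y') = 0.
Proof. exact: (tensm0 hT). Qed.
Lemma mtZl X X' Y Y' a (f : Mor X X') (h : Mor Y Y') : (a *: f) ⊠ h = a *: (f ⊠ h).
Proof. by have := tensm_linearl hT a f 0 h; rewrite mt0l !addr0. Qed.
Lemma mtZr X X' Y Y' a (f : Mor X X') (h : Mor Y Y') : h ⊠ (a *: f) = a *: (h ⊠ f).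
Proof. by have := tensm_linearr hT a h f 0; rewrite mt0r !addr0. Qed.
Lemma mt_suml X X' Y Y' I (r : seq I) P (F : I -> Mor X X') (h : Mor Y Y') :
  (\sum_(a <- r | P a) F a) ⊠ h = \sum_(a <- r | P a) F a ⊠ h.
Proof.
by apply: (big_morph (fun g => g ⊠ h)) => [f g|]; [exact: mtDl|exact: mt0l].
Qed.
Lemma mt_sumr X X' Y Y' I (r : seq I) P (F : I -> Mor Y Y') (h : Mor X X') :
  h ⊠ (\sum_(a <- r | P a) F a) = \sum_(a <- r | P a) h ⊠ F a.
Proof.
by apply: (big_morph (fun g => h ⊠ g)) => [f g|]; [exact: mtDr|exact: mt0r].
Qed.
Lemma mtMl X Y Z W (g : Mor Y Z) (f : Mor X Y) :
  (g ∘ f) ⊠ idm W = (g ⊠ idm W) ∘ (f ⊠ idm W).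
Proof. by rewrite -mtM cmp1m. Qed.
Lemma mtMr X Y Z W (g : Mor Y Z) (f : Mor X Y) :
  idm W ⊠ (g ∘ f) = (idm W ⊠ g) ∘ (idm W ⊠ f).
Proof. by rewrite -mtM cmp1m. Qed.
Lemma mt_xch X X' Y Y' (f : Mor X X') (g : Mor Y Y') :
  (f ⊠ idm Y') ∘ (idm X ⊠ g) = (idm X' ⊠ g) ∘ (f ⊠ idm Y).
Proof. by rewrite -!mtM !cmp1m !cmpm1. Qed.
Lemma mt_split X X' Y Y' (f : Mor X X') (g : Mor Y Y') :
  f ⊠ g = (f ⊠ idm Y') ∘ (idm X ⊠ g).
Proof. by rewrite -mtM cmp1m cmpm1. Qed.
Lemma mt_split' X X' Y Y' (f : Mor X X') (g : Mor Y Y') :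
  f ⊠ g = (idm X' ⊠ g) ∘ (f ⊠ idm Y).
Proof. by rewrite -mtM cmp1m cmpm1. Qed.

Lemma eqm1 X (e : X = X) : eqm e = idm X. Proof. exact: eqm_id. Qed.
Lemma eqmM X Y Z (e : X = Y) (e' : Y = Z) : eqm e' ∘ eqm e = eqm (etrans e e').
Proof. by case: Z / e'; rewrite cmp1m. Qed.
Lemma eqm_irr X Y (e e' : X = Y) : eqm e = eqm e' :> Mor X Y.
Proof. by rewrite (Prop_irrelevance e e'). Qed.
Lemma eqmVK X Y (e : X = Y) (e' : Y = X) : eqm e ∘ eqm e' = idm Y.
Proof. by rewrite eqmM eqm1. Qed.
Lemma eqmadj X Y (e : X = Y) : (eqm e)^† = eqm (esym e).
Proof. exact: (eqm_adj hC). Qed.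
Lemma mt_eqmr X X' Z (e : X = X') (e' : Z ⊗ X = Z ⊗ X') : idm Z ⊠ eqm e = eqm e'.
Proof. by case: X' / e e' => e'; rewrite !eqm1 mt1. Qed.

(* [wh eS eT f] is f ⊗ 1_Z, with source and target rebracketed to S and T.
   Bracketing to the right everywhere, as in the functors X ⊗ -, makes the
   associativity identifications disappear from all computations below. *)
Fact wh_key : unit. Proof. by []. Qed.
Definition wh X Y Z S T (eS : X ⊗ Z = S) (eT : Y ⊗ Z = T) (f : Mor X Y) : Mor S T :=
  locked_with wh_key (eqm eT ∘ (f ⊠ idm Z) ∘ eqm (esym eS)).

Lemma wh_def X Y Z S T (eS : X ⊗ Z = S) (eT : Y ⊗ Z = T) (f : Mor X Y) :
  wh eS eT f = eqm eT ∘ (f ⊠ idm Z) ∘ eqm (esym eS).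
Proof. by rewrite /wh unlock. Qed.

Lemma whE X Y Z S T (eS : X ⊗ Z = S) (eT : Y ⊗ Z = T) (f : Mor X Y) :
  wh eS eT f ∘ eqm eS = eqm eT ∘ (f ⊠ idm Z).
Proof. by rewrite wh_def -!cmpA eqmVK cmpm1. Qed.

Lemma whM X Y Z W S T U (eS : X ⊗ W = S) (eT : Y ⊗ W = T) (eU : Z ⊗ W = U)
  (g : Mor Y Z) (f : Mor X Y) : wh eS eU (g ∘ f) = wh eT eU g ∘ wh eS eT f.
Proof.
case: S / eS; case: T / eT; case: U / eU.
by rewrite !wh_def /= !cmp1m !cmpm1 mtMl.
Qed.

Lemma whadj X Y Z S T (eS : X ⊗ Z = S) (eT : Y ⊗ Z = T) (f : Mor X Y) :
  (wh eS eT f)^† = wh eT eS f^†.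
Proof.
case: S / eS; case: T / eT.
by rewrite !wh_def /= !cmp1m !cmpm1 mtadj madj1.
Qed.

Lemma wh1 X Z S (eS eS' : X ⊗ Z = S) : wh eS eS' (idm X) = idm S.
Proof. by case: S / eS eS' => eS'; rewrite !wh_def /= eqm1 !cmp1m !cmpm1 mt1. Qed.

Lemma whD X Y Z S T (eS : X ⊗ Z = S) (eT : Y ⊗ Z = T) (f g : Mor X Y) :
  wh eS eT (f + g) = wh eS eT f + wh eS eT g.
Proof. by rewrite !wh_def mtDl cmpDr cmpDl. Qed.

Lemma whZ X Y Z S T (eS : X ⊗ Z = S) (eT : Y ⊗ Z = T) a (f : Mor X Y) :
  wh eS eT (a *: f) = a *: wh eS eT f.
Proof. by rewrite !wh_def mtZl mZr mZl. Qed.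

Lemma wh_xch X Y Z Z' S T S' T' (eS : X ⊗ Z = S) (eT : Y ⊗ Z = T)
   (eS' : X ⊗ Z' = S') (eT' : Y ⊗ Z' = T') (f : Mor X Y) (g : Mor Z Z') :
  wh eS' eT' f ∘ (eqm eS' ∘ (idm X ⊠ g) ∘ eqm (esym eS)) =
  (eqm eT' ∘ (idm Y ⊠ g) ∘ eqm (esym eT)) ∘ wh eS eT f.
Proof.
case: S / eS; case: T / eT; case: S' / eS'; case: T' / eT'.
by rewrite !wh_def /= !cmp1m !cmpm1 mt_xch.
Qed.

Lemma tensA_conj A B Z Z' (g : Mor Z Z') :
  eqm (tensA A B Z') ∘ (idm (A ⊗ B) ⊠ g) ∘ eqm (esym (tensA A B Z)) =
  idm A ⊠ (idm B ⊠ g).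
Proof. by rewrite -mt1 (tensmA hT) -cmpA eqmVK cmpm1. Qed.

Lemma tens1_conj Z Z' (g : Mor Z Z') :
  eqm (tens1o Z') ∘ (idm tunit ⊠ g) ∘ eqm (esym (tens1o Z)) = g.
Proof. by rewrite (tensm1o hT) -cmpA eqmVK cmpm1. Qed.

Definition cup A B (u : Mor tunit (A ⊗ B)) Z : Mor Z (A ⊗ (B ⊗ Z)) :=
  wh (tens1o Z) (tensA A B Z) u.
Definition cap A B (u : Mor tunit (A ⊗ B)) Z : Mor (A ⊗ (B ⊗ Z)) Z :=
  wh (tensA A B Z) (tens1o Z) u^†.
(** In [w12], [w21] and [w22] the digits count the tensor factors of the source and of the target of
    [f]. *)
Definition w12 A Y B (f : Mor A (Y ⊗ B)) Z : Mor (A ⊗ Z) (Y ⊗ (B ⊗ Z)) :=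
  wh erefl (tensA Y B Z) f.
Definition w21 A Y B (f : Mor (Y ⊗ B) A) Z : Mor (Y ⊗ (B ⊗ Z)) (A ⊗ Z) :=
  wh (tensA Y B Z) erefl f.
Definition w22 A B A' B' (f : Mor (A ⊗ B) (A' ⊗ B')) Z :
    Mor (A ⊗ (B ⊗ Z)) (A' ⊗ (B' ⊗ Z)) :=
  wh (tensA A B Z) (tensA A' B' Z) f.

Lemma wh_erefl X Y Z (f : Mor X Y) : wh erefl erefl f = f ⊠ idm Z.
Proof. by rewrite !wh_def /= cmp1m cmpm1. Qed.

Lemma cup_adj A B (u : Mor tunit (A ⊗ B)) Z : (cup u Z)^† = cap u Z.
Proof. exact: whadj. Qed.
Lemma cap_adj A B (u : Mor tunit (A ⊗ B)) Z : (cap u Z)^† = cup u Z.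
Proof. by rewrite -cup_adj madjK. Qed.
Lemma w12_adj A Y B (f : Mor A (Y ⊗ B)) Z : (w12 f Z)^† = w21 f^† Z.
Proof. exact: whadj. Qed.
Lemma w21_adj A Y B (f : Mor (Y ⊗ B) A) Z : (w21 f Z)^† = w12 f^† Z.
Proof. exact: whadj. Qed.
Lemma w22_adj A B A' B' (f : Mor (A ⊗ B) (A' ⊗ B')) Z : (w22 f Z)^† = w22 f^† Z.
Proof. exact: whadj. Qed.

Lemma cup_nat A B (u : Mor tunit (A ⊗ B)) Z Z' (g : Mor Z Z') :
  cup u Z' ∘ g = (idm A ⊠ (idm B ⊠ g)) ∘ cup u Z.
Proof.
have := wh_xch (tens1o Z) (tensA A B Z) (tens1o Z') (tensA A B Z') u g.
by rewrite tensA_conj tens1_conj.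
Qed.
Lemma cap_nat A B (u : Mor tunit (A ⊗ B)) Z Z' (g : Mor Z Z') :
  cap u Z' ∘ (idm A ⊠ (idm B ⊠ g)) = g ∘ cap u Z.
Proof.
have := wh_xch (tensA A B Z) (tens1o Z) (tensA A B Z') (tens1o Z') u^† g.
by rewrite tensA_conj tens1_conj.
Qed.
Lemma w12_nat A Y B (f : Mor A (Y ⊗ B)) Z Z' (g : Mor Z Z') :
  w12 f Z' ∘ (idm A ⊠ g) = (idm Y ⊠ (idm B ⊠ g)) ∘ w12 f Z.
Proof.
have := wh_xch erefl (tensA Y B Z) erefl (tensA Y B Z') f g.
by rewrite tensA_conj /= cmp1m cmpm1.
Qed.
Lemma w21_nat A Y B (f : Mor (Y ⊗ B) A) Z Z' (g : Mor Z Z') :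
  w21 f Z' ∘ (idm Y ⊠ (idm B ⊠ g)) = (idm A ⊠ g) ∘ w21 f Z.
Proof.
have := wh_xch (tensA Y B Z) erefl (tensA Y B Z') erefl f g.
by rewrite tensA_conj /= cmp1m cmpm1.
Qed.
Lemma w22_nat A B A' B' (f : Mor (A ⊗ B) (A' ⊗ B')) Z Z' (g : Mor Z Z') :
  w22 f Z' ∘ (idm A ⊠ (idm B ⊠ g)) = (idm A' ⊠ (idm B' ⊠ g)) ∘ w22 f Z.
Proof.
have := wh_xch (tensA A B Z) (tensA A' B' Z) (tensA A B Z') (tensA A' B' Z') f g.
by rewrite !tensA_conj.
Qed.

Lemma w22_tens A B A' B' (f : Mor A A') (g : Mor B B') Z :
  w22 (f ⊠ g) Z = f ⊠ (g ⊠ idm Z).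
Proof. by rewrite /w22 wh_def (tensmA hT) -cmpA eqmVK cmpm1. Qed.

Lemma wh_wh X Y Z S T Z' U U' (eS : X ⊗ Z = S) (eT : Y ⊗ Z = T)
    (eU : S ⊗ Z' = U) (eU' : T ⊗ Z' = U') (e1 : X ⊗ (Z ⊗ Z') = U)
    (e2 : Y ⊗ (Z ⊗ Z') = U') (f : Mor X Y) :
  wh eU eU' (wh eS eT f) = wh e1 e2 f.
Proof.
case: S / eS eU => eU; case: T / eT eU' => eU'; rewrite wh_erefl.
have := tensmA hT f (idm Z) (idm Z'); rewrite mt1.
case: U / eU e1 => e1; case: U' / eU' e2 => e2; rewrite wh_erefl => h.
rewrite !wh_def (eqm_irr e2 (esym (tensA Y Z Z'))) (eqm_irr (esym e1) (tensA X Z Z')).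
by rewrite -cmpA -h cmpA eqmVK cmp1m.
Qed.

End TensorCalculus.

(** * Duality and Frobenius reciprocity *)

Section Duality.
Context {R : realType} {C : cstarTensorCategory R}.
Implicit Types X Y Z W A B P Q : C.
Local Notation hT := (ctc_tensor C).

Definition capm A X (h : Mor (A ⊗ X) tunit) Z : Mor (A ⊗ (X ⊗ Z)) Z :=
  wh (tensA A X Z) (tens1o Z) h.

Lemma capm_nat A X (h : Mor (A ⊗ X) tunit) Z Z' (g : Mor Z Z') :
  capm h Z' ∘ (idm A ⊠ (idm X ⊠ g)) = g ∘ capm h Z.
Proof.
have := wh_xch (tensA A X Z) (tens1o Z) (tensA A X Z') (tens1o Z') h g.
by rewrite tensA_conj tens1_conj.
Qed.

Lemma wh_tens A A' X Y Z S S' T T' (eS : (A ⊗ X) ⊗ Z = A ⊗ S')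
    (eT : (A' ⊗ Y) ⊗ Z = A' ⊗ T') (eS' : X ⊗ Z = S') (eT' : Y ⊗ Z = T')
    (a : Mor A A') (f : Mor X Y) (eU : A ⊗ S' = S) (eU' : A' ⊗ T' = T) :
  wh eS eT (a ⊠ f) = a ⊠ wh eS' eT' f.
Proof.
case: S' / eS' eS eU => eS _; case: T' / eT' eT eU' => eT _.
rewrite wh_erefl wh_def (eqm_irr eT (tensA _ _ _)) (eqm_irr (esym eS) (esym (tensA _ _ _))).
by rewrite (tensmA hT) -cmpA eqmVK cmpm1.
Qed.

Lemma wh_tensl A X Y Z S' T' (eS : (A ⊗ X) ⊗ Z = A ⊗ S')
    (eT : (A ⊗ Y) ⊗ Z = A ⊗ T') (eS' : X ⊗ Z = S') (eT' : Y ⊗ Z = T') (f : Mor X Y) :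
  wh eS eT (idm A ⊠ f) = idm A ⊠ wh eS' eT' f.
Proof. exact: wh_tens. Qed.

Lemma wh_eqm X Y Z S T (eS : X ⊗ Z = S) (eT : Y ⊗ Z = T) (e : X = Y) (e' : S = T) :
  wh eS eT (eqm e) = eqm e'.
Proof.
case: Y / e eT => eT; case: S / eS e' => e'; case: T / e' eT => eT.
by rewrite eqm1 wh1 eqm1.
Qed.

Lemma wh_eqmr X Y Z S T S' (eS : X ⊗ Z = S) (eT : Y ⊗ Z = T) (eS' : X ⊗ Z = S')
   (e : S' = S) (f : Mor X Y) : wh eS eT f ∘ eqm e = wh eS' eT f.
Proof. by case: S / e eS => eS; rewrite cmpm1 (Prop_irrelevance eS eS'). Qed.

Lemma wh_eqml X Y Z S T T' (eS : X ⊗ Z = S) (eT : Y ⊗ Z = T) (eT' : Y ⊗ Z = T')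
   (e : T = T') (f : Mor X Y) : eqm e ∘ wh eS eT f = wh eS eT' f.
Proof. by case: T' / e eT' => eT'; rewrite cmp1m (Prop_irrelevance eT eT'). Qed.

Lemma wh_unit X Y (f : Mor X Y) : wh (tenso1 X) (tenso1 Y) f = f.
Proof.
have := tensmo1 hT f => h; rewrite wh_def h -cmpA eqmVK cmpm1 //.
Qed.

Lemma wh_unitE X Y S T (eS : X ⊗ tunit = S) (eT : Y ⊗ tunit = T) (e : S = X) (e' : Y = T)
  (f : Mor X Y) : wh eS eT f = eqm e' ∘ f ∘ eqm e.
Proof.
case: T / e' eT => eT; case: X / e eS f => eS f.
by rewrite cmp1m cmpm1 (Prop_irrelevance eS (tenso1 S)) (Prop_irrelevance eT (tenso1 Y))
  wh_unit.
Qed.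

(** One of the two conjugate equations, in right-bracketed form; [conj_zz] makes the translation. *)
Definition zz P P' (u : Mor tunit (P ⊗ P')) (u' : Mor tunit (P' ⊗ P)) :=
  cap u P ∘ (idm P ⊠ u') = eqm (tenso1 P).

Lemma conj_zz X Xb (r : Mor tunit (Xb ⊗ X)) (rb : Mor tunit (X ⊗ Xb)) :
  conjugate_eqs r rb <-> zz r rb /\ zz rb r.
Proof.
suff eq P P' (u : Mor tunit (P ⊗ P')) (u' : Mor tunit (P' ⊗ P)) :
    zz u u' <-> eqm (tens1o P) ∘ (u^† ⊠ idm P) ∘ eqm (esym (tensA P P' P))
    ∘ (idm P ⊠ u') ∘ eqm (esym (tenso1 P)) = idm P.
  by rewrite /conjugate_eqs -!eq.
rewrite /zz /cap wh_def; split=> [->|h].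
  by rewrite eqmVK.
have := congr1 (fun f => f ∘ eqm (tenso1 P)) h.
by rewrite /= -!cmpA eqmVK cmpm1 cmp1m.
Qed.

Lemma conj_swap X Xb (r : Mor tunit (Xb ⊗ X)) (rb : Mor tunit (X ⊗ Xb)) :
  conjugate_eqs r rb -> conjugate_eqs rb r.
Proof. by case. Qed.

Lemma zz_adj P P' (u : Mor tunit (P ⊗ P')) (u' : Mor tunit (P' ⊗ P)) :
  zz u u' -> (idm P ⊠ u'^†) ∘ cup u P = eqm (esym (tenso1 P)).
Proof.
move=> /(congr1 (fun f => f^†)).
by rewrite madjM cap_adj mtadj madj1 eqmadj.
Qed.

Lemma zag P P' (u : Mor tunit (P ⊗ P')) (u' : Mor tunit (P' ⊗ P)) Z :
  zz u u' -> cap u (P ⊗ Z) ∘ (idm P ⊠ cup u' Z) = idm (P ⊗ Z).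
Proof.
move=> h.
have e1 : (P ⊗ tunit) ⊗ Z = P ⊗ Z by rewrite tenso1.
have e2 : (P ⊗ (P' ⊗ P)) ⊗ Z = P ⊗ (P' ⊗ (P ⊗ Z)) by rewrite !tensA.
have := congr1 (wh e1 erefl) h; rewrite (wh_eqm _ _ _ erefl) /= => <-.
rewrite (whM _ e2) (wh_tensl _ _ (tens1o Z) (tensA P' P Z)); congr comp.
by rewrite (wh_wh _ _ _ _ (tensA P P' (P ⊗ Z)) (tens1o (P ⊗ Z))).
Qed.

Lemma zig P P' (u : Mor tunit (P ⊗ P')) (u' : Mor tunit (P' ⊗ P)) Z :
  zz u u' -> (idm P ⊠ cap u' Z) ∘ cup u (P ⊗ Z) = idm (P ⊗ Z).
Proof.
move=> /(zag Z) /(congr1 (fun f => f^†)).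
by rewrite madjM cap_adj mtadj !madj1 cup_adj.
Qed.

Section Transpose.
Variables (X Xb : C) (r : Mor tunit (Xb ⊗ X)) (rb : Mor tunit (X ⊗ Xb)).
Hypothesis cr : conjugate_eqs r rb.

(** The right-hand side depends on [w] only through its transpose, so this formula is a left inverse
    of transposition. *)
Lemma transpose_l_inj A (w : Mor A Xb) :
  w = capm (r^† ∘ (w ⊠ idm X)) Xb ∘ (idm A ⊠ rb) ∘ eqm (esym (tenso1 A)).
Proof.
have [/conj_zz [z1 z2]] := conj cr I.
rewrite /capm (whM _ (tensA Xb X Xb)) -[wh _ _ (w ⊠ _)]/(w22 _ _) w22_tens.
rewrite -!cmpA (cmpA (w ⊠ _)) mt1 mt_xch -/(cap r Xb).
have -> : w ⊠ idm tunit = eqm (esym (tenso1 Xb)) ∘ w ∘ eqm (tenso1 A).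
  rewrite -cmpA -(tensmo1 hT) cmpA eqmVK cmp1m //.
by rewrite -!cmpA eqmVK cmpm1 !cmpA z1 eqmVK cmp1m.
Qed.

Lemma transpose_l_ex A (h : Mor (A ⊗ X) tunit) : exists w : Mor A Xb, h = r^† ∘ (w ⊠ idm X).
Proof.
have [/conj_zz [z1 z2]] := conj cr I.
exists (capm h Xb ∘ (idm A ⊠ rb) ∘ eqm (esym (tenso1 A))).
have e0 : (A ⊗ tunit) ⊗ X = A ⊗ X by rewrite tenso1.
have e1 : (A ⊗ (X ⊗ Xb)) ⊗ X = A ⊗ (X ⊗ (Xb ⊗ X)) by rewrite !tensA.
rewrite -wh_erefl (whM _ e0) (whM _ e1) (wh_eqm _ _ _ erefl) /= cmpm1.
rewrite (wh_tensl _ _ (tens1o X) (tensA X Xb X)) -[wh _ _ rb]/(cup rb X).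
rewrite (wh_wh _ _ _ _ (tensA A X (Xb ⊗ X)) (tens1o (Xb ⊗ X))) -[wh _ _ h]/(capm h _).
rewrite !cmpA -capm_nat -cmpA -mtMr (zz_adj z2).
rewrite (mt_eqmr _ (congr1 (tens A) (esym (tenso1 X)))) /capm.
have e : A ⊗ X = A ⊗ (X ⊗ tunit) by rewrite tenso1.
by rewrite (wh_eqmr _ _ (tenso1 (A ⊗ X))) (Prop_irrelevance (tens1o tunit) (tenso1 tunit))
  wh_unit.
Qed.

Lemma transpose_l_uniq A (w w' : Mor A Xb) :
  r^† ∘ (w ⊠ idm X) = r^† ∘ (w' ⊠ idm X) -> w = w'.
Proof. by move=> h; rewrite (transpose_l_inj w) h -transpose_l_inj. Qed.

Lemma transpose_r_inj A (w : Mor A X) :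
  w = eqm (tenso1 X) ∘ (idm X ⊠ (r^† ∘ (idm Xb ⊠ w))) ∘ cup rb A.
Proof.
have [/conj_zz [z1 z2]] := conj cr I.
by rewrite mtMr -!cmpA -cup_nat (cmpA _ _ w) (zz_adj z2) cmpA eqmVK cmp1m.
Qed.

Lemma transpose_r_ex A (h : Mor (Xb ⊗ A) tunit) : exists w : Mor A X, h = r^† ∘ (idm Xb ⊠ w).
Proof.
have [/conj_zz [z1 z2]] := conj cr I.
exists (eqm (tenso1 X) ∘ (idm X ⊠ h) ∘ cup rb A).
rewrite !mtMr !cmpA.
have e : Xb ⊗ (X ⊗ tunit) = Xb ⊗ X by rewrite tenso1.
rewrite (mt_eqmr _ e).
have -> : r^† ∘ eqm e = cap r tunit.
  by rewrite /cap (wh_unitE _ _ e erefl) cmp1m.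
by rewrite cap_nat -cmpA zag // cmpm1.
Qed.

Lemma transpose_r_uniq A (w w' : Mor A X) :
  r^† ∘ (idm Xb ⊠ w) = r^† ∘ (idm Xb ⊠ w') -> w = w'.
Proof. by move=> h; rewrite (transpose_r_inj w) h -transpose_r_inj. Qed.

Lemma cotranspose_l_ex A (h : Mor tunit (A ⊗ X)) : exists w : Mor Xb A, h = (w ⊠ idm X) ∘ r.
Proof.
have [w hw] := transpose_l_ex h^†; exists w^†.
by apply: madj_inj; rewrite madjM mtadj madj1 madjK.
Qed.

Lemma cotranspose_r_ex A (h : Mor tunit (Xb ⊗ A)) : exists w : Mor X A, h = (idm Xb ⊠ w) ∘ r.
Proof.
have [w hw] := transpose_r_ex h^†; exists w^†.
by apply: madj_inj; rewrite madjM mtadj madj1 madjK.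
Qed.

End Transpose.

(** The cup [v] inside the cup [u]: the usual solution of the conjugate equations for a tensor
    product of objects. *)
Definition nest P P' Q Q' (u : Mor tunit (P ⊗ P')) (v : Mor tunit (Q ⊗ Q')) :
    Mor tunit ((P ⊗ Q) ⊗ (Q' ⊗ P')) :=
  eqm (esym (tensA P Q (Q' ⊗ P'))) ∘ (idm P ⊠ cup v P') ∘ u.

Lemma nest_assoc P P' Q Q' Z :
  P ⊗ (Q ⊗ (Q' ⊗ (P' ⊗ Z))) = (P ⊗ Q) ⊗ ((Q' ⊗ P') ⊗ Z).
Proof. by rewrite !tensA. Qed.

Lemma cup_nest P P' Q Q' (u : Mor tunit (P ⊗ P')) (v : Mor tunit (Q ⊗ Q')) Z :
  cup (nest u v) Z =
  eqm (nest_assoc P P' Q Q' Z) ∘ (idm P ⊠ cup v (P' ⊗ Z)) ∘ cup u Z.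
Proof.
have e1 : (P ⊗ (Q ⊗ (Q' ⊗ P'))) ⊗ Z = P ⊗ (Q ⊗ (Q' ⊗ (P' ⊗ Z))) by rewrite !tensA.
have e2 : (Q ⊗ (Q' ⊗ P')) ⊗ Z = Q ⊗ (Q' ⊗ (P' ⊗ Z)) by rewrite !tensA.
rewrite /cup /nest (whM _ (tensA P P' Z)) (whM _ e1).
rewrite (wh_tensl _ _ erefl e2) (wh_eqm _ _ _ (nest_assoc P P' Q Q' Z)).
by rewrite (wh_wh _ _ _ _ (tens1o (P' ⊗ Z)) (tensA Q Q' (P' ⊗ Z))).
Qed.

Lemma cap_nest P P' Q Q' (u : Mor tunit (P ⊗ P')) (v : Mor tunit (Q ⊗ Q')) Z :
  cap (nest u v) Z =
  cap u Z ∘ (idm P ⊠ cap v (P' ⊗ Z)) ∘ eqm (esym (nest_assoc P P' Q Q' Z)).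
Proof.
by rewrite -cup_adj cup_nest !madjM !cup_adj mtadj madj1 cup_adj eqmadj cmpA.
Qed.

Lemma nest_zz P P' Q Q' (u : Mor tunit (P ⊗ P')) (u' : Mor tunit (P' ⊗ P))
    (v : Mor tunit (Q ⊗ Q')) (v' : Mor tunit (Q' ⊗ Q)) :
  zz u u' -> zz v v' -> zz (nest u v) (nest v' u').
Proof.
move=> zu zv; rewrite /zz cap_nest.
have e1 : (P ⊗ Q) ⊗ tunit = P ⊗ (Q ⊗ tunit) by rewrite tensA.
have -> : idm (P ⊗ Q) ⊠ nest v' u' =
    eqm (nest_assoc P P' Q Q' (P ⊗ Q)) ∘
    (idm P ⊠ (idm Q ⊠ ((idm Q' ⊠ cup u' Q) ∘ v'))) ∘ eqm e1.
  rewrite /nest -tensA_conj -[eqm (esym _) ∘ _ ∘ v']cmpA mtMr.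
  rewrite (mt_eqmr _ (congr1 (tens (P ⊗ Q)) (esym (tensA Q' P' (P ⊗ Q))))).
  rewrite !cmpA -!cmpA eqmM eqm1 cmpm1 !cmpA; congr (_ ∘ _).
  by rewrite eqmM; exact: eqm_irr.
rewrite !cmpA -(cmpA _ (eqm (esym _))) eqmVK cmpm1 -(cmpA (cap u _)) -mtMr.
rewrite (mtMr Q (idm Q' ⊠ cup u' Q) v') (cmpA (cap v _)) cap_nat -(cmpA (cup u' Q)) zv mtMr.
rewrite !cmpA zag // cmp1m.
rewrite (mt_eqmr _ (congr1 (tens P) (tenso1 Q))) eqmM; exact: eqm_irr.
Qed.

Lemma nest_conj A Ab B Bb (rA : Mor tunit (Ab ⊗ A)) (rbA : Mor tunit (A ⊗ Ab))
    (rB : Mor tunit (Bb ⊗ B)) (rbB : Mor tunit (B ⊗ Bb)) :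
  conjugate_eqs rA rbA -> conjugate_eqs rB rbB ->
  conjugate_eqs (nest rB rA) (nest rbA rbB).
Proof.
by move=> /conj_zz[a1 a2] /conj_zz[b1 b2]; apply/conj_zz; split; exact: nest_zz.
Qed.

End Duality.

Lemma fsum_seq (V : nmodType) (T : choiceType) (s : seq T) (F : T -> V) :
  uniq s -> (forall t, t \notin s -> F t = 0) ->
  \sum_(t \in [set: T]) F t = \sum_(t <- s) F t.
Proof.
move=> us F0; have := @bigfs _ _ +%R T s predT F us (fun t _ => F0 t).
by move=> ->; apply: eq_fsbigl; apply/seteqP; split.
Qed.

Section Scalars.
Context {R : realType} {C : cstarTensorCategory R}.
Implicit Types X Y Z : C.

Definition scal X (f : Mor X X) : R[i] := xget 0 [set a | f = a *: idm X].

Section SimpleScalars.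
Variables (X : C) (sX : simple X).

Lemma idm_neq0' : idm X != 0. Proof. exact: (idm_neq0 (ctc_cstar C) sX). Qed.

Lemma scalP (f : Mor X X) : f = scal f *: idm X.
Proof.
have [a fa] := simple_scalar (ctc_cstar C) f sX.
by rewrite /scal; case: xgetP => [_ -> //|/(_ a)].
Qed.

Lemma scalE a : scal (a *: idm X) = a.
Proof.
apply/eqP; rewrite -subr_eq0.
have /eqP := scalP (a *: idm X); rewrite eq_sym -subr_eq0 -scalerBl scaler_eq0.
by rewrite (negbTE idm_neq0') orbF.
Qed.

Lemma scal1 : scal (idm X) = 1.
Proof. by rewrite -[idm X]scale1r scalE. Qed.
Lemma scal0 : scal (0 : Mor X X) = 0.
Proof. by rewrite -(scale0r (idm X)) scalE. Qed.
Lemma scalZ a (f : Mor X X) : scal (a *: f) = a * scal f.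
Proof. by rewrite {1}(scalP f) scalerA scalE. Qed.
Lemma scalD (f g : Mor X X) : scal (f + g) = scal f + scal g.
Proof. by rewrite {1}(scalP f) {1}(scalP g) -scalerDl scalE. Qed.
Lemma scalM (f g : Mor X X) : scal (f ∘ g) = scal f * scal g.
Proof. by rewrite {1}(scalP f) {1}(scalP g) mZl mZr cmp1m scalerA scalE. Qed.
Lemma scal_adj (f : Mor X X) : scal f^† = (scal f)^*.
Proof. by rewrite {1}(scalP f) madjZ madj1 scalE. Qed.
Lemma scal_sum I (r : seq I) P (F : I -> Mor X X) :
  scal (\sum_(a <- r | P a) F a) = \sum_(a <- r | P a) scal (F a).
Proof.
by apply: (big_morph (fun f => scal f)) => [f g|]; [exact: scalD|exact: scal0].
Qed.

Lemma scal_ge0 Y (f : Mor X Y) : 0 <= scal (f^† ∘ f).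
Proof.
have [g ->] := adj_comp_pos (ctc_cstar C) f.
by rewrite scalM scal_adj mulrC mul_conjC_ge0.
Qed.

Lemma scal_eq0 Y (f : Mor X Y) : scal (f^† ∘ f) = 0 -> f = 0.
Proof.
move=> f0; apply: (adj_comp_eq0 (ctc_cstar C)).
by rewrite (scalP (f^† ∘ f)) f0 scale0r.
Qed.

End SimpleScalars.

(** The two bracketings of [f ∘ g ∘ f] multiply [f] by the two scalars. *)
Lemma scal_comm X Y (f : Mor X Y) (g : Mor Y X) : simple X -> simple Y ->
  scal (f ∘ g) = scal (g ∘ f).
Proof.
move=> sX sY; have [->|f0] := eqVneq f 0; first by rewrite m0l m0r !scal0.
apply/eqP; rewrite -subr_eq0; apply/eqP.
have : (scal (f ∘ g) - scal (g ∘ f)) *: f = 0.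
  have h1 : (f ∘ g) ∘ f = scal (f ∘ g) *: f.
    by rewrite {1}(scalP sY (f ∘ g)) mZl cmp1m.
  have h2 : f ∘ (g ∘ f) = scal (g ∘ f) *: f.
    by rewrite {1}(scalP sX (g ∘ f)) mZr cmpm1.
  by rewrite scalerBl -h1 -h2 cmpA subrr.
by move/eqP; rewrite scaler_eq0 (negbTE f0) orbF => /eqP.
Qed.

End Scalars.

(** * Multiplicity traces *)

Section Traces.
Context {R : realType} {C : cstarTensorCategory R} (D : catChoices C).
Implicit Types X Y Z : C.
Local Notation I := (Irr D).
Local Notation X_ k := (rep (c:=D) k).

Lemma onb_decomp (k : I) Y (f : Mor (X_ k) Y) :
  f = \sum_(V <- onb k Y) V ∘ (V^† ∘ f).
Proof.
rewrite -[LHS](isotypic_comp (D := D)) /isotypic cmp_suml.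
by apply: eq_bigr => V _; rewrite cmpA.
Qed.

Lemma rep_hom0 (k l : I) (f : Mor (X_ k) (X_ l)) : k != l -> f = 0.
Proof.
move=> kl; apply/eqP; apply: contra_neqT kl => f0; apply: (rep_inj (c := D)).
by apply: (schur (ctc_cstar C) _ _ f0); exact: rep_simple.
Qed.

Definition irrs Y : seq I :=
  finmap.enum_fset (fset_set [set k : I | exists f : Mor (X_ k) Y, f != 0]).

Lemma irrs_uniq Y : uniq (irrs Y). Proof. exact: finmap.fset_uniq. Qed.

Lemma irrsP Y (k : I) : k \notin irrs Y -> forall f : Mor (X_ k) Y, f = 0.
Proof.
rewrite /irrs in_fset_set; last exact: finite_irr_sub.
by move=> h f; apply/eqP; apply: contraNT h => f0; rewrite inE; exists f.
Qed.

Lemma isotypic0 Y (k : I) : k \notin irrs Y -> isotypic k Y = 0.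
Proof.
move=> h; rewrite /isotypic big1_seq // => V _.
by rewrite (irrsP h V) m0l.
Qed.

(** A morphism maps the [X_k]-part of [Y] into the [X_k]-part of [Z]; applied to the adjoint, this
    gives the other inclusion. *)
Lemma isotypic_nat (k : I) Y Z (f : Mor Y Z) : f ∘ isotypic k Y = isotypic k Z ∘ f.
Proof.
have half Y' Z' (g : Mor Y' Z') : g ∘ isotypic k Y' = isotypic k Z' ∘ g ∘ isotypic k Y'.
  rewrite {1 3}/isotypic !cmp_sumr; apply: eq_bigr => V _.
  by rewrite cmpA -[in LHS](isotypic_comp (D := D) (g ∘ V)) !cmpA.
rewrite half; have := congr1 (fun h => h^†) (half _ _ f^†).
by rewrite /= !madjM !madjK !isotypic_adj cmpA => <-.
Qed.

Lemma isotypic_ortho (k l : I) Y : k != l -> isotypic k Y ∘ isotypic l Y = 0.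
Proof.
move=> kl; rewrite /isotypic cmp_suml big1_seq // => V _.
rewrite cmp_sumr big1_seq // => W _.
by rewrite cmpA -(cmpA V) (rep_hom0 (V^† ∘ W)) 1?eq_sym // m0r m0l.
Qed.

Lemma isotypic_sum Y : \sum_(k <- irrs Y) isotypic k Y = idm Y.
Proof.
(* A standard solution carries a decomposition of [Y] into simple objects; semisimplicity enters
   here. *)
have [_ [n [S [Sb [w [wb [s [sb [hS [_ w1] _ _ _]]]]]]]]] := sol_standard D Y.
have key a : \sum_(k <- irrs Y) isotypic k Y ∘ w a = w a.
  have [sS _ _] := hS a; have [k [v [v' [v'v vv']]]] := rep_surj D sS.
  have wE : w a = (w a ∘ v') ∘ v by rewrite -cmpA v'v cmpm1.
  have [kY|/irrsP kY] := boolP (k \in irrs Y); last first.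
    by rewrite wE (kY (w a ∘ v')) m0l big1 // => l _; rewrite m0r.
  rewrite (bigD1_seq k) ?irrs_uniq //= big1 => [|l lk].
    by rewrite addr0 wE cmpA isotypic_comp.
  rewrite wE cmpA -[w a ∘ v'](isotypic_comp (D := D)) (cmpA (isotypic l Y)).
  by rewrite isotypic_ortho // !m0l.
rewrite -[LHS]cmpm1 -w1 cmp_sumr; apply: eq_bigr => a _.
by rewrite cmpA cmp_suml key.
Qed.

Lemma idm_onb Y : idm Y = \sum_(k <- irrs Y) \sum_(V <- onb k Y) V ∘ V^†.
Proof. by rewrite isotypic_sum. Qed.

Lemma onb_orth (k : I) Y (V : Mor (X_ k) Y) : V \in onb k Y -> V^† ∘ V = idm (X_ k).
Proof.
move=> VY; have [_ on] := onbP k Y.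
have lt : (index V (onb k Y) < size (onb k Y))%N by rewrite index_mem.
have := on (Ordinal lt) (Ordinal lt).
by rewrite /= nth_index // eqxx scale1r.
Qed.

Lemma size_onb (k : I) Y : size (onb k Y) = \dim (fullv : {vspace Mor (X_ k) Y}).
Proof.
by have [bb _] := onbP k Y; rewrite (size_basis (X := in_tuple _) bb).
Qed.

(** The trace of composition with [z] on the space of morphisms from [X_k] to [Z]. *)
Definition tau (k : I) Z (z : Mor Z Z) : R[i] :=
  \sum_(V <- onb k Z) scal (V^† ∘ z ∘ V).

Let sX (k : I) : simple (X_ k). Proof. exact: rep_simple. Qed.

Lemma tauD (k : I) Z (z w : Mor Z Z) : tau k (z + w) = tau k z + tau k w.
Proof.
by rewrite /tau -big_split; apply: eq_bigr => V _ /=; rewrite cmpDr cmpDl scalD.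
Qed.
Lemma tauZ (k : I) Z a (z : Mor Z Z) : tau k (a *: z) = a * tau k z.
Proof.
by rewrite /tau mulr_sumr; apply: eq_bigr => V _ /=; rewrite mZr mZl scalZ.
Qed.
Lemma tau0 (k : I) Z : tau k (0 : Mor Z Z) = 0.
Proof. by rewrite -(scale0r (0 : Mor Z Z)) tauZ mul0r. Qed.
Lemma tau_sum (k : I) Z J (r : seq J) P (F : J -> Mor Z Z) :
  tau k (\sum_(a <- r | P a) F a) = \sum_(a <- r | P a) tau k (F a).
Proof.
by apply: (big_morph (fun f => tau k f)) => [f g|]; [exact: tauD|exact: tau0].
Qed.

Lemma tau_comm (k : I) Z W (f : Mor Z W) (g : Mor W Z) : tau k (f ∘ g) = tau k (g ∘ f).
Proof.
have expand Z' W' (f' : Mor Z' W') (g' : Mor W' Z') : tau k (f' ∘ g') =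
    \sum_(V <- onb k W') \sum_(U <- onb k Z') scal (V^† ∘ f' ∘ U) * scal (U^† ∘ g' ∘ V).
  apply: eq_bigr => V _.
  rewrite -!cmpA {1}(onb_decomp (g' ∘ V)) !cmp_sumr scal_sum //.
  by apply: eq_bigr => U _; rewrite -scalM // !cmpA.
rewrite !expand exchange_big; apply: eq_bigr => U _; apply: eq_bigr => V _.
by rewrite mulrC.
Qed.

Lemma tau_idm (k : I) Y : tau k (idm Y) = (\dim (fullv : {vspace Mor (X_ k) Y}))%:R.
Proof.
rewrite /tau big_seq (eq_bigr (fun=> 1)) => [|V VY].
  by rewrite -big_seq big_const_seq count_predT iter_addr addr0 -size_onb.
by rewrite cmpm1 onb_orth // scal1.
Qed.

Lemma tau_rep (k l : I) : tau k (idm (X_ l)) = (k == l)%:R.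
Proof.
rewrite tau_idm; case: eqVneq => [->|kl]; first by rewrite (sX l).
suff -> : (fullv : {vspace Mor (X_ k) (X_ l)}) = 0%VS by rewrite dimv0.
apply/eqP; rewrite -subv0; apply/subvP => f _.
by rewrite (rep_hom0 f kl) mem0v.
Qed.

Lemma tau_notin (k : I) Z (z : Mor Z Z) : k \notin irrs Z -> tau k z = 0.
Proof.
move=> kZ; rewrite /tau big1_seq // => V _.
by rewrite (irrsP kZ V) m0r scal0.
Qed.

Lemma tau_ge0 (k : I) Z W (z : Mor Z W) : 0 <= tau k (z^† ∘ z).
Proof.
apply: sumr_ge0 => V _; have := scal_ge0 (sX k) (z ∘ V).
by rewrite madjM !cmpA.
Qed.

Lemma tau_isotypic (k l : I) Z (z : Mor Z Z) :
  tau k (z ∘ isotypic l Z) = (k == l)%:R * tau k z.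
Proof.
case: eqVneq => [->|kl]; rewrite ?mul1r ?mul0r /tau.
  by apply: eq_bigr => V _; rewrite -!cmpA isotypic_comp.
rewrite big1_seq // => V _.
by rewrite -[V in _ ∘ V](isotypic_comp (D := D)) -!cmpA (cmpA (isotypic l Z))
  isotypic_ortho 1?eq_sym // m0l !m0r scal0.
Qed.


Lemma fus_subproof Z (z : Mor Z Z) : finite_set [set k : I | tau k z != 0].
Proof.
apply: sub_finite_set (finite_irr_sub D Z) => k /= tk.
have [|] := boolP (k \in irrs Z); last by move=> /tau_notin kz; rewrite kz eqxx in tk.
by rewrite in_fset_set ?inE //; exact: finite_irr_sub.
Qed.

(** For an identity morphism this is the class of the object in the fusion algebra; in general the
    multiplicities are replaced by traces. *)
Definition fus Z (z : Mor Z Z) : fusion D :=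
  @DSum _ _ (fusion_space (D := D)) (fun k => tau k z) (fus_subproof z).

(** Expand both factors over orthonormal bases and use the trace property: what is left of each term
    is a product of two scalars and the trace of the identity of [X_m ⊗ X_l], a fusion
    coefficient. *)
Lemma fus_tens A B (z : Mor A A) (w : Mor B B) :
  fus (z ⊠ w) = fusion_mul (fus z) (fus w).
Proof.
apply: dsumP => k; rewrite /= /fusion_mul_fun.
pose s := [seq (m, l) | m <- irrs A, l <- irrs B].
rewrite (fsum_seq (s := s)); first last.
- move=> [m l] /= mls; have [mA|/tau_notin ->] := boolP (m \in irrs A); last by rewrite !mul0r.
  have [lB|/tau_notin ->] := boolP (l \in irrs B); last by rewrite mulr0 mul0r.
  by case/negP: mls; apply/allpairsP; exists (m, l).
- by apply: allpairs_uniq => [||[? ?] [? ?] _ _ []]; rewrite ?irrs_uniq // => -> ->.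
rewrite big_allpairs /=.
have -> : z ⊠ w = \sum_(m <- irrs A) \sum_(V <- onb m A) \sum_(l <- irrs B)
   \sum_(U <- onb l B) ((z ∘ V) ⊠ (w ∘ U)) ∘ (V^† ⊠ U^†).
  rewrite -{1}[z]cmpm1 -{1}[w]cmpm1 !idm_onb cmp_sumr mt_suml; apply: eq_bigr => m _.
  rewrite cmp_sumr mt_suml; apply: eq_bigr => V _.
  rewrite cmp_sumr mt_sumr; apply: eq_bigr => l _.
  rewrite cmp_sumr mt_sumr; apply: eq_bigr => U _.
  by rewrite -mtM !cmpA.
rewrite tau_sum; apply: eq_bigr => m _; rewrite tau_sum.
under [LHS]eq_bigr do rewrite tau_sum.
rewrite exchange_big; apply: eq_bigr => l _ /=.
have -> : tau m z * tau l w * (fusion_coef k m l)%:R = \sum_(V <- onb m A)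
    \sum_(U <- onb l B) scal (V^† ∘ z ∘ V) * scal (U^† ∘ w ∘ U) * (fusion_coef k m l)%:R.
  rewrite -mulrA mulr_suml; apply: eq_bigr => V _.
  by rewrite mulrA mulr_sumr mulr_suml.
apply: eq_bigr => V _; rewrite tau_sum; apply: eq_bigr => U _; rewrite tau_comm -mtM !cmpA.
rewrite (scalP (sX m) (V^† ∘ z ∘ V)) (scalP (sX l) (U^† ∘ w ∘ U)) !scalE //.
by rewrite mtZl mtZr mt1 !tauZ tau_idm mulrA.
Qed.

Lemma fus_comm Z W (f : Mor Z W) (g : Mor W Z) : fus (f ∘ g) = fus (g ∘ f).
Proof. by apply: dsumP => k; exact: tau_comm. Qed.

Lemma fusZ Z a (z : Mor Z Z) : fus (a *: z) = a *: fus z.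
Proof. by apply: dsumP => k; exact: tauZ. Qed.

Lemma fusD Z (z w : Mor Z Z) : fus (z + w) = fus z + fus w.
Proof. by apply: dsumP => k; exact: tauD. Qed.

Lemma fus0 Z : fus (0 : Mor Z Z) = 0.
Proof. by apply: dsumP => k; exact: tau0. Qed.

End Traces.

(** * Kernels with values in the fusion algebra *)

Section AnnularKernel.
Context {R : realType} {C : cstarTensorCategory R} (D : catChoices C).
Implicit Types A B X Y Z : C.

Lemma tensA_mv A B Z Z' (g : Mor Z Z') :
  eqm (tensA A B Z') ∘ (idm (A ⊗ B) ⊠ g) =
  (idm A ⊠ (idm B ⊠ g)) ∘ eqm (tensA A B Z).
Proof. by rewrite -tensA_conj -cmpA eqmVK cmpm1. Qed.

Lemma w21_comp A A' Y Y' B B' (w : Mor A A') (f : Mor (Y ⊗ B) A)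
    (g : Mor Y' Y) (h : Mor B' B) Z :
  w21 (w ∘ f ∘ (g ⊠ h)) Z = (w ⊠ idm Z) ∘ w21 f Z ∘ (g ⊠ (h ⊠ idm Z)).
Proof.
by rewrite /w21 (whM _ (tensA Y B Z)) (whM _ erefl) wh_erefl -[wh _ _ (g ⊠ h)]/(w22 _ _)
  w22_tens.
Qed.

Lemma w21_post A A' Y B (w : Mor A A') (f : Mor (Y ⊗ B) A) Z :
  w21 (w ∘ f) Z = (w ⊠ idm Z) ∘ w21 f Z.
Proof. by rewrite /w21 (whM _ erefl) wh_erefl. Qed.

Lemma w21_pre A Y Y' B B' (f : Mor (Y ⊗ B) A) (g : Mor Y' Y) (h : Mor B' B) Z :
  w21 (f ∘ (g ⊠ h)) Z = w21 f Z ∘ (g ⊠ (h ⊠ idm Z)).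
Proof. by rewrite -[f]cmp1m w21_comp cmp1m mt1 cmp1m. Qed.

Lemma w21_tensA A Y B (f : Mor (Y ⊗ B) A) Z : w21 f Z ∘ eqm (tensA Y B Z) = f ⊠ idm Z.
Proof. by rewrite /w21 whE cmp1m. Qed.

(* Up to rebracketing, r^* (1 ⊗ y^* ) = r^* (f ⊗ 1): f is y^* bent around X. *)
Definition is_sharp X Xb Y (r : Mor tunit (Xb ⊗ X)) (y : Mor X (Y ⊗ X))
    (f : Mor (Xb ⊗ Y) Xb) : Prop :=
  r^† ∘ (idm Xb ⊠ y^†) = r^† ∘ w21 f X.

Lemma bend_ex X Xb Y Z (r : Mor tunit (Xb ⊗ X)) (rb : Mor tunit (X ⊗ Xb)) W
    (h : Mor (W ⊗ (Y ⊗ X)) tunit) :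
  conjugate_eqs r rb -> exists f : Mor (W ⊗ Y) Xb, h = r^† ∘ w21 f X.
Proof.
move=> cr; have [f hf] := transpose_l_ex cr (h ∘ eqm (tensA W Y X)).
exists f; have := congr1 (fun g => g ∘ eqm (esym (tensA W Y X))) hf.
by rewrite /= -cmpA eqmVK cmpm1 -w21_tensA -!cmpA eqmVK cmpm1.
Qed.

Lemma bend_uniq X Xb Y W (r : Mor tunit (Xb ⊗ X)) (rb : Mor tunit (X ⊗ Xb))
    (f g : Mor (W ⊗ Y) Xb) :
  conjugate_eqs r rb -> r^† ∘ w21 f X = r^† ∘ w21 g X -> f = g.
Proof.
move=> cr h; apply: (transpose_l_uniq cr).
by rewrite -!w21_tensA !cmpA h.
Qed.

Lemma sharp_uniq X Xb Y (r : Mor tunit (Xb ⊗ X)) (rb : Mor tunit (X ⊗ Xb))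
    (y : Mor X (Y ⊗ X)) f g :
  conjugate_eqs r rb -> is_sharp r y f -> is_sharp r y g -> f = g.
Proof. by move=> cr hf hg; apply: (bend_uniq cr); rewrite -hf -hg. Qed.

Lemma sharpD X Xb Y (r : Mor tunit (Xb ⊗ X)) (y : Mor X (Y ⊗ X)) f Z :
  is_sharp r y f -> cap r Z ∘ (idm Xb ⊠ w21 y^† Z) = cap r Z ∘ w21 f (X ⊗ Z).
Proof.
move=> hf; have e1 : (Xb ⊗ (Y ⊗ X)) ⊗ Z = Xb ⊗ (Y ⊗ (X ⊗ Z)) by rewrite !tensA.
have := congr1 (wh e1 (tens1o Z)) hf.
rewrite !(whM _ (tensA Xb X Z)) (wh_tensl _ _ (tensA Y X Z) erefl) => ->.
by rewrite /w21 (wh_wh _ _ _ _ (tensA Xb Y (X ⊗ Z)) erefl).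
Qed.

Definition loop X Xb Y (f : Mor (Xb ⊗ Y) Xb) (x : Mor X (Y ⊗ X)) :
    Mor (Xb ⊗ X) (Xb ⊗ X) :=
  w21 f X ∘ (idm Xb ⊠ x).

Lemma fus_loop_nat X X' Xb Y (f : Mor (Xb ⊗ Y) Xb) (z : Mor X (Y ⊗ X')) (v : Mor X' X) :
  fus D (loop f ((idm Y ⊠ v) ∘ z)) = fus D (loop f (z ∘ v)).
Proof. by rewrite /loop !mtMr !cmpA w21_nat -!cmpA fus_comm !cmpA. Qed.

(** Sliding [t] along the dual strand. With [w] and [zb] the transposes of the adjoints of [t] and
    [z], the two bent morphisms are [w ∘ zb] and [zb ∘ (w ⊠ idm Y)], and the trace property
    identifies their loops. For [t] an identity this gives independence of the choice of dual and
    solution. *)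
Lemma fus_sharp_nat X1 X1b X2 X2b X Y (r1 : Mor tunit (X1b ⊗ X1))
    (rb1 : Mor tunit (X1 ⊗ X1b)) (r2 : Mor tunit (X2b ⊗ X2))
    (rb2 : Mor tunit (X2 ⊗ X2b)) (z : Mor X1 (Y ⊗ X2)) (t : Mor X2 X1) f1 f2
    (x : Mor X (Y ⊗ X)) :
  conjugate_eqs r1 rb1 -> conjugate_eqs r2 rb2 ->
  is_sharp r1 ((idm Y ⊠ t) ∘ z) f1 -> is_sharp r2 (z ∘ t) f2 ->
  fus D (loop f1 x) = fus D (loop f2 x).
Proof.
move=> c1 c2 s1 s2.
have [w hw] := transpose_l_ex c1 (r2^† ∘ (idm X2b ⊠ t^†)).
have [zb hz] := bend_ex X1 (r1^† ∘ (idm X1b ⊠ z^†)) c2.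
have -> : f1 = w ∘ zb.
  apply: (sharp_uniq c1 s1); rewrite /is_sharp w21_post cmpA -hw -cmpA -w21_nat cmpA -hz.
  by rewrite madjM mtadj madj1 mtMr cmpA.
have -> : f2 = zb ∘ (w ⊠ idm Y).
  apply: (sharp_uniq c2 s2); rewrite /is_sharp w21_pre cmpA -hz mt1 -cmpA -mt_xch cmpA -hw.
  by rewrite madjM mtMr cmpA.
by rewrite /loop w21_post w21_pre mt1 -!cmpA fus_comm mt_xch !cmpA.
Qed.

Lemma sharp_post X Xb Y Y' (r : Mor tunit (Xb ⊗ X)) (y : Mor X (Y ⊗ X)) f (h : Mor Y' Y) :
  is_sharp r y f -> is_sharp r ((h^† ⊠ idm X) ∘ y) (f ∘ (idm Xb ⊠ h)).
Proof.
by rewrite /is_sharp w21_pre madjM mtadj madj1 madjK mtMr !cmpA => ->.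
Qed.

Lemma loop_post X Xb Y Y' (f : Mor (Xb ⊗ Y) Xb) (h : Mor Y' Y) (x : Mor X (Y' ⊗ X)) :
  loop (f ∘ (idm Xb ⊠ h)) x = loop f ((h ⊠ idm X) ∘ x).
Proof. by rewrite /loop w21_pre mtMr !cmpA. Qed.

(* The objects A, Y and Y' of such a tube A ⊗ Y -> Y' ⊗ A need not be simple. *)
Definition act A Y Y' X (a : Mor (A ⊗ Y) (Y' ⊗ A)) (x : Mor X (Y ⊗ X)) :
    Mor (A ⊗ X) (Y' ⊗ (A ⊗ X)) :=
  w22 a X ∘ (idm A ⊠ x).

(* (1 ⊗ r^* )(a ⊗ 1) = (r^* ⊗ 1)(1 ⊗ a'^* ): the tube a is the involution # of the
   tube a', turned around by r. *)
Definition is_rot A Ab Y Y' (r : Mor tunit (Ab ⊗ A)) (a : Mor (Ab ⊗ Y') (Y ⊗ Ab))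
    (a' : Mor (A ⊗ Y) (Y' ⊗ A)) : Prop :=
  forall Z, (idm Y ⊠ cap r Z) ∘ w22 a (A ⊗ Z) = cap r (Y ⊗ Z) ∘ (idm Ab ⊠ w22 a'^† Z).

Section ActAdjoint.
Variables (A Ab B Bb Y Y' : C).
Variables (rA : Mor tunit (Ab ⊗ A)) (rB : Mor tunit (Bb ⊗ B)).
Variables (a : Mor (Ab ⊗ Y') (Y ⊗ Ab)) (a' : Mor (A ⊗ Y) (Y' ⊗ A)).
Variables (y : Mor B (Y ⊗ B)) (f : Mor (Bb ⊗ Y) Bb).

Definition act_sharp : Mor ((Bb ⊗ Ab) ⊗ Y') (Bb ⊗ Ab) :=
  w21 f Ab ∘ (idm Bb ⊠ a) ∘ eqm (tensA Bb Ab Y').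

Lemma w21_act_sharp Z :
  eqm (tensA Bb Ab Z) ∘ w21 act_sharp Z =
  w21 f (Ab ⊗ Z) ∘ (idm Bb ⊠ w22 a Z) ∘ eqm (tensA Bb Ab (Y' ⊗ Z)).
Proof.
have e1 : (Bb ⊗ (Ab ⊗ Y')) ⊗ Z = Bb ⊗ (Ab ⊗ (Y' ⊗ Z)) by rewrite !tensA.
have e2 : (Bb ⊗ (Y ⊗ Ab)) ⊗ Z = Bb ⊗ (Y ⊗ (Ab ⊗ Z)) by rewrite !tensA.
rewrite /w21 /act_sharp (wh_eqml _ _ (tensA Bb Ab Z)).
rewrite (whM _ e1) (whM _ e2) (wh_tensl _ _ (tensA Ab Y' Z) (tensA Y Ab Z)).
rewrite (wh_wh _ _ _ _ (tensA Bb Y (Ab ⊗ Z)) erefl).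
by rewrite (wh_eqm _ _ _ (tensA Bb Ab (Y' ⊗ Z))).
Qed.

(** Bending around [A] turns the adjoint of [a'] into [a], by [is_rot]; what remains to be bent
    around [B] is the adjoint of [y]. *)
Lemma act_sharpP : is_rot rA a a' -> is_sharp rB y f ->
  is_sharp (nest rB rA) (act a' y) act_sharp.
Proof.
move=> ha hf; rewrite /is_sharp.
have -> : (nest rB rA)^† = rB^† ∘ (idm Bb ⊠ cap rA B) ∘ eqm (tensA Bb Ab (A ⊗ B)).
  by rewrite /nest !madjM mtadj madj1 cup_adj eqmadj esymK cmpA.
rewrite -!cmpA w21_act_sharp tensA_mv.
rewrite [in RHS](cmpA (idm Bb ⊠ cap rA B)) [in RHS](cmpA (idm Bb ⊠ cap rA B)) -w21_nat.
rewrite -[in RHS]cmpA [in RHS](cmpA rB^†) [in RHS](cmpA rB^†) -hf -!cmpA.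
congr (_ ∘ _); rewrite !cmpA; congr (_ ∘ _); rewrite -!mtMr; congr (_ ⊠ _).
by rewrite -[in RHS]cmpA ha madjM mtadj madj1 w22_adj mtMr !cmpA cap_nat.
Qed.

Lemma fus_loop_act X (x : Mor X (Y' ⊗ X)) :
  fus D (loop act_sharp x) = fus D (loop f (act a x)).
Proof.
rewrite /loop -[w21 act_sharp X]cmp1m -(eqmVK (esym (tensA Bb Ab X)) (tensA Bb Ab X)).
rewrite -!cmpA fus_comm cmpA w21_act_sharp -!cmpA.
by rewrite (cmpA (eqm (tensA _ _ _))) tensA_conj /act mtMr.
Qed.

End ActAdjoint.

Section Strands.
Variables (B Bb L Lb Y : C) (rB : Mor tunit (Bb ⊗ B)) (rL : Mor tunit (Lb ⊗ L)).
Variables (y : Mor B (Y ⊗ B)) (f : Mor (Bb ⊗ Y) Bb).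

Definition strand_sharp : Mor ((Lb ⊗ Bb) ⊗ Y) (Lb ⊗ Bb) :=
  (idm Lb ⊠ f) ∘ eqm (tensA Lb Bb Y).

Lemma w21_strand_sharp Z :
  eqm (tensA Lb Bb Z) ∘ w21 strand_sharp Z =
  (idm Lb ⊠ w21 f Z) ∘ eqm (tensA Lb Bb (Y ⊗ Z)).
Proof.
have e1 : (Lb ⊗ (Bb ⊗ Y)) ⊗ Z = Lb ⊗ (Bb ⊗ (Y ⊗ Z)) by rewrite !tensA.
rewrite /w21 /strand_sharp (wh_eqml _ _ (tensA Lb Bb Z)) (whM _ e1).
by rewrite (wh_tensl _ _ (tensA Bb Y Z) erefl) (wh_eqm _ _ _ (tensA Lb Bb (Y ⊗ Z))).
Qed.

Lemma strand_sharpP : is_sharp rB y f -> is_sharp (nest rL rB) (w12 y L) strand_sharp.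
Proof.
move=> hf; rewrite /is_sharp.
have -> : (nest rL rB)^† = rL^† ∘ (idm Lb ⊠ cap rB L) ∘ eqm (tensA Lb Bb (B ⊗ L)).
  by rewrite /nest !madjM mtadj madj1 cup_adj eqmadj esymK cmpA.
rewrite -!cmpA w21_strand_sharp tensA_mv.
congr (_ ∘ _); rewrite !cmpA -!mtMr; congr (_ ∘ _); congr (_ ⊠ _).
by rewrite w12_adj; exact: sharpD.
Qed.

(** The strands [Lb] and [K] do not interact with the loop, so the endomorphism is a triple tensor
    product up to rebracketing and [fus_tens] applies. *)
Lemma fus_loop_strand X K (x : Mor X (Y ⊗ X)) :
  fus D (loop strand_sharp (w12 x K)) =
  fusion_mul (fus D (idm Lb)) (fusion_mul (fus D (loop f x)) (fus D (idm K))).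
Proof.
rewrite -!fus_tens /loop.
have e : (Bb ⊗ X) ⊗ K = Bb ⊗ (X ⊗ K) by rewrite tensA.
have -> : (w21 f X ∘ (idm Bb ⊠ x)) ⊠ idm K =
    eqm (esym e) ∘ (w21 f (X ⊗ K) ∘ (idm Bb ⊠ w12 x K)) ∘ eqm e.
  have e1 : (Bb ⊗ (Y ⊗ X)) ⊗ K = Bb ⊗ (Y ⊗ (X ⊗ K)) by rewrite !tensA.
  rewrite -wh_erefl (whM _ e1) /w21 (wh_wh _ _ _ _ (tensA Bb Y (X ⊗ K)) (esym e)).
  rewrite !cmpA (wh_eqml _ _ (esym e)) -cmpA; congr (_ ∘ _).
  rewrite -(wh_tensl e e1 erefl (tensA Y X K)).
  by rewrite (wh_eqmr _ _ erefl).
rewrite !mtMr (mt_eqmr _ (congr1 (tens Lb) e)) (mt_eqmr _ (congr1 (tens Lb) (esym e))).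
rewrite [RHS]fus_comm [in RHS]cmpA eqmM eqm1 cmp1m.
rewrite -[w21 strand_sharp _]cmp1m.
rewrite -(eqmVK (esym (tensA Lb Bb (X ⊗ K))) (tensA Lb Bb (X ⊗ K))).
rewrite -!cmpA fus_comm cmpA w21_strand_sharp -!cmpA.
by rewrite (cmpA (eqm (tensA _ _ _))) tensA_conj.
Qed.

End Strands.

End AnnularKernel.

Section Kernel.
Context {R : realType} {C : cstarTensorCategory R} (D : catChoices C).
Implicit Types A B X Y Z : C.
Local Notation I := (Irr D).
Local Notation X_ k := (rep (c:=D) k).

Lemma sol_conj X : conjugate_eqs (sol D X) (solb D X).
Proof. by have [] := sol_standard D X. Qed.

Definition sharp X Y (y : Mor X (Y ⊗ X)) : Mor (dual D X ⊗ Y) (dual D X) :=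
  sval (cid (bend_ex X ((sol D X)^† ∘ (idm (dual D X) ⊠ y^†)) (sol_conj X))).

Lemma sharpP X Y (y : Mor X (Y ⊗ X)) : is_sharp (sol D X) y (sharp y).
Proof. exact: svalP (cid _). Qed.

(* The (fusion algebra valued) inner product of two vectors of weight Y in the
   regular representation of the tube algebra. *)
Definition kern Y X X' (y : Mor X' (Y ⊗ X')) (x : Mor X (Y ⊗ X)) : fusion D :=
  fus D (loop (sharp y) x).

(** Allows kernels to be computed with nested or transported solutions in place of the chosen
    ones. *)
Lemma kernE Y X X' Xb (r : Mor tunit (Xb ⊗ X')) rb (y : Mor X' (Y ⊗ X')) f
    (x : Mor X (Y ⊗ X)) :
  conjugate_eqs r rb -> is_sharp r y f -> kern y x = fus D (loop f x).
Proof.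
move=> cr hf; rewrite /kern; apply: (fus_sharp_nat D (z := y) (t := idm X') x (sol_conj X') cr).
  by rewrite mt1 cmp1m; exact: sharpP.
by rewrite cmpm1.
Qed.

Lemma kern_natr Y X X' X'' (y : Mor X' (Y ⊗ X')) (z : Mor X (Y ⊗ X'')) (v : Mor X'' X) :
  kern y ((idm Y ⊠ v) ∘ z) = kern y (z ∘ v).
Proof. exact: fus_loop_nat. Qed.

Lemma kern_natl Y X X' X'' (x : Mor X (Y ⊗ X)) (z : Mor X' (Y ⊗ X'')) (v : Mor X'' X') :
  kern ((idm Y ⊠ v) ∘ z) x = kern (z ∘ v) x.
Proof. exact: fus_sharp_nat (sol_conj _) (sol_conj _) (sharpP _) (sharpP _). Qed.

Lemma kern_post Y Y' X X' (y : Mor X' (Y ⊗ X')) (x : Mor X (Y' ⊗ X)) (h : Mor Y' Y) :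
  kern ((h^† ⊠ idm X') ∘ y) x = kern y ((h ⊠ idm X) ∘ x).
Proof.
rewrite (kernE x (sol_conj X') (sharp_post h (sharpP y))).
by rewrite loop_post.
Qed.

Lemma kern_act A Ab Y Y' X X' (r : Mor tunit (Ab ⊗ A)) rb
    (a : Mor (Ab ⊗ Y') (Y ⊗ Ab)) (a' : Mor (A ⊗ Y) (Y' ⊗ A))
    (y : Mor X' (Y ⊗ X')) (x : Mor X (Y' ⊗ X)) :
  conjugate_eqs r rb -> is_rot r a a' -> kern (act a' y) x = kern y (act a x).
Proof.
move=> cr ha; rewrite (kernE x (nest_conj cr (sol_conj X')) (act_sharpP ha (sharpP y))).
exact: fus_loop_act.
Qed.

Lemma kernDr Y X X' (y : Mor X' (Y ⊗ X')) (x x' : Mor X (Y ⊗ X)) :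
  kern y (x + x') = kern y x + kern y x'.
Proof. by rewrite /kern /loop mtDr cmpDr fusD. Qed.

Lemma kernZr Y X X' (y : Mor X' (Y ⊗ X')) c (x : Mor X (Y ⊗ X)) :
  kern y (c *: x) = c *: kern y x.
Proof. by rewrite /kern /loop mtZr mZr fusZ. Qed.

Lemma kern0r Y X X' (y : Mor X' (Y ⊗ X')) : kern y (0 : Mor X (Y ⊗ X)) = 0.
Proof. by rewrite /kern /loop mt0r m0r fus0. Qed.

Lemma kern_sumr Y X X' (y : Mor X' (Y ⊗ X')) J (s : seq J) P (F : J -> Mor X (Y ⊗ X)) :
  kern y (\sum_(a <- s | P a) F a) = \sum_(a <- s | P a) kern y (F a).
Proof.
by apply: (big_morph (fun f => kern y f)) => [f g|]; [exact: kernDr|exact: kern0r].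
Qed.

Lemma kernDl Y X X' (y y' : Mor X' (Y ⊗ X')) (x : Mor X (Y ⊗ X)) :
  kern (y + y') x = kern y x + kern y' x.
Proof.
rewrite (kernE (f := sharp y + sharp y') x (sol_conj X')).
  by rewrite /kern /loop /w21 whD cmpDl fusD.
by rewrite /is_sharp /w21 whD madjD mtDr !cmpDr !sharpP.
Qed.

Lemma kernZl Y X X' c (y : Mor X' (Y ⊗ X')) (x : Mor X (Y ⊗ X)) :
  kern (c *: y) x = Num.conj c *: kern y x.
Proof.
rewrite (kernE (f := Num.conj c *: sharp y) x (sol_conj X')).
  by rewrite /kern /loop /w21 whZ mZl fusZ.
by rewrite /is_sharp /w21 whZ madjZ mtZr !mZr !sharpP.
Qed.

Lemma kern0l Y X X' (x : Mor X (Y ⊗ X)) : kern (0 : Mor X' (Y ⊗ X')) x = 0.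
Proof.
have := kernZl 0 (0 : Mor X' (Y ⊗ X')) x.
by rewrite scale0r conjC0 scale0r.
Qed.

Lemma kern_suml Y X X' (x : Mor X (Y ⊗ X)) J (s : seq J) P (F : J -> Mor X' (Y ⊗ X')) :
  kern (\sum_(a <- s | P a) F a) x = \sum_(a <- s | P a) kern (F a) x.
Proof.
by apply: (big_morph (fun f => kern f x)) => [f g|]; [exact: kernDl|exact: kern0l].
Qed.

Lemma kern_strand Y X X' (y : Mor X' (Y ⊗ X')) (x : Mor X (Y ⊗ X)) (l k : I) :
  kern (w12 y (X_ l)) (w12 x (X_ k)) =
  fusion_mul (fus D (idm (X_ (bar l)))) (fusion_mul (kern y x) (fus D (idm (X_ k)))).
Proof.
rewrite (kernE _ (nest_conj (sol_conj X') (irr_sol_conj l))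
  (strand_sharpP (irr_sol l) (sharpP y))).
exact: fus_loop_strand.
Qed.

Lemma fus_irr (k : I) : fus D (idm (X_ k)) = fusion_irr k.
Proof.
apply: dsumP => m; rewrite [LHS]tau_rep /= /single_fun; case: eqP => [e|].
  by case: m / e; rewrite eqxx.
by move=> /eqP; rewrite eq_sym => /negbTE ->.
Qed.

End Kernel.

(** * The categorical trace *)

Section DimensionTrace.
Context {R : realType} {C : cstarTensorCategory R} (D : catChoices C).
Implicit Types A B P Q X Y Z W : C.
Local Notation I := (Irr D).
Local Notation X_ k := (rep (c:=D) k).
Local Notation hC := (ctc_cstar C).
Local Notation hT := (ctc_tensor C).

Lemma cmpNr X Y Z (h : Mor Y Z) (f : Mor X Y) : h ∘ (- f) = - (h ∘ f).
Proof. by rewrite -scaleN1r mZr scaleN1r. Qed.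

Lemma tau_faithful Z W (z : Mor Z W) : (forall k : I, tau k (z^† ∘ z) = 0) -> z = 0.
Proof.
move=> h; have zV (k : I) V : V \in onb k Z -> z ∘ V = 0.
  have pos (U : Mor (X_ k) Z) : 0 <= scal (U^† ∘ (z^† ∘ z) ∘ U).
    by have := scal_ge0 (rep_simple k) (z ∘ U); rewrite madjM !cmpA.
  move=> VZ; apply: (scal_eq0 (rep_simple k)).
  have := h k; rewrite /tau => /eqP; rewrite psumr_eq0 => [/allP/(_ V VZ)/eqP|U _ //].
  by rewrite madjM !cmpA.
rewrite -[z]cmpm1 (idm_onb D) cmp_sumr big1_seq // => k _.
rewrite cmp_sumr big1_seq // => V /= VZ.
by rewrite cmpA zV // m0l.
Qed.

Lemma tau_sum_eq0 (J : finType) (P : pred J) Z (W : J -> C) (m : forall a, Mor Z (W a)) :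
  \sum_(a | P a) (m a)^† ∘ m a = 0 -> forall a, P a -> m a = 0.
Proof.
move=> h a Pa; apply: tau_faithful => k.
have : tau k (\sum_(a | P a) (m a)^† ∘ m a) = 0 by rewrite h tau0.
rewrite tau_sum => /eqP; rewrite psumr_eq0 => [/allP/(_ a)|b _]; last exact: tau_ge0.
by rewrite mem_index_enum Pa => /(_ isT)/eqP.
Qed.

(** For [e = u - idm X] one has [u ∘ e = - e], so the positive elements built from [v ∘ e] and from
    [e] add up to zero. *)
Lemma positive_involution X (u : Mor X X) Y (v : Mor X Y) :
  u = v^† ∘ v -> u ∘ u = idm X -> u = idm X.
Proof.
move=> uv uu; pose e := u - idm X.
have ue : u ∘ e = - e.
  by rewrite /e cmpDr cmpNr cmpm1 uu opprB.
have e0 : (v ∘ e)^† ∘ (v ∘ e) + e^† ∘ e = 0.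
  by rewrite madjM -!cmpA (cmpA v^†) -uv ue cmpNr addNr.
suff : e = 0 by move/eqP; rewrite subr_eq0 => /eqP.
apply: tau_faithful => k; have : tau k ((v ∘ e)^† ∘ (v ∘ e) + e^† ∘ e) = 0 by rewrite e0 tau0.
by rewrite tauD => /eqP; rewrite paddr_eq0 ?tau_ge0 // => /andP[_ /eqP].
Qed.

(** Compressing the resolution of the identity by [w b] leaves a vanishing sum of positive terms
    over the other indices. *)
Lemma isometries_orth (n : nat) (S : 'I_n -> C) X (w : forall a, Mor (S a) X) :
  (forall a, (w a)^† ∘ w a = idm (S a)) -> \sum_a w a ∘ (w a)^† = idm X ->
  forall a b, a != b -> (w a)^† ∘ w b = 0.
Proof.
move=> wi ws a b ab; apply: (@tau_sum_eq0 _ (fun a => a != b) _ _ (fun a => (w a)^† ∘ w b)) =>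
  //.
have : (w b)^† ∘ (\sum_a w a ∘ (w a)^†) ∘ w b = idm (S b) by rewrite ws cmpm1 wi.
rewrite cmp_sumr cmp_suml (bigD1 b) //= !cmpA wi cmp1m wi => /eqP.
rewrite -subr_eq0 addrAC subrr add0r => /eqP h; rewrite -[RHS]h.
by apply: eq_bigr => c _; rewrite madjM madjK !cmpA.
Qed.

Lemma unit_norm Y (u : Mor tunit Y) : u^† ∘ u = (mnorm u ^+ 2)%:C%C *: idm (tunit : C).
Proof.
have sU := ctc_unit C.
have n1 : mnorm (idm (tunit : C)) = 1.
  have n0 : mnorm (idm (tunit : C)) != 0.
    by apply: contraNneq (idm_neq0 hC sU) => /(mnorm_eq0 hC) ->.
  apply: (mulfI n0); rewrite mulr1 -expr2 -(mnorm_cstar hC) madj1 cmp1m //.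
rewrite {1}(scalP sU (u^† ∘ u)); congr (_ *: _).
have a0 := scal_ge0 sU u.
have := mnormZ hC (scal (u^† ∘ u)) (idm (tunit : C)).
rewrite -(scalP sU) (mnorm_cstar hC) n1 mulr1 => ->.
by rewrite ger0_norm // RRe_real // ger0_real.
Qed.

Lemma transport_zz P (P' : C) (u : Mor tunit (P ⊗ P')) (u' : Mor tunit (P' ⊗ P)) m s :
  zz u u' -> u^† ∘ (idm P ⊠ m) = u^† ∘ (s ⊠ idm P') ->
  cap u P ∘ (idm P ⊠ ((m ⊠ idm P) ∘ u')) = s ∘ eqm (tenso1 P).
Proof.
move=> z h; rewrite mtMr cmpA.
have -> : cap u P ∘ (idm P ⊠ (m ⊠ idm P)) = cap u P ∘ (s ⊠ (idm P' ⊠ idm P)).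
  by have := congr1 (wh (tensA P P' P) (tens1o P)) h;
  rewrite !(whM _ (tensA P P' P)) -![wh _ _ (_ ⊠ _)]/(w22 _ _) !w22_tens.
by rewrite mt1 -cmpA mt_xch cmpA z -(tensmo1 hT).
Qed.

(** Moving [p] to the other leg gives the same [t] at the cup [u'] and at the cap of [u], by the
    conjugate equations. *)
Lemma mate P (P' : C) (u : Mor tunit (P ⊗ P')) (u' : Mor tunit (P' ⊗ P)) p t :
  conjugate_eqs u u' -> (p ⊠ idm P) ∘ u' = (idm P' ⊠ t) ∘ u' ->
  u^† ∘ (idm P ⊠ p) = u^† ∘ (t ⊠ idm P').
Proof.
move=> cu h; have [z1 z2] := (conj_zz u u').1 cu.
have [s hs] := transpose_l_ex cu (u^† ∘ (idm P ⊠ p)).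
rewrite hs; congr (_ ∘ (_ ⊠ _)).
have := transport_zz z1 hs; rewrite h mtMr cmpA cap_nat -cmpA z1.
move=> /(congr1 (fun f => f ∘ eqm (esym (tenso1 P)))).
by rewrite -!cmpA eqmVK !cmpm1 => ->.
Qed.

Section SphericalUniqueness.
Variables (Z Zb Zb' : C) (r : Mor tunit (Zb ⊗ Z)) (rb : Mor tunit (Z ⊗ Zb)).
Variables (r' : Mor tunit (Zb' ⊗ Z)) (rb' : Mor tunit (Z ⊗ Zb')).
Hypotheses (cr : conjugate_eqs r rb) (cr' : conjugate_eqs r' rb').
Variable F : Mor Z Z -> R[i].
Hypothesis Fl : forall z, r^† ∘ (idm Zb ⊠ z) ∘ r = F z *: idm tunit.
Hypothesis Fr : forall z, rb^† ∘ (z ⊠ idm Zb) ∘ rb = F z *: idm tunit.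
Hypothesis F_comm : forall z w, F (z ∘ w) = F (w ∘ z).
Hypothesis F_faithful : forall w : Mor Z Z, (forall z, F (z ∘ w) = 0) -> w = 0.
Hypothesis FD : forall z w, F (z - w) = F z - F w.
Hypothesis spherical : forall z,
  r'^† ∘ (idm Zb' ⊠ z) ∘ r' = rb'^† ∘ (z ⊠ idm Zb') ∘ rb'.

(* Writing r' = (u ⊗ 1) r and p = u^* u, the left traces of r' and r differ by
   the transpose of p and the right ones by the transpose of p^-1. Hence p = p^-1,
   and p = 1 because p is positive. *)
Lemma spherical_unique z : r'^† ∘ (idm Zb' ⊠ z) ∘ r' = F z *: idm tunit.
Proof.
have [z1 z2] := (conj_zz r rb).1 cr; have [z1' z2'] := (conj_zz r' rb').1 cr'.
have [u hu] := cotranspose_l_ex cr r'.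
have [w hw] := cotranspose_r_ex (conj_swap cr) rb'.
have capr' W : cap r' W = cap r W ∘ (u^† ⊠ idm (Z ⊗ W)).
  rewrite /cap hu madjM mtadj madj1 (whM _ (tensA Zb Z W)).
  by rewrite -[wh _ _ (_ ⊠ _)]/(w22 _ _) w22_tens mt1.
have wu : w ∘ u^† = idm Zb'.
  move: z1'; rewrite /zz capr' hw mtMr -!cmpA (cmpA (u^† ⊠ _)) mt_xch.
  rewrite -cmpA mt_xch !cmpA cap_nat -(cmpA w) z1 -(cmpA w) (tensmo1 hT) cmpA.
  move=> /(congr1 (fun f => f ∘ eqm (esym (tenso1 Zb')))).
  by rewrite -!cmpA eqmVK cmpm1.
have uw : w^† ∘ u = idm Zb.
  have [s hs] := transpose_l_ex (conj_swap cr) (rb^† ∘ (idm Z ⊠ (w^† ∘ u))).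
  apply: (transpose_r_uniq (conj_swap cr)); rewrite hs mt1 cmpm1.
  have := transport_zz z2 hs.
  have -> : cap rb Z ∘ (idm Z ⊠ (((w^† ∘ u) ⊠ idm Z) ∘ r)) = eqm (tenso1 Z).
    rewrite -[RHS]z2' /cap hw madjM mtadj madj1 (whM _ (tensA Z Zb Z)).
    rewrite -[wh _ _ (_ ⊠ _)]/(w22 _ _) w22_tens -cmpA -mtMr hu cmpA -mtMl //.
  move=> /(congr1 (fun f => f ∘ eqm (esym (tenso1 Z)))).
  by rewrite -!cmpA eqmVK cmpm1 => <-; rewrite mt1 cmpm1.
(* By [wu] and [uw], [w] is inverse to the adjoint of [u], so [q] is the inverse of [p]. *)
pose p := u^† ∘ u; pose q := w^† ∘ w.
have [t ht] := cotranspose_r_ex cr ((p ⊠ idm Z) ∘ r).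
have mt := mate (conj_swap cr) ht.
have [t' ht'] := transpose_l_ex (conj_swap cr) (rb^† ∘ (idm Z ⊠ q)).
have scale_inj a b : a *: idm (tunit : C) = b *: idm tunit -> a = b.
  by move=> /(congr1 (fun f => scal f)); rewrite !(scalE (ctc_unit C)).
have L y : r'^† ∘ (idm Zb' ⊠ y) ∘ r' = F (y ∘ t) *: idm tunit.
  rewrite -Fl hu madjM mtadj madj1 -!cmpA (cmpA (idm Zb' ⊠ y)) -mt_xch.
  rewrite -!cmpA (cmpA (u^† ⊠ _)) -mtMl (cmpA (p ⊠ _)) mt_xch -cmpA ht.
  by rewrite mtMr -!cmpA.
have Rr y : rb'^† ∘ (y ⊠ idm Zb') ∘ rb' = F (y ∘ t') *: idm tunit.
  rewrite F_comm -Fr hw madjM mtadj madj1 -!cmpA (cmpA (y ⊠ idm Zb')) mt_xch.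
  rewrite -!cmpA (cmpA (idm Z ⊠ w^†)) -mtMr (cmpA rb^†) (cmpA rb^†) ht'.
  by rewrite mtMl !cmpA.
have tt' : t = t'.
  apply/eqP; rewrite -subr_eq0; apply/eqP/F_faithful => y.
  rewrite cmpDr cmpNr FD (_ : F (y ∘ t) = F (y ∘ t')) ?subrr //.
  by apply: scale_inj; rewrite -L -Rr.
have pq : p = q.
  by apply: (transpose_r_uniq (conj_swap cr)); rewrite ht' mt tt'.
have pp : p ∘ p = idm Zb.
  rewrite {2}pq /p /q -!cmpA (cmpA u) (_ : u ∘ w^† = idm _) ?cmp1m; last first.
    by apply: madj_inj; rewrite madjM madjK wu madj1.
  by apply: madj_inj; rewrite madjM madjK uw madj1.
have p1 : p = idm Zb := positive_involution (erefl p) pp.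
rewrite L; congr (F _ *: _).
have -> : t = idm Z; last by rewrite cmpm1.
have [_ inj] := (transpose_r_ex cr, transpose_r_uniq cr).
have := congr1 (fun f => f^†) ht; rewrite /= p1 mt1 cmp1m madjM mtadj madj1.
move=> h; apply: madj_inj; rewrite madj1; apply: (transpose_r_uniq cr).
by rewrite -h mt1 cmpm1.
Qed.

End SphericalUniqueness.
End DimensionTrace.

Section StandardTrace.
Context {R : realType} {C : cstarTensorCategory R} (D : catChoices C).
Implicit Types A B P Q X Y Z W S : C.
Local Notation I := (Irr D).
Local Notation X_ k := (rep (c:=D) k).
Local Notation hC := (ctc_cstar C).
Local Notation hT := (ctc_tensor C).
Local Notation sU := (ctc_unit C).

Definition dimk (k : I) : R[i] := (sdim D (X_ k))%:C%C.

Lemma conj_neq0 X Xb (r : Mor tunit (Xb ⊗ X)) rb :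
  conjugate_eqs r rb -> idm X != 0 -> r != 0.
Proof.
move=> [_ h]; apply: contra_neq => r0; move: h.
by rewrite r0 mt0r m0r m0l => <-.
Qed.

Lemma mnorm_neq0 X Y (f : Mor X Y) : f != 0 -> mnorm f != 0.
Proof. by apply: contra_neq => /(mnorm_eq0 hC). Qed.

Lemma mnorm_ge0 X Y (f : Mor X Y) : 0 <= mnorm f.
Proof.
have := mnormD hC f (- f); rewrite subrr.
have := mnormZ hC 0 (0 : Mor X Y); rewrite scaler0 normr0 mul0r => ->.
have := mnormZ hC (-1) f; rewrite normrN1 mul1r scaleN1r => ->.
by rewrite -mulr2n pmulrn_lge0.
Qed.

Lemma conj_simple X Xb (r : Mor tunit (Xb ⊗ X)) rb :
  conjugate_eqs r rb -> simple X -> simple Xb.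
Proof.
move=> cr sX; have id0 : idm Xb != 0.
  apply: contra_neq (conj_neq0 cr (idm_neq0' sX)) => h.
  by rewrite -[r]cmp1m -mt1 h mt0l m0l.
rewrite /simple (_ : fullv = <[idm Xb]>%VS) ?dim_vline ?id0 //.
apply/eqP; rewrite eqEsubv subvf andbT; apply/subvP => f _; apply/vlineP.
have [w hw] := transpose_r_ex cr (r^† ∘ (f ⊠ idm X)).
exists (scal w); apply: (transpose_l_uniq cr).
by rewrite hw {1}(scalP sX w) mtZl mtZr !mZr mt1.
Qed.

Lemma standard_sym X Xb (r : Mor tunit (Xb ⊗ X)) rb : standard r rb -> standard rb r.
Proof.
move=> [cr [n [S [Sb [w [wb [s [sb [hS hw hwb hr hrb]]]]]]]]].
split; first exact: conj_swap.
exists n, Sb, S, wb, w, sb, s; split=> // a; have [sS cs ns] := hS a.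
by split; [exact: conj_simple cs sS|exact: conj_swap|].
Qed.

Lemma standard_left X Xb (r : Mor tunit (Xb ⊗ X)) rb n (S Sb : 'I_n -> C)
    (w : forall a, Mor (S a) X) (wb : forall a, Mor (Sb a) Xb)
    (s : forall a, Mor tunit (Sb a ⊗ S a)) (z : Mor X X) :
  (forall a, simple (S a)) ->
  (forall a, (wb a)^† ∘ wb a = idm (Sb a)) -> \sum_a wb a ∘ (wb a)^† = idm Xb ->
  r = \sum_a (wb a ⊠ w a) ∘ s a -> conjugate_eqs r rb ->
  r^† ∘ (idm Xb ⊠ z) ∘ r =
  (\sum_a scal ((w a)^† ∘ z ∘ w a) * (mnorm (s a) ^+ 2)%:C%C) *: idm tunit.
Proof.
move=> hS wbi wbs hr cr; rewrite hr madj_sum -cmpA !cmp_suml scaler_suml.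
apply: eq_bigr => a _; rewrite cmp_sumr cmp_sumr (bigD1 a) //= big1 => [|b ba].
  rewrite addr0 madjM mtadj cmpA cmpA -(cmpA (s a)^†) -mtM -(cmpA (s a)^†) -mtM.
  rewrite cmpm1 wbi (scalP (hS a) (_ ∘ z ∘ _)) scalE // mtZr mt1 mZr mZl cmpm1.
  by rewrite unit_norm scalerA.
rewrite madjM mtadj cmpA cmpA -(cmpA (s a)^†) -mtM -(cmpA (s a)^†) -mtM.
by rewrite cmpm1 (isometries_orth D wbi wbs) 1?eq_sym // mt0l m0r m0l.
Qed.

Lemma standard_norm X Xb (r : Mor tunit (Xb ⊗ X)) rb : standard r rb ->
  mnorm r = mnorm rb.
Proof.
move=> hs; have [crb [n [S [Sb [w [wb [s [sb [hS [wi ws] [wbi wbs] hr hrb]]]]]]]]] := hs.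
have sS a : simple (S a) by case: (hS a).
have sSb a : simple (Sb a) by have [? c ?] := hS a; exact: conj_simple c _.
have e1 := standard_left (idm X) sS wbi wbs hr crb.
have e2 := standard_left (idm Xb) sSb wi ws hrb (conj_swap crb).
apply/eqP; rewrite -(@eqrXn2 _ 2) ?mnorm_ge0 //; apply/eqP.
move: e1 e2; rewrite !mt1 !cmpm1 !unit_norm => e1 e2.
have inj a b : a *: idm (tunit : C) = b *: idm tunit -> a = b.
  by move=> /(congr1 (fun f => scal f)); rewrite !(scalE sU).
move: (inj _ _ e1) (inj _ _ e2) => {}e1 {}e2.
suff : (mnorm r ^+ 2)%:C%C = (mnorm rb ^+ 2)%:C%C by case.
rewrite e1 e2; apply: eq_bigr => a _; rewrite !cmpm1 wi wbi !scal1 //.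
by have [_ _ ->] := hS a.
Qed.

(** On a simple object both traces are multiples of [scal], so sphericality is just the equality of
    the two norms. *)
Lemma simple_norm_unique X Xb Xb' (r : Mor tunit (Xb ⊗ X)) rb
    (r' : Mor tunit (Xb' ⊗ X)) rb' : simple X ->
  conjugate_eqs r rb -> conjugate_eqs r' rb' ->
  mnorm r = mnorm rb -> mnorm r' = mnorm rb' -> mnorm r ^+ 2 = mnorm r' ^+ 2.
Proof.
move=> sX cr cr' n1 n2; pose c := (mnorm r ^+ 2)%:C%C.
have c0 : c != 0.
  have := mnorm_neq0 (conj_neq0 cr (idm_neq0' sX)) => h.
  by rewrite /c -(rmorph0 (real_complex R)) (inj_eq (@complexI R)) sqrf_eq0.
have L Xc (u : Mor tunit (Xc ⊗ X)) z : u^† ∘ (idm Xc ⊠ z) ∘ u =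
    (scal z * (mnorm u ^+ 2)%:C%C) *: idm tunit.
  by rewrite {1}(scalP sX z) mtZr mt1 mZr mZl cmpm1 unit_norm scalerA.
have L' Xc (u : Mor tunit (X ⊗ Xc)) z : u^† ∘ (z ⊠ idm Xc) ∘ u =
    (scal z * (mnorm u ^+ 2)%:C%C) *: idm tunit.
  by rewrite {1}(scalP sX z) mtZl mt1 mZr mZl cmpm1 unit_norm scalerA.
have := @spherical_unique _ _ D _ _ _ _ _ _ _ cr cr' (fun z => scal z * c) _ _ _ _ _ _ (idm X).
rewrite L !scal1 // !mul1r => h.
have {}h : (mnorm r' ^+ 2)%:C%C *: idm (tunit : C) = c *: idm tunit.
  apply: h => [z|z|z w|w hw|z w|z].
  - by rewrite L.
  - by rewrite L' -n1.
  - by rewrite !scalM // [scal z * scal w]mulrC.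
  - have := hw (idm X); rewrite cmp1m => /eqP; rewrite mulf_eq0 (negbTE c0) orbF.
    by move/eqP => w0; rewrite (scalP sX w) w0 scale0r.
  - by rewrite scalD // -scaleN1r scalZ // mulN1r mulrBl.
  - by rewrite L L' n2.
by move/(congr1 (fun f => scal f)): h; rewrite !(scalE sU) => -[].
Qed.

Lemma iso_unitary X Y : simple X -> simple Y -> isomorphic X Y ->
  exists v : Mor X Y, v^† ∘ v = idm X /\ v ∘ v^† = idm Y.
Proof.
move=> sX sY [f [g [gf fg]]].
have f0 : f != 0 by apply: contra_neq (idm_neq0' sX) => f0; rewrite -gf f0 m0r.
pose a := scal (f^† ∘ f).
have a0 : a != 0 by apply: contra_neq f0; exact: scal_eq0.
have ag : 0 <= a := scal_ge0 sX f.
have ac : a^-1 \is Num.real by rewrite ger0_real // invr_ge0.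
pose c := sqrtC a^-1.
have cc : c^* * c = a^-1.
  by rewrite (CrealP (ger0_real _)) -?expr2 ?sqrtCK // sqrtC_ge0 invr_ge0.
exists (c *: f); rewrite madjZ !mZl !mZr !scalerA; split.
  by rewrite cc (scalP sX (f^† ∘ f)) scalerA mulVf // scale1r.
rewrite mulrC cc (scalP sY (f ∘ f^†)) (scal_comm f f^† sX sY) scalerA mulVf //.
by rewrite scale1r.
Qed.

(** Transporting the solution to [X_k] along a unitary preserves both norms. *)
Lemma norm_dim S Sb (s : Mor tunit (Sb ⊗ S)) sb (k : I) : simple S ->
  conjugate_eqs s sb -> mnorm s = mnorm sb -> isomorphic S (X_ k) ->
  mnorm s ^+ 2 = sdim D (X_ k).
Proof.
move=> sS cs ns iso; have sX := rep_simple k.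
have [v [v1 v2]] := iso_unitary sS sX iso.
pose s' := (idm Sb ⊠ v) ∘ s; pose sb' := (v ⊠ idm Sb) ∘ sb.
have [z1 z2] := (conj_zz s sb).1 cs.
have cs' : conjugate_eqs s' sb'.
  apply/conj_zz; split; rewrite /zz.
    rewrite /cap /s' madjM mtadj madj1 (whM _ (tensA Sb S Sb)).
    rewrite -[wh _ _ (_ ⊠ _)]/(w22 _ _) w22_tens -cmpA -mtMr /sb' cmpA -mtMl v1 mt1.
    by rewrite cmp1m -[RHS]z1.
  rewrite /cap /sb' madjM mtadj madj1 (whM _ (tensA S Sb (X_ k))).
  rewrite -[wh _ _ (_ ⊠ _)]/(w22 _ _) w22_tens mt1 -cmpA mt_xch /s' mtMr !cmpA.
  rewrite -[wh _ _ _]/(cap sb (X_ k)) cap_nat -(cmpA v) z2 -cmpA (tensmo1 hT) cmpA v2.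
  by rewrite cmp1m.
have inj a b : (a%:C%C : R[i]) *: idm (tunit : C) = b%:C%C *: idm tunit -> a = b.
  by move=> /(congr1 (fun f => scal f)); rewrite !(scalE sU) => -[].
have n1 : mnorm s' ^+ 2 = mnorm s ^+ 2.
  apply: inj; rewrite -!unit_norm /s' madjM mtadj madj1 -cmpA (cmpA (_ ⊠ v^†)).
  by rewrite -mtM cmp1m v1 mt1 cmp1m.
have n2 : mnorm sb' ^+ 2 = mnorm sb ^+ 2.
  apply: inj; rewrite -!unit_norm /sb' madjM mtadj madj1 -cmpA (cmpA (v^† ⊠ _)).
  by rewrite -mtM cmp1m v1 mt1 cmp1m.
rewrite -n1 /sdim; apply: (simple_norm_unique sX cs' (sol_conj D (X_ k))).
  by apply/eqP; rewrite -(@eqrXn2 _ 2 (mnorm s') (mnorm sb')) ?mnorm_ge0 // n1 n2 ns.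
exact: standard_norm (sol_standard D (X_ k)).
Qed.

End StandardTrace.

Section CategoricalTrace.
Context {R : realType} {C : cstarTensorCategory R} (D : catChoices C).
Implicit Types A B X Y Z W S : C.
Local Notation I := (Irr D).
Local Notation X_ k := (rep (c:=D) k).
Local Notation sU := (ctc_unit C).
Local Notation dimk := (dimk (D := D)).

Lemma wh_wh_cast X Y Z S T Z' Z'' U U' (eS : X ⊗ Z = S) (eT : Y ⊗ Z = T)
    (eU : S ⊗ Z' = U) (eU' : T ⊗ Z' = U') (ez : Z ⊗ Z' = Z'') (e1 : X ⊗ Z'' = U)
    (e2 : Y ⊗ Z'' = U') (f : Mor X Y) :
  wh eU eU' (wh eS eT f) = wh e1 e2 f.
Proof. by case: Z'' / ez e1 e2 => e1 e2; exact: wh_wh. Qed.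

Lemma dimk_gt0 (k : I) : 0 < dimk k.
Proof.
have n0 := mnorm_neq0 (conj_neq0 (sol_conj D (X_ k)) (idm_neq0' (rep_simple k))).
by rewrite /dimk /sdim ltcR exprn_gt0 // lt_def n0 mnorm_ge0.
Qed.

(** The categorical trace, written through multiplicities so that it involves no solution for [X]
    itself; [Tr_standard] and [Tr_standard_r] identify it with the left and right traces of every
    standard solution. *)
Definition Tr X (z : Mor X X) : R[i] := \sum_(k <- irrs D X) dimk k * tau k z.

Lemma TrD X (z w : Mor X X) : Tr (z + w) = Tr z + Tr w.
Proof. by rewrite /Tr -big_split; apply: eq_bigr => k _; rewrite tauD mulrDr. Qed.
Lemma TrZ X a (z : Mor X X) : Tr (a *: z) = a * Tr z.
Proof. by rewrite /Tr mulr_sumr; apply: eq_bigr => k _; rewrite tauZ mulrCA. Qed.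
Lemma TrN X (z : Mor X X) : Tr (- z) = - Tr z.
Proof. by rewrite -scaleN1r TrZ mulN1r. Qed.
Lemma Tr0 X : Tr (0 : Mor X X) = 0.
Proof. by rewrite -(scale0r (0 : Mor X X)) TrZ mul0r. Qed.
Lemma Tr_sum X J (r : seq J) P (F : J -> Mor X X) :
  Tr (\sum_(a <- r | P a) F a) = \sum_(a <- r | P a) Tr (F a).
Proof. by apply: (big_morph (fun f => Tr f)) => [f g|]; [exact: TrD|exact: Tr0]. Qed.

Lemma Tr_widen X (z : Mor X X) (s : seq I) : uniq s -> {subset irrs D X <= s} ->
  Tr z = \sum_(k <- s) dimk k * tau k z.
Proof.
move=> us sub.
have zero (k : I) : k \notin irrs D X -> dimk k * tau k z = 0.
  by move=> /tau_notin ->; rewrite mulr0.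
rewrite /Tr -(fsum_seq (irrs_uniq D X) zero) (fsum_seq us) // => k kn.
by apply: zero; apply: contra kn; exact: sub.
Qed.

Lemma Tr_comm X Y (f : Mor X Y) (g : Mor Y X) : Tr (f ∘ g) = Tr (g ∘ f).
Proof.
pose s := undup (irrs D X ++ irrs D Y).
rewrite !(@Tr_widen _ _ s) ?undup_uniq // => [|k|k]; rewrite ?mem_undup ?mem_cat; last 2 first.
- by move=> ->.
- by move=> ->; rewrite orbT.
by apply: eq_bigr => k _; rewrite tau_comm.
Qed.

Lemma Tr_faithful X (w : Mor X X) : (forall z, Tr (z ∘ w) = 0) -> w = 0.
Proof.
move=> /(_ w^†) /eqP; rewrite /Tr psumr_eq0 => [/allP h|k _]; last first.
  by rewrite mulr_ge0 ?tau_ge0 // ltW // dimk_gt0.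
apply: (@tau_faithful _ _ D) => k.
have [/h|/tau_notin -> //] := boolP (k \in irrs D X).
by rewrite /= mulf_eq0 gt_eqF ?dimk_gt0 //= => /eqP.
Qed.

Lemma tau_iso S (k l : I) : isomorphic S (X_ k) -> tau l (idm S) = (l == k)%:R.
Proof. by move=> [v [v' [<- vv']]]; rewrite tau_comm vv' tau_rep. Qed.

Lemma Tr_iso S (k : I) : isomorphic S (X_ k) -> Tr (idm S) = dimk k.
Proof.
move=> kS; have kin : k \in irrs D S.
  apply: contraT => kn; have /eqP := tau_notin (idm S) kn.
  by rewrite (tau_iso k kS) eqxx oner_eq0.
rewrite /Tr (bigD1_seq k) ?irrs_uniq //= (tau_iso k kS) eqxx mulr1 big1 ?addr0 // => l lk.
by rewrite (tau_iso l kS) (negbTE lk) mulr0.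
Qed.

Lemma Tr_isometries X n (S : 'I_n -> C) (w : forall a, Mor (S a) X) (d : 'I_n -> R[i])
    (z : Mor X X) :
  (forall a, simple (S a)) -> \sum_a w a ∘ (w a)^† = idm X ->
  (forall a k, isomorphic (S a) (X_ k) -> d a = dimk k) ->
  Tr z = \sum_a scal ((w a)^† ∘ z ∘ w a) * d a.
Proof.
move=> sS ws hd; rewrite -{1}[z]cmpm1 -ws cmp_sumr Tr_sum; apply: eq_bigr => a _.
rewrite cmpA Tr_comm cmpA (scalP (sS a) (_ ∘ z ∘ _)) TrZ scalE //; congr (_ * _).
by have [k kS] := rep_surj D (sS a); rewrite (hd a k kS); exact: Tr_iso.
Qed.

Lemma Tr_standard X Xb (r : Mor tunit (Xb ⊗ X)) rb (z : Mor X X) : standard r rb ->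
  r^† ∘ (idm Xb ⊠ z) ∘ r = Tr z *: idm tunit.
Proof.
move=> [crb [n [S [Sb [w [wb [s [sb [hS [wi ws] [wbi wbs] hr hrb]]]]]]]]].
have sS a : simple (S a) by case: (hS a).
rewrite (standard_left D z sS wbi wbs hr crb); congr (_ *: _).
apply/esym/Tr_isometries => // a k kS; rewrite /Defs.sdim.
have [_ ca na] := hS a.
by congr (_%:C%C); exact: (norm_dim (sS a) ca na kS).
Qed.

Lemma standard_right X Xb (r : Mor tunit (Xb ⊗ X)) rb n (S Sb : 'I_n -> C)
    (w : forall a, Mor (S a) X) (wb : forall a, Mor (Sb a) Xb)
    (sb : forall a, Mor tunit (S a ⊗ Sb a)) (z : Mor X X) :
  (forall a, simple (S a)) ->
  (forall a, (wb a)^† ∘ wb a = idm (Sb a)) -> \sum_a wb a ∘ (wb a)^† = idm Xb ->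
  rb = \sum_a (w a ⊠ wb a) ∘ sb a -> conjugate_eqs r rb ->
  rb^† ∘ (z ⊠ idm Xb) ∘ rb =
  (\sum_a scal ((w a)^† ∘ z ∘ w a) * (mnorm (sb a) ^+ 2)%:C%C) *: idm tunit.
Proof.
move=> hS wbi wbs hr cr; rewrite hr madj_sum -cmpA !cmp_suml scaler_suml.
apply: eq_bigr => a _; rewrite cmp_sumr cmp_sumr (bigD1 a) //= big1 => [|b ba].
  rewrite addr0 madjM mtadj cmpA cmpA -(cmpA (sb a)^†) -mtM -(cmpA (sb a)^†) -mtM.
  rewrite cmpm1 wbi (scalP (hS a) (_ ∘ z ∘ _)) scalE // mtZl mt1 mZr mZl cmpm1.
  by rewrite unit_norm scalerA.
rewrite madjM mtadj cmpA cmpA -(cmpA (sb a)^†) -mtM -(cmpA (sb a)^†) -mtM.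
by rewrite cmpm1 (isometries_orth D wbi wbs) 1?eq_sym // mt0r m0r m0l.
Qed.

Lemma Tr_standard_r X Xb (r : Mor tunit (Xb ⊗ X)) rb (z : Mor X X) : standard r rb ->
  rb^† ∘ (z ⊠ idm Xb) ∘ rb = Tr z *: idm tunit.
Proof.
move=> [crb [n [S [Sb [w [wb [s [sb [hS [wi ws] [wbi wbs] hr hrb]]]]]]]]].
have sS a : simple (S a) by case: (hS a).
rewrite (standard_right z sS wbi wbs hrb crb); congr (_ *: _).
apply/esym/Tr_isometries => // a k kS.
have [_ ca na] := hS a; rewrite -na.
by congr (_%:C%C); exact: (norm_dim (sS a) ca na kS).
Qed.

Definition ltrace A B (z : Mor (A ⊗ B) (A ⊗ B)) : Mor B B :=
  cap (sol D A) B ∘ (idm (dual D A) ⊠ z) ∘ cup (sol D A) B.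

(* Closing A ⊗ B on the left and on the right gives the same scalar, because the
   left and the right trace agree on A and on B; so the nested solution for A ⊗ B
   computes the same trace as the standard one. *)
Lemma Tr_ltrace A B (z : Mor (A ⊗ B) (A ⊗ B)) : Tr (ltrace z) = Tr z.
Proof.
set Ab := dual D A; set Bb := dual D B.
have stA := sol_standard D A; have stB := sol_standard D B.
have cN := nest_conj (sol_conj D A) (sol_conj D B).
have L y : (nest (sol D B) (sol D A))^† ∘ (idm (Bb ⊗ Ab) ⊠ y) ∘ nest (sol D B) (sol D A) =
    Tr (ltrace y) *: idm tunit.
  rewrite -(Tr_standard _ stB) /nest !madjM mtadj madj1 cup_adj eqmadj esymK /ltrace.
  rewrite !cmpA -(cmpA _ (eqm _)) tensA_mv !cmpA -(cmpA _ (eqm _)) eqmVK cmpm1 !mtMr.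
  by rewrite !cmpA.
(* [E y] is the right partial trace of [y] over [B], and [G y T] is the same morphism with a
   spectator [T] on its right. *)
pose G y T : Mor (A ⊗ T) (A ⊗ T) := (idm A ⊠ cap (solb D B) T) ∘ w22 y (Bb ⊗ T) ∘
    (idm A ⊠ cup (solb D B) T).
pose E y : Mor A A := eqm (tenso1 A) ∘ G y tunit ∘ eqm (esym (tenso1 A)).
have EG y T : E y ⊠ idm T = G y T.
  have e1 : (A ⊗ tunit) ⊗ T = A ⊗ T by rewrite tenso1.
  have e2 : (A ⊗ (B ⊗ (Bb ⊗ tunit))) ⊗ T = A ⊗ (B ⊗ (Bb ⊗ T)) by rewrite tenso1 !tensA.
  have e3 : (B ⊗ (Bb ⊗ tunit)) ⊗ T = B ⊗ (Bb ⊗ T) by rewrite tenso1 !tensA.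
  rewrite /E -wh_erefl (whM _ e1) (whM _ e1) !(wh_eqm _ _ _ erefl) /= cmp1m cmpm1.
  rewrite /G (whM _ e2) (whM _ e2) !(wh_tensl _ _ (tens1o T) e3) !(wh_tensl _ _ e3 (tens1o T)).
  rewrite /cap /cup (wh_wh_cast _ _ _ _ (tens1o T) (tens1o T) (tensA B Bb T)).
  rewrite (wh_wh_cast _ _ _ _ (tens1o T) (tensA B Bb T) (tens1o T)).
  have ez : (Bb ⊗ tunit) ⊗ T = Bb ⊗ T by rewrite tenso1.
  by rewrite /w22 (wh_wh_cast _ _ _ _ ez (tensA A B (Bb ⊗ T)) (tensA A B (Bb ⊗ T))).
have spher y : (nest (sol D B) (sol D A))^† ∘ (idm (Bb ⊗ Ab) ⊠ y) ∘ nest (sol D B) (sol D A) =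
    (nest (solb D A) (solb D B))^† ∘ (y ⊠ idm (Bb ⊗ Ab)) ∘ nest (solb D A) (solb D B).
  have -> : (nest (solb D A) (solb D B))^† ∘ (y ⊠ idm (Bb ⊗ Ab)) ∘
      nest (solb D A) (solb D B) = (solb D A)^† ∘ G y Ab ∘ solb D A.
    rewrite /nest !madjM mtadj madj1 cup_adj eqmadj esymK /G /w22 wh_def.
    by rewrite !cmpA.
  rewrite L -EG (Tr_standard_r _ stA) -(Tr_standard _ stA) -(Tr_standard_r _ stB).
  have e1 : (Ab ⊗ (A ⊗ B)) ⊗ Bb = Ab ⊗ (A ⊗ (B ⊗ Bb)) by rewrite !tensA.
  have -> : ltrace y ⊠ idm Bb = cap (sol D A) (B ⊗ Bb) ∘ (idm Ab ⊠ w22 y Bb) ∘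
      cup (sol D A) (B ⊗ Bb).
    rewrite -wh_erefl /ltrace !(whM _ e1) (wh_tensl _ _ (tensA A B Bb) (tensA A B Bb)).
    by rewrite /cap /cup !(wh_wh _ _ _ _ (tens1o (B ⊗ Bb)) (tensA Ab A (B ⊗ Bb)))
      !(wh_wh _ _ _ _ (tensA Ab A (B ⊗ Bb)) (tens1o (B ⊗ Bb))).
  rewrite -!cmpA cup_nat !cmpA -cap_nat -!cmpA [in LHS](cmpA (idm Ab ⊠ _)) -mtMr.
  rewrite [in LHS](cmpA (idm Ab ⊠ _)) -mtMr.
  have u1 : cup (sol D A) tunit = (idm Ab ⊠ eqm (esym (tenso1 A))) ∘ sol D A.
    rewrite (mt_eqmr _ (congr1 (tens Ab) (esym (tenso1 A)))) /cup.
    rewrite (wh_unitE _ _ erefl (congr1 (tens Ab) (esym (tenso1 A)))) cmpm1 //.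
  have u2 : cap (sol D A) tunit = (sol D A)^† ∘ (idm Ab ⊠ eqm (tenso1 A)).
    by rewrite -cup_adj u1 madjM mtadj madj1 eqmadj esymK.
  have e : Bb = Bb ⊗ tunit by rewrite tenso1.
  have v1 : cup (solb D B) tunit = (idm B ⊠ eqm e) ∘ solb D B.
    rewrite (mt_eqmr _ (congr1 (tens B) e)) /cup.
    by rewrite (wh_unitE _ _ erefl (congr1 (tens B) e)) cmpm1.
  have v2 : cap (solb D B) tunit = (solb D B)^† ∘ (idm B ⊠ eqm (esym e)).
    by rewrite -cup_adj v1 madjM mtadj madj1 eqmadj.
  have hG : G y tunit =
      (idm A ⊠ (solb D B)^†) ∘ (w22 y Bb ∘ (idm A ⊠ solb D B)).
    rewrite /G v1 v2 !mtMr -!cmpA (cmpA (w22 y _)) w22_nat -!cmpA.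
    by rewrite (cmpA (idm A ⊠ (idm B ⊠ eqm (esym e)))) -!mtMr eqmVK !mt1 cmp1m.
  by rewrite u1 u2 -!cmpA -hG /E !mtMr !cmpA.
have h := spherical_unique D (sol_conj D (A ⊗ B)) cN
  (fun y => Tr_standard y (sol_standard D (A ⊗ B)))
  (fun y => Tr_standard_r y (sol_standard D (A ⊗ B))) (@Tr_comm _ _) (@Tr_faithful _)
  (fun y w => etrans (TrD y (- w)) (congr1 _ (TrN w))) spher z.
by move: h; rewrite L => /(congr1 (fun f => scal f)); rewrite !(scalE sU).
Qed.

End CategoricalTrace.

(** * Multipliers and bent endomorphisms *)

Section Opening.
Context {R : realType} {C : cstarTensorCategory R} (D : catChoices C).
Implicit Types A B X Y Z W S : C.
Local Notation I := (Irr D).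
Local Notation hT := (ctc_tensor C).
Local Notation sU := (ctc_unit C).
Local Notation dimk := (dimk (D := D)).

Lemma cap_mv A A' X (u : Mor tunit (A ⊗ X)) (w : Mor A A') Z :
  cap ((w ⊠ idm X) ∘ u) Z = cap u Z ∘ (w^† ⊠ idm (X ⊗ Z)).
Proof.
rewrite /cap madjM mtadj madj1 (whM _ (tensA A X Z)).
by rewrite -[wh _ _ (_ ⊠ _)]/(w22 _ _) w22_tens mt1.
Qed.

Lemma cap1 A X (u : Mor tunit (A ⊗ X)) :
  cap u tunit = u^† ∘ (idm A ⊠ eqm (tenso1 X)).
Proof.
have e : A ⊗ (X ⊗ tunit) = A ⊗ X by rewrite tenso1.
by rewrite (mt_eqmr _ e) /cap (wh_unitE _ _ e erefl) cmp1m.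
Qed.

(* The part of [hat] to the right of the bent strand. *)
Definition opening X Y Y' Z (rb : Mor tunit (Y ⊗ Y')) (b : Mor (X ⊗ Y) Z) :
    Mor X (Z ⊗ Y') :=
  (b ⊠ idm Y') ∘ eqm (esym (tensA X Y Y')) ∘ (idm X ⊠ rb) ∘ eqm (esym (tenso1 X)).

(** The operation [hat] for arbitrary cups and for different source and target. The involution of
    the tube algebra has the same shape. *)
Definition bend X X1 X' Y Y1 Y' (u : Mor tunit (X' ⊗ X1)) (rb : Mor tunit (Y ⊗ Y'))
    (v : Mor (X ⊗ Y) (X1 ⊗ Y1)) : Mor (X' ⊗ X) (Y1 ⊗ Y') :=
  cap u (Y1 ⊗ Y') ∘ (idm X' ⊠ (eqm (tensA X1 Y1 Y') ∘ opening rb v)).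

Lemma mid_bend X X1 X' Y Y1 Y' (u : Mor tunit (X' ⊗ X1)) (rb : Mor tunit (Y ⊗ Y'))
    (v : Mor (X ⊗ Y) (X1 ⊗ Y1)) :
  eqm (tens1o (Y1 ⊗ Y')) ∘ (u^† ⊠ idm (Y1 ⊗ Y')) ∘ mid X' Y' v
  ∘ (idm (X' ⊗ X) ⊠ rb) ∘ eqm (esym (tenso1 (X' ⊗ X))) = bend u rb v.
Proof.
rewrite /bend /mid /opening /cap wh_def !mtMr !cmpA.
have -> : idm (X' ⊗ X) ⊠ rb =
   eqm (esym (tensA X' X (Y ⊗ Y'))) ∘ (idm X' ⊠ (idm X ⊠ rb)) ∘ eqm (tensA X' X tunit).
  by rewrite -tensA_conj !cmpA eqmM eqm1 cmp1m -cmpA eqmVK cmpm1.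
rewrite (mt_eqmr _ (congr1 (tens X') (tensA X1 Y1 Y'))).
rewrite (mt_eqmr _ (congr1 (tens X') (esym (tensA X Y Y')))).
rewrite (mt_eqmr _ (congr1 (tens X') (esym (tenso1 X)))).
rewrite -!cmpA; congr (_ ∘ (_ ∘ _)).
rewrite !cmpA !eqmM -!cmpA !eqmM (cmpA (eqm _) (eqm _)) eqmM.
do ?[congr (_ ∘ _) | exact: eqm_irr].
Qed.

Lemma hatE X Y (v : Mor (X ⊗ Y) (X ⊗ Y)) : hat D v = bend (sol D X) (solb D Y) v.
Proof. exact: mid_bend. Qed.

Lemma openingE X Y Y' Z (rb : Mor tunit (Y ⊗ Y')) (b : Mor (X ⊗ Y) Z) :
  opening rb b = w21 b Y' ∘ (idm X ⊠ rb) ∘ eqm (esym (tenso1 X)).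
Proof. by rewrite /opening /w21 wh_def cmp1m. Qed.

(** Closing the strand [A] of [f] with [rb] gives [b]; a zigzag undoes this. *)
Lemma opening_ex A Ab B Y (r : Mor tunit (Ab ⊗ A)) (rb : Mor tunit (A ⊗ Ab))
  (f : Mor B (Y ⊗ A)) : zz rb r -> exists b : Mor (B ⊗ Ab) Y, f = opening r b.
Proof.
move=> z; exists (eqm (tenso1 Y) ∘ (idm Y ⊠ rb^†) ∘ w12 f Ab); rewrite openingE.
have e1 : (Y ⊗ (A ⊗ Ab)) ⊗ A = Y ⊗ (A ⊗ (Ab ⊗ A)) by rewrite !tensA.
have e2 : (Y ⊗ tunit) ⊗ A = Y ⊗ A by rewrite tenso1.
rewrite /w21 (whM _ e1) (whM _ e2) (wh_eqm _ _ _ erefl) /= cmp1m.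
rewrite (wh_tensl _ _ (tensA A Ab A) (tens1o A)) -/(cap rb A).
rewrite /w12 (wh_wh _ _ _ _ erefl (tensA Y A (Ab ⊗ A))) -/(w12 f (Ab ⊗ A)).
rewrite -!cmpA (cmpA (w12 f _)) w12_nat !cmpA -mtMr z.
have e3 : Y ⊗ (A ⊗ tunit) = Y ⊗ A by rewrite tenso1.
rewrite (mt_eqmr _ e3) /w12 (wh_unitE _ _ (tenso1 B) (esym e3)) !cmpA eqmVK cmp1m.
by rewrite -cmpA eqmVK cmpm1.
Qed.

Lemma opening_post X Y Y' Z Z' (rb : Mor tunit (Y ⊗ Y')) (b : Mor (X ⊗ Y) Z)
    (h : Mor Z Z') : opening rb (h ∘ b) = (h ⊠ idm Y') ∘ opening rb b.
Proof. by rewrite /opening mtMl !cmpA. Qed.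

Lemma opening_mv X Y Y' Y'' Z (rb : Mor tunit (Y ⊗ Y')) (m : Mor Y' Y'')
    (b : Mor (X ⊗ Y) Z) :
  opening ((idm Y ⊠ m) ∘ rb) b = (idm Z ⊠ m) ∘ opening rb b.
Proof. by rewrite !openingE mtMr !cmpA w21_nat. Qed.

Lemma bend_mv X X1 X' X'' Y Y1 Y' Y'' (u : Mor tunit (X' ⊗ X1)) (w : Mor X' X'')
    (rb : Mor tunit (Y ⊗ Y')) (m : Mor Y' Y'') (v : Mor (X ⊗ Y) (X1 ⊗ Y1)) :
  bend ((w ⊠ idm X1) ∘ u) ((idm Y ⊠ m) ∘ rb) v =
  (idm Y1 ⊠ m) ∘ bend u rb v ∘ (w^† ⊠ idm X).
Proof.
rewrite /bend opening_mv cmpA tensA_mv -(cmpA _ _ (opening _ _)).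
rewrite cap_mv -cmpA mt_xch mtMr.
by rewrite !cmpA cap_nat.
Qed.

(** Both solutions compute the trace of [Y]. If [t] is the transpose of [w^† ∘ w], then [z ∘ t] and
    [z] have the same trace for every [z], and faithfulness gives [t = idm Y]. *)
Lemma standard_isometry X X' Y (r : Mor tunit (X ⊗ Y)) rb (r' : Mor tunit (X' ⊗ Y)) rb'
    (w : Mor X X') :
  standard r rb -> standard r' rb' -> r' = (w ⊠ idm Y) ∘ r -> w^† ∘ w = idm X.
Proof.
move=> st st' hw; have [cr _] := st.
have [t ht] := cotranspose_r_ex cr (((w^† ∘ w) ⊠ idm Y) ∘ r).
have t1 : t = idm Y.
  apply/eqP; rewrite -subr_eq0; apply/eqP/(Tr_faithful (D := D)) => z.
  have inj a b : a *: idm (tunit : C) = b *: idm tunit -> a = b.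
    by move=> /(congr1 (fun f => scal f)); rewrite !(scalE sU).
  apply: inj; rewrite cmpDr cmpNr cmpm1 TrD TrN scalerBl.
  rewrite -(Tr_standard D (z ∘ t) st) -(Tr_standard D z st') hw.
  rewrite madjM mtadj madj1 mtMr -!cmpA -ht mtMl !cmpA.
  by rewrite -(cmpA r^† (w^† ⊠ _) (idm _ ⊠ z)) mt_xch !cmpA subrr scale0r.
apply: (transpose_l_uniq cr); apply: madj_inj.
by rewrite !(madjM, mtadj, madjK, madj1) ht t1.
Qed.

Definition isotypic_mult (psi : I -> R[i]) Z W (h : Mor Z W) : Mor Z W :=
  \sum_(k \in [set: I]) psi k *: (h ∘ isotypic k Z).

Lemma isotypic_mult_seq psi Z W (h : Mor Z W) (s : seq I) : uniq s ->
  {subset irrs D Z <= s} -> isotypic_mult psi h = \sum_(k <- s) psi k *: (h ∘ isotypic k Z).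
Proof.
move=> us sub; apply: fsum_seq => // k ks.
by rewrite isotypic0 ?m0r ?scaler0 //; apply: contra ks; exact: sub.
Qed.

Lemma isotypic_multM psi Z Z' W W' (M : Mor W W') (h : Mor Z W) (N : Mor Z' Z) :
  isotypic_mult psi (M ∘ h ∘ N) = M ∘ isotypic_mult psi h ∘ N.
Proof.
pose s := undup (irrs D Z ++ irrs D Z'); have us : uniq s := undup_uniq _.
rewrite !(@isotypic_mult_seq _ _ _ _ s) // => [|k|k]; last 2 first.
- by rewrite mem_undup mem_cat => ->; rewrite ?orbT.
- by rewrite mem_undup mem_cat => ->; rewrite ?orbT.
rewrite cmp_sumr cmp_suml; apply: eq_bigr => k _.
by rewrite mZr mZl !cmpA -!cmpA isotypic_nat.
Qed.

Section TraceIdentity.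
Variables (X Y : C) (r : Mor tunit (X ⊗ Y)) (rb : Mor tunit (Y ⊗ X)).
Hypothesis st : standard r rb.

Let cr : conjugate_eqs r rb. Proof. by case: st. Qed.

(** Write [r^† ∘ v] as [r^† ∘ (e ⊠ idm Y)]. The left-hand side is then the trace of [e], and [e] is
    the left partial trace over [Y] of the bent morphism. *)
Lemma Tr_bend (v : Mor (X ⊗ Y) (X ⊗ Y)) :
  r^† ∘ v ∘ r = Tr D (bend rb rb v) *: idm tunit.
Proof.
have [z1 z2] := (conj_zz _ _).1 cr.
have [w hw] := cotranspose_l_ex cr (sol D Y).
have ww := standard_isometry st (sol_standard D Y) hw.
have [e he] := transpose_l_ex cr (r^† ∘ v).
rewrite he (Tr_standard_r D e (standard_sym st)) -Tr_ltrace; congr (Tr D _ *: _).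
rewrite /ltrace /bend mtMr -!cmpA -cup_nat.
have -> : cup (sol D Y) (X ⊗ (Y ⊗ X)) = (w ⊠ idm _) ∘ cup r (X ⊗ (Y ⊗ X)).
  by rewrite hw -[RHS]madjK madjM mtadj cup_adj madj1 -cap_mv cap_adj.
rewrite -!cmpA (cmpA (idm (dual D Y) ⊠ _) (w ⊠ idm _)) -mt_xch hw cap_mv.
rewrite !cmpA -(cmpA (cap r X)) -mtMl ww mt1 cmpm1 -(cmpA _ _ (cup r _)) zig // cmpm1.
rewrite -(cmpA (cap r X)).
rewrite (transpose_l_inj cr e) -he.
by rewrite /capm (whM _ (tensA X Y X)) (wh_def _ _ v) -/(cap r X) !cmpA.
Qed.

(** [bend rb rb] is [hat] composed on both sides with fixed morphisms between duals, and isotypic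
    projections are natural. *)
Lemma multiplier_bend (psi : I -> R[i]) (Th : endo_family) (v : Mor (X ⊗ Y) (X ⊗ Y)) :
  multiplier_of psi Th ->
  bend rb rb (Th X Y v) =
  \sum_(k \in [set: I]) psi k *: (bend rb rb v ∘ isotypic k (Y ⊗ X)).
Proof.
move=> hTh.
have [w hw] := cotranspose_l_ex (conj_swap cr) (sol D X).
have [w' hw'] := cotranspose_l_ex (sol_conj D X) rb.
have [m hm] := cotranspose_r_ex (conj_swap cr) (solb D Y).
have [m' hm'] := cotranspose_r_ex (conj_swap (sol_conj D Y)) rb.
have ww : w^† ∘ w'^† = idm Y.
  apply: (transpose_l_uniq (conj_swap cr)); apply: madj_inj.
  by rewrite !(madjM, mtadj, madjK, madj1) mtMl -cmpA -hw -hw' mt1 cmp1m.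
have mm : m' ∘ m = idm X.
  apply: madj_inj; rewrite madjM madj1; apply: (transpose_r_uniq (conj_swap cr)).
  by apply: madj_inj; rewrite !(madjM, mtadj, madjK, madj1) mtMr -cmpA -hm -hm' mt1 cmp1m.
have bendE x : bend rb rb x = (idm Y ⊠ m') ∘ hat D x ∘ (w'^† ⊠ idm X).
  rewrite hatE {1}hw {1}hm bend_mv -!cmpA -mtMl ww mt1 cmpm1.
  by rewrite cmpA -mtMr mm mt1 cmp1m.
by rewrite bendE hTh -[X in _ ∘ X ∘ _]/(isotypic_mult psi (hat D v)) -isotypic_multM -bendE.
Qed.

(* The trace of a bent endomorphism is its value between standard solutions, so a
   multiplier acts on such values through the coefficients [tau k]. *)
Lemma multiplier_trace (psi : I -> R[i]) (Th : endo_family) (v : Mor (X ⊗ Y) (X ⊗ Y)) :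
  multiplier_of psi Th ->
  scal (r^† ∘ Th X Y v ∘ r) =
  \sum_(k \in [set: I]) psi k * dimk k * tau k (bend rb rb v).
Proof.
move=> hTh; rewrite Tr_bend (scalE sU) (multiplier_bend v hTh).
rewrite !(fsum_seq (irrs_uniq D (Y ⊗ X))) => [|k /tau_notin ->|k /isotypic0 ->]; last 2 first.
- by rewrite mulr0.
- by rewrite m0r scaler0.
rewrite Tr_sum big_seq [RHS]big_seq; apply: eq_bigr => k kin.
rewrite TrZ -mulrA; congr (_ * _); rewrite /Tr (bigD1_seq k) ?irrs_uniq //=.
rewrite tau_isotypic eqxx mul1r big1 ?addr0 // => l lk.
by rewrite tau_isotypic (negbTE lk) mul0r mulr0.
Qed.

Lemma w21_unbend Z W (b : Mor Z (X ⊗ Y)) :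
  w21 (cap rb Y ∘ (idm Y ⊠ b)) W = cap rb (Y ⊗ W) ∘ (idm Y ⊠ w12 b W).
Proof.
have e : (Y ⊗ (X ⊗ Y)) ⊗ W = Y ⊗ (X ⊗ (Y ⊗ W)) by rewrite !tensA.
rewrite /w21 (whM _ e) /cap (wh_wh _ _ _ _ (tensA Y X (Y ⊗ W)) (tens1o (Y ⊗ W))).
by rewrite (wh_tensl _ _ erefl (tensA X Y W)).
Qed.

Lemma opening_sharp Z (b : Mor (X ⊗ Y) Z) :
  is_sharp rb (opening rb b) (cap rb Y ∘ (idm Y ⊠ b^†)).
Proof.
rewrite /is_sharp w21_unbend openingE !(madjM, mtadj, madj1) w21_adj eqmadj esymK !mtMr.
by rewrite !cmpA -cap1 cap_nat.
Qed.

(** The link with multipliers: the coefficients of this kernel are the numbers [tau k] in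
    [multiplier_trace]. *)
Lemma opening_kern Z (b b' : Mor (X ⊗ Y) Z) :
  kern D (opening rb b) (opening rb b') = fus D (bend rb rb (b^† ∘ b')).
Proof.
rewrite (kernE D (opening rb b') (conj_swap cr) (opening_sharp b)) /loop w21_unbend.
congr (fus D _); rewrite /bend -!cmpA -mtMr opening_post; congr (_ ∘ (_ ⊠ _)).
by rewrite /w12 wh_def cmpm1 !cmpA.
Qed.


End TraceIdentity.

End Opening.

(** * Tubes acting on kernels *)

Section TubeKernels.
Context {R : realType} {C : cstarTensorCategory R} (D : catChoices C).
Implicit Types A B X Y Z W S : C.
Local Notation I := (Irr D).
Local Notation X_ k := (rep (c:=D) k).
Local Notation sU := (ctc_unit C).

Lemma bend_w22 X X1 X' Y Y1 Y' (u : Mor tunit (X' ⊗ X1)) (rb : Mor tunit (Y ⊗ Y'))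
    (v : Mor (X ⊗ Y) (X1 ⊗ Y1)) :
  bend u rb v = cap u (Y1 ⊗ Y') ∘ (idm X' ⊠ (w22 v Y' ∘ (idm X ⊠ rb) ∘ eqm (esym (tenso1 X)))).
Proof. by rewrite /bend /opening /w22 wh_def !cmpA. Qed.

Lemma w22_bend X X1 X' Y Y1 Y' (u : Mor tunit (X' ⊗ X1)) (rb : Mor tunit (Y ⊗ Y'))
    (v : Mor (X ⊗ Y) (X1 ⊗ Y1)) W :
  w22 (bend u rb v) W = cap u (Y1 ⊗ (Y' ⊗ W)) ∘
    (idm X' ⊠ (w22 v (Y' ⊗ W) ∘ (idm X ⊠ cup rb W))).
Proof.
have e1 : (X' ⊗ (X1 ⊗ (Y1 ⊗ Y'))) ⊗ W = X' ⊗ (X1 ⊗ (Y1 ⊗ (Y' ⊗ W))) by rewrite !tensA.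
have e2 : (X ⊗ (Y ⊗ Y')) ⊗ W = X ⊗ (Y ⊗ (Y' ⊗ W)) by rewrite !tensA.
have e3 : (X1 ⊗ (Y1 ⊗ Y')) ⊗ W = X1 ⊗ (Y1 ⊗ (Y' ⊗ W)) by rewrite !tensA.
have e4 : (X ⊗ tunit) ⊗ W = X ⊗ W by rewrite tenso1.
rewrite bend_w22 {1}/w22 (whM _ e1) (wh_tensl _ _ erefl e3) /cap.
have ez : (Y1 ⊗ Y') ⊗ W = Y1 ⊗ (Y' ⊗ W) by rewrite tensA.
rewrite (wh_wh_cast _ _ _ _ ez (tensA X' X1 (Y1 ⊗ (Y' ⊗ W))) (tens1o (Y1 ⊗ (Y' ⊗ W)))).
rewrite (whM _ e4) (whM _ e2) (wh_eqm _ _ _ erefl) cmpm1.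
rewrite (wh_tensl _ _ (tens1o W) (tensA Y Y' W)).
by rewrite /w22 (wh_wh _ _ _ _ (tensA X Y (Y' ⊗ W)) (tensA X1 Y1 (Y' ⊗ W))).
Qed.

Lemma bend_rot A Ab Y Y' (r : Mor tunit (Ab ⊗ A)) (rb : Mor tunit (A ⊗ Ab))
    (a : Mor (A ⊗ Y) (Y' ⊗ A)) : zz rb r -> is_rot r (bend r rb a^†) a.
Proof.
move=> z Z; rewrite w22_bend cmpA -cap_nat -cmpA; congr (_ ∘ _).
rewrite -mtMr; congr (_ ⊠ _).
by rewrite cmpA -w22_nat -cmpA -mtMr zig // mt1 cmpm1.
Qed.

(** By [mid_bend], a component of [tube_star x] is the adjoint of a component of [x] bent by
    [irr_sol] and [irr_solb], that is, its rotation. *)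
Lemma kern_act_star i j (k : I) (x : tube D) X X'
    (g : Mor X (X_ i ⊗ X)) (h : Mor X' (X_ j ⊗ X')) :
  kern D h (act (tube_star x (i, j, k)) g) = kern D (act (x (j, i, bar k)) h) g.
Proof.
have cr := irr_sol_conj k; have [z1 z2] := (conj_zz _ _).1 cr.
rewrite (kern_act D h g (conj_swap cr) (bend_rot _ z1)); congr (kern D h (act _ g)).
exact: mid_bend.
Qed.

Lemma act_compress K L M I1 S J Z (V : Mor K (M ⊗ L)) (f : Mor (M ⊗ S) (J ⊗ M))
    (g : Mor (L ⊗ I1) (S ⊗ L)) (z : Mor Z (I1 ⊗ Z)) :
  act ((idm J ⊠ V^†) ∘ eqm (tensA J M L) ∘ (f ⊠ idm L) ∘ eqm (esym (tensA M S L))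
    ∘ (idm M ⊠ g) ∘ eqm (tensA M L I1) ∘ (V ⊠ idm I1)) z =
  (idm J ⊠ ((V^† ⊠ idm Z) ∘ eqm (esym (tensA M L Z)))) ∘ act f (act g z)
    ∘ (eqm (tensA M L Z) ∘ (V ⊠ idm Z)).
Proof.
have ea : (M ⊗ (L ⊗ I1)) ⊗ Z = M ⊗ (L ⊗ (I1 ⊗ Z)) by rewrite !tensA.
have eb : (M ⊗ (S ⊗ L)) ⊗ Z = M ⊗ (S ⊗ (L ⊗ Z)) by rewrite !tensA.
have ec : ((M ⊗ S) ⊗ L) ⊗ Z = M ⊗ (S ⊗ (L ⊗ Z)) by rewrite !tensA.
have ed : ((J ⊗ M) ⊗ L) ⊗ Z = J ⊗ (M ⊗ (L ⊗ Z)) by rewrite !tensA.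
have ee : J ⊗ (M ⊗ (L ⊗ Z)) = J ⊗ ((M ⊗ L) ⊗ Z) by rewrite !tensA.
rewrite {1}/act /w22 (whM _ (tensA (M ⊗ L) I1 Z)) (whM _ ea) (whM _ eb) (whM _ ec).
rewrite (whM _ ed) (whM _ (tensA J (M ⊗ L) Z)).
rewrite (wh_eqm _ _ _ (tensA M L (I1 ⊗ Z))) (wh_eqm _ _ _ erefl) (wh_eqm _ _ _ ee) cmpm1.
rewrite -![wh (tensA _ _ Z) (tensA _ _ Z) _]/(w22 _ Z) !w22_tens.
rewrite -(wh_erefl L f) (wh_wh _ _ _ _ (tensA M S (L ⊗ Z)) (tensA J M (L ⊗ Z))).
rewrite (wh_tensl _ _ (tensA L I1 Z) (tensA S L Z)) mt1.
rewrite -!cmpA mt_xch (cmpA (eqm (tensA M L _))) tensA_mv.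
by rewrite [in RHS]mtMr (mt_eqmr _ ee) /act mtMr /w22 !cmpA.
Qed.

(** The adjoint of [V] slides around the annulus and meets [V]; the sum of the resulting projections
    is the identity of [M ⊗ L]. This is why the product of the tube algebra becomes composition of
    actions. *)
Lemma kern_compress L M I1 S J Z X (f : Mor (M ⊗ S) (J ⊗ M))
    (g : Mor (L ⊗ I1) (S ⊗ L)) (z : Mor Z (I1 ⊗ Z)) (h : Mor X (J ⊗ X)) :
  \sum_(k <- irrs D (M ⊗ L)) \sum_(V <- onb k (M ⊗ L))
    kern D h (act ((idm J ⊠ V^†) ∘ eqm (tensA J M L) ∘ (f ⊠ idm L) ∘ eqm (esym (tensA M S L))
    ∘ (idm M ⊠ g) ∘ eqm (tensA M L I1) ∘ (V ⊠ idm I1)) z) =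
  kern D h (act f (act g z)).
Proof.
set e := eqm (tensA M L Z); set e' := eqm (esym (tensA M L Z)).
have ee : e' ∘ e = idm _ by rewrite /e /e' eqmVK.
transitivity (kern D h ((idm J ⊠ e') ∘ (act f (act g z) ∘ e))); last first.
  by rewrite kern_natr -cmpA /e /e' eqmVK cmpm1.
have -> : act f (act g z) ∘ e = \sum_(k <- irrs D (M ⊗ L)) \sum_(V <- onb k (M ⊗ L))
    act f (act g z) ∘ e ∘ ((V ∘ V^†) ⊠ idm Z).
  rewrite -[LHS]cmpm1 -mt1 (idm_onb D) mt_suml cmp_sumr; apply: eq_bigr => k _.
  by rewrite mt_suml cmp_sumr.
rewrite cmp_sumr kern_sumr; apply: eq_bigr => k _.
rewrite cmp_sumr kern_sumr; apply: eq_bigr => V _.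
by rewrite act_compress -/e -/e' mtMr mtMl -!cmpA kern_natr -!cmpA.
Qed.

Lemma actP A Y Y' X c (f f' : Mor (A ⊗ Y) (Y' ⊗ A)) (x : Mor X (Y ⊗ X)) :
  act (c *: f + f') x = c *: act f x + act f' x.
Proof. by rewrite /act /w22 whD whZ cmpDl mZl. Qed.

Lemma act_post A Y Y' Y'' X (h : Mor Y' Y'') (f : Mor (A ⊗ Y) (Y' ⊗ A)) (x : Mor X (Y ⊗ X)) :
  act ((h ⊠ idm A) ∘ f) x = (h ⊠ idm (A ⊗ X)) ∘ act f x.
Proof.
by rewrite /act /w22 (whM _ (tensA Y' A X)) -[wh _ _ (h ⊠ _)]/(w22 _ X) w22_tens mt1 cmpA.
Qed.


Section Conjugation.
Variables (A Ab Y : C) (r : Mor tunit (Ab ⊗ A)) (rb : Mor tunit (A ⊗ Ab)).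
Hypothesis cr : conjugate_eqs r rb.
Local Notation W := ((A ⊗ Y) ⊗ Ab).

(** The universal tube around [A]: by [opening_ex], every tube from [Y] around [A] is a morphism out
    of [W] applied after this one. *)
Definition conj_tube : Mor (A ⊗ Y) (W ⊗ A) := opening r (idm W).

Lemma conj_tube_eq Z : A ⊗ (Y ⊗ (Ab ⊗ (A ⊗ Z))) = W ⊗ (A ⊗ Z).
Proof. by rewrite !tensA. Qed.

Lemma w22_conj_tube Z :
  w22 conj_tube Z = eqm (conj_tube_eq Z) ∘ (idm A ⊠ (idm Y ⊠ cup r Z)).
Proof.
have e0 : ((A ⊗ Y) ⊗ tunit) ⊗ Z = (A ⊗ Y) ⊗ Z by rewrite tenso1.
have e1 : ((A ⊗ Y) ⊗ (Ab ⊗ A)) ⊗ Z = (A ⊗ Y) ⊗ (Ab ⊗ (A ⊗ Z)) by rewrite !tensA.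
rewrite /w22 /conj_tube /opening mt1 cmp1m (whM _ e0) (whM _ e1).
have e2 : (A ⊗ Y) ⊗ (Ab ⊗ (A ⊗ Z)) = W ⊗ (A ⊗ Z) by rewrite !tensA.
rewrite (wh_eqm _ _ _ e2) (wh_eqm _ _ _ (esym (tensA A Y Z))).
rewrite (wh_tensl _ _ (tens1o Z) (tensA Ab A Z)) -/(cup r Z).
by rewrite -[in RHS]tensA_conj !cmpA eqmM; congr (_ ∘ _ ∘ _); exact: eqm_irr.
Qed.

Lemma unconj_eq : Ab ⊗ W = Ab ⊗ (A ⊗ (Y ⊗ Ab)).
Proof. by rewrite !tensA. Qed.

Definition unconj_tube : Mor (Ab ⊗ W) (Y ⊗ Ab) := cap r (Y ⊗ Ab) ∘ eqm unconj_eq.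

Lemma w22_unconj_tube Z :
  w22 unconj_tube (A ⊗ Z) = cap r (Y ⊗ (Ab ⊗ (A ⊗ Z))) ∘ (idm Ab ⊠ eqm (esym (conj_tube_eq Z))).
Proof.
have e : (Ab ⊗ (A ⊗ (Y ⊗ Ab))) ⊗ (A ⊗ Z) = Ab ⊗ (A ⊗ (Y ⊗ (Ab ⊗ (A ⊗ Z)))) by rewrite !tensA.
rewrite /w22 /unconj_tube (whM _ e) /cap.
rewrite (wh_wh_cast _ _ _ _ (tensA Y Ab (A ⊗ Z)) (tensA Ab A (Y ⊗ (Ab ⊗ (A ⊗ Z)))) (tens1o _)).
rewrite (mt_eqmr _ (congr1 (tens Ab) (esym (conj_tube_eq Z)))); congr (_ ∘ _).
by apply: wh_eqm.
Qed.

Lemma unconj_rot : is_rot r unconj_tube conj_tube.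
Proof.
move=> Z; rewrite w22_unconj_tube -w22_adj w22_conj_tube madjM eqmadj !mtadj !madj1 cup_adj.
by rewrite mtMr !cmpA cap_nat.
Qed.

(** Once the second tube is moved across the kernel, the strand [A] forms a closed circle, whose
    value is the scalar. *)
Lemma kern_conj X X' (h : Mor X' (Y ⊗ X')) (g : Mor X (Y ⊗ X)) :
  kern D (act conj_tube h) (act conj_tube g) = scal (r^† ∘ r) *: kern D h g.
Proof.
rewrite (kern_act D h _ cr unconj_rot) /act w22_unconj_tube w22_conj_tube.
rewrite -cmpA -mtMr -cmpA cmpA eqmVK cmp1m -mtMr cap_nat.
rewrite -cmpA kern_natr -cmpA.
have -> : cap r X ∘ cup r X = scal (r^† ∘ r) *: idm X.
  rewrite /cap /cup -whM {1}(scalP sU (r^† ∘ r)) whZ wh1 //.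
by rewrite mZr cmpm1 kernZr.
Qed.

End Conjugation.

(* A tube f factors as a morphism b into Y' after the conjugation tube, which scales
   inner products; as b b^* is a scalar c, the difference c - b^* b is a square. *)
Lemma act_bound A Y Y' (f : Mor (A ⊗ Y) (Y' ⊗ A)) : simple Y' ->
  exists2 c, 0 <= c & exists W (b : Mor (A ⊗ Y) (W ⊗ A)),
    forall X X' (h : Mor X' (Y ⊗ X')) (g : Mor X (Y ⊗ X)),
    c *: kern D h g = kern D (act f h) (act f g) + kern D (act b h) (act b g).
Proof.
move=> sY; pose r := sol D A; have cr := sol_conj D A.
have [z1 z2] := (conj_zz _ _).1 cr.
have [b hb] := opening_ex f z2.
set W := (A ⊗ Y) ⊗ dual D A in b hb.
have d0 : 0 <= scal (r^† ∘ r) := scal_ge0 sU r.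
have e0 : 0 <= scal (b ∘ b^†) by have := scal_ge0 sY b^†; rewrite madjK.
pose c := scal (b ∘ b^†).
have bb : b ∘ b^† = c *: idm Y' := scalP sY _.
pose s := sqrtC c; have ss : s * s = c by rewrite -expr2 sqrtCK.
have sc : s^* = s by apply: CrealP; rewrite ger0_real // sqrtC_ge0.
have scV : (- s^-1)^* = - s^-1 by rewrite rmorphN fmorphV /= sc.
(* For [c != 0], [c^-1 *: (b^† ∘ b)] is a projection and [p] is [s] times its complement. For
   [c = 0] both [b] and [s^-1] vanish, hence also [p]. *)
pose p : Mor W W := s *: idm W + (- s^-1) *: (b^† ∘ b).
have pp : p^† ∘ p = c *: idm W - b^† ∘ b.
  have [c0|c0] := eqVneq c 0.
    have b0 : b = 0.
      by apply: madj_inj; rewrite madj0; apply: (scal_eq0 sY); rewrite madjK.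
    have s0 : s = 0 by rewrite /s c0 sqrtC0.
    by rewrite /p c0 s0 b0 m0r !scaler0 !scale0r subrr addr0 m0r.
  have s0 : s != 0 by rewrite sqrtC_eq0.
  have pa : p^† = p by rewrite /p madjD !madjZ madj1 madjM madjK sc scV.
  rewrite pa /p cmpDl !cmpDr !mZl !mZr !cmp1m cmpm1 !scalerA.
  rewrite -(cmpA b^† b) (cmpA b b^†) bb mZl mZr cmp1m !scalerA ss.
  rewrite -addrA; congr (_ + _).
  rewrite -!scalerDl. rewrite -[RHS]scaleN1r; congr (_ *: _).
  by rewrite -ss; field.
exists (c * scal (r^† ∘ r)); first by rewrite mulr_ge0.
exists W, ((p ⊠ idm A) ∘ conj_tube Y r) => X X' h g.
have -> : f = (b ⊠ idm A) ∘ conj_tube Y r by rewrite hb -[b in LHS]cmpm1 opening_post.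
have post Z (q : Mor W Z) : kern D ((q ⊠ idm (A ⊗ X')) ∘ act (conj_tube Y r) h)
    ((q ⊠ idm (A ⊗ X)) ∘ act (conj_tube Y r) g) =
    kern D (act (conj_tube Y r) h) (((q^† ∘ q) ⊠ idm (A ⊗ X)) ∘ act (conj_tube Y r) g).
  by rewrite -[q in LHS]madjK kern_post madjK mtMl cmpA.
rewrite -scalerA -(kern_conj cr) !act_post !post pp.
rewrite -kernDr -cmpDl -mtDl addrC subrK mtZl mt1 mZl cmp1m kernZr //.
Qed.

End TubeKernels.

(** * Complete positivity of multipliers *)

Section MatrixPositivity.
Context {R : realType} {C : cstarTensorCategory R} (D : catChoices C).
Local Notation I := (Irr D).
Local Notation X_ k := (rep (c:=D) k).
Variables (Z : C) (n : nat) (T : 'M[Mor Z Z]_n).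
Hypothesis pos : forall (k : I) (f : 'I_n -> Mor (X_ k) Z),
  0 <= scal (\sum_p \sum_q (f p)^† ∘ T p q ∘ f q).

Let V (k : I) (a : 'I_(size (onb k Z))) : Mor (X_ k) Z := (onb k Z)`_a.

Lemma isotypic_ord (k : I) : isotypic k Z = \sum_a V (k := k) a ∘ (V a)^†.
Proof. by rewrite /isotypic (big_nth 0) big_mkord. Qed.

Lemma block_psd (k : I) : exists s : 'I_n * 'I_(size (onb k Z)) -> 'I_n * 'I_(size (onb k Z))
  -> R[i],
  forall i j, scal ((V i.2)^† ∘ T i.1 j.1 ∘ V j.2) = \sum_l (s l i)^* * s l j.
Proof.
apply: psd_factor => c.
have := pos (fun p => \sum_a c (p, a) *: V a); congr (0 <= _).
have sk := rep_simple (c := D) k.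
rewrite scal_sum // [RHS](eq_bigr (fun i => \sum_q \sum_b (c (i.1, i.2))^* *
  scal ((V i.2)^† ∘ T i.1 q ∘ V b) * c (q, b))) => [|[p a] _]; last first.
  by rewrite pair_bigA; apply: eq_bigr => -[q b].
rewrite -(pair_bigA _ (fun p a => \sum_q \sum_b (c (p, a))^* *
  scal ((V a)^† ∘ T p q ∘ V b) * c (q, b))) /=; apply: eq_bigr => p _.
rewrite scal_sum // exchange_big; apply: eq_bigr => q _ /=.
rewrite madj_sum !cmp_suml scal_sum //; apply: eq_bigr => a _.
rewrite cmp_sumr scal_sum //; apply: eq_bigr => b _.
by rewrite madjZ !mZl mZr !scalZ //; ring.
Qed.

(** In each isotypic part [T] is a scalar matrix with respect to the matrix units formed from [V];
    [block_psd] factors that matrix, and the factors placed on the same matrix units give the square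
    root. Different parts do not interact. *)
Lemma mx_positive_criterion : mx_positive T.
Proof.
have /(_ _)/cid-/all_sig[s hs] := block_psd.
pose B (k : I) (r q : 'I_n) : Mor Z Z :=
  \sum_c \sum_b s k (r, c) (q, b) *: (V c ∘ (V b)^†).
have BI k r q : isotypic k Z ∘ B k r q = B k r q.
  rewrite /B cmp_sumr; apply: eq_bigr => c _; rewrite cmp_sumr; apply: eq_bigr => b _.
  by rewrite mZr cmpA isotypic_comp.
have BB k r p q : (B k r p)^† ∘ B k r q = \sum_c \sum_a \sum_b
    ((s k (r, c) (p, a))^* * s k (r, c) (q, b)) *: (V a ∘ (V b)^†).
  rewrite /B madj_sum cmp_suml; apply: eq_bigr => c _.
  rewrite madj_sum cmp_suml; apply: eq_bigr => a _.
  rewrite cmp_sumr (bigD1 c) //= [X in _ + X]big1 ?addr0 => [|c' cc].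
    rewrite cmp_sumr; apply: eq_bigr => b _.
    rewrite madjZ mZl mZr scalerA madjM madjK -cmpA (cmpA (V c)^†).
    by have [_ ->] := onbP k Z; rewrite eqxx scale1r cmp1m.
  rewrite cmp_sumr big1 // => b _.
  rewrite madjZ mZl mZr scalerA madjM madjK -cmpA (cmpA (V c)^†).
  by have [_ ->] := onbP k Z; rewrite eq_sym (negbTE cc) scale0r m0l m0r scaler0.
exists (\matrix_(r, q) \sum_(k <- irrs D Z) B k r q) => p q.
have TE : T p q = \sum_(k <- irrs D Z) \sum_(a : 'I_(size (onb k Z))) \sum_b
    scal ((V a)^† ∘ T p q ∘ V b) *: (V a ∘ (V b)^†).
  rewrite -{1}[T p q]cmpm1 -(isotypic_sum D) cmp_sumr; apply: eq_bigr => k _.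
  rewrite -isotypic_idem cmpA isotypic_nat isotypic_ord cmp_suml; apply: eq_bigr => a _.
  rewrite !cmp_sumr; apply: eq_bigr => b _.
  have sk := rep_simple (c := D) k.
  have e : (V a)^† ∘ T p q ∘ V b = scal ((V a)^† ∘ T p q ∘ V b) *: idm _ := scalP sk _.
  set z := scal _ in e *.  rewrite -!cmpA (cmpA (T p q)) (cmpA (V a)^†) (cmpA (V a)^†) e.
  by rewrite mZl mZr cmp1m.
rewrite TE; under [RHS]eq_bigr do rewrite !mxE madj_sum cmp_suml.
rewrite exchange_big; apply: eq_big_seq => k kZ.
transitivity (\sum_r (B k r p)^† ∘ B k r q); last first.
  apply: eq_bigr => r _; rewrite cmp_sumr (bigD1_seq k) ?irrs_uniq //= big1 ?addr0 // => l lk.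
  rewrite -(BI k) -(BI l) madjM isotypic_adj -cmpA (cmpA (isotypic k Z)).
  by rewrite isotypic_ortho 1?eq_sym // m0l m0r.
under [RHS]eq_bigr do rewrite BB.
rewrite [RHS]pair_bigA [RHS]exchange_big /=; apply: eq_bigr => a _.
rewrite [RHS]exchange_big; apply: eq_bigr => b _ /=.
rewrite -scaler_suml; congr (_ *: _).
by have := hs k (p, a) (q, b) => /= ->; apply: eq_bigr => -[r c] _.
Qed.

End MatrixPositivity.

(** * Construction of the multiplier of a function *)

Section HatBijection.
Context {R : realType} {C : cstarTensorCategory R} (D : catChoices C).
Implicit Types A B X Y Z W S : C.
Local Notation I := (Irr D).
Local Notation hT := (ctc_tensor C).

Lemma opening_closeK A Ab B Y (r : Mor tunit (Ab ⊗ A)) (rb : Mor tunit (A ⊗ Ab))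
    (b : Mor (B ⊗ Ab) Y) : zz r rb ->
  eqm (tenso1 Y) ∘ (idm Y ⊠ rb^†) ∘ w12 (opening r b) Ab = b.
Proof.
move=> z; have e0 : (B ⊗ tunit) ⊗ Ab = B ⊗ Ab by rewrite tenso1.
have e1 : (B ⊗ (Ab ⊗ A)) ⊗ Ab = B ⊗ (Ab ⊗ (A ⊗ Ab)) by rewrite !tensA.
rewrite /w12 /opening (whM _ e0) (whM _ e1) (whM _ (tensA (B ⊗ Ab) A Ab)).
rewrite -[wh _ _ (b ⊠ _)]/(w22 _ Ab) w22_tens (wh_eqm _ _ _ (esym (tensA B Ab (A ⊗ Ab)))).
rewrite (wh_eqm _ _ _ erefl) cmpm1 (wh_tensl _ _ (tens1o Ab) (tensA Ab A Ab)) -/(cup r Ab).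
rewrite mt1 !cmpA -(cmpA (eqm (tenso1 Y))) -mt_xch !cmpA.
rewrite -(cmpA (eqm (tenso1 Y) ∘ (b ⊠ idm tunit))).
have -> : (idm (B ⊗ Ab) ⊠ rb^†) ∘ eqm (esym (tensA B Ab (A ⊗ Ab))) =
    eqm (esym (tensA B Ab tunit)) ∘ (idm B ⊠ (idm Ab ⊠ rb^†)).
  by rewrite -tensA_conj !cmpA eqmVK cmp1m.
rewrite (tensmo1 hT) -!cmpA -mtMr (zz_adj z).
rewrite (mt_eqmr _ (congr1 (tens B) (esym (tenso1 Ab)))) !eqmM eqm1 cmpm1 //.
Qed.

Lemma cap_idm_inj A Ab B Z (u : Mor tunit (Ab ⊗ A)) (u' : Mor tunit (A ⊗ Ab))
    (w w' : Mor B (A ⊗ Z)) : zz u' u ->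
  cap u Z ∘ (idm Ab ⊠ w) = cap u Z ∘ (idm Ab ⊠ w') -> w = w'.
Proof.
move=> z; have wE (y : Mor B (A ⊗ Z)) : y = (idm A ⊠ (cap u Z ∘ (idm Ab ⊠ y))) ∘ cup u' B.
  by rewrite mtMr -cmpA -cup_nat cmpA zig // cmp1m.
by move=> e; rewrite (wE w) e -wE.
Qed.

Lemma hat_inj X Y (v v' : Mor (X ⊗ Y) (X ⊗ Y)) : hat D v = hat D v' -> v = v'.
Proof.
have [x1 x2] := (conj_zz _ _).1 (sol_conj D X).
have [y1 y2] := (conj_zz _ _).1 (sol_conj D Y).
rewrite !hatE /bend => /(cap_idm_inj x2).
move=> h; have e : opening (solb D Y) v = opening (solb D Y) v'.
  have := congr1 (fun h => eqm (esym (tensA X Y (dual D Y))) ∘ h) h.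
  by rewrite !(cmpA (eqm _)) eqmVK !cmp1m.
by rewrite -(opening_closeK v y2) e opening_closeK.
Qed.

Lemma hat_surj X Y (h : Mor (dual D X ⊗ X) (Y ⊗ dual D Y)) : exists v, hat D v = h.
Proof.
have [x1 x2] := (conj_zz _ _).1 (sol_conj D X).
have [y1 y2] := (conj_zz _ _).1 (sol_conj D Y).
pose w := eqm (esym (tensA X Y (dual D Y))) ∘ ((idm X ⊠ h) ∘ cup (solb D X) X).
have [v hv] := opening_ex w y1.
exists v; rewrite hatE /bend -hv /w cmpA eqmVK cmp1m mtMr cmpA cap_nat -cmpA zag //.
by rewrite cmpm1.
Qed.

Definition theta (psi : I -> R[i]) : endo_family := fun X Y v =>
  sval (cid (hat_surj (isotypic_mult psi (hat D v)))).

Section Theta.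
Variable psi : I -> R[i].

Lemma hat_theta X Y (v : Mor (X ⊗ Y) (X ⊗ Y)) :
  hat D (theta psi v) = isotypic_mult psi (hat D v).
Proof. by rewrite /theta; case: cid. Qed.

Lemma theta_multiplier_of : multiplier_of psi (theta psi).
Proof. by move=> X Y v; exact: hat_theta. Qed.

(** Isotypic projections are natural, so [theta] commutes with every operation that [hat] turns into
    composition with fixed morphisms. The multiplier axioms all follow from this. *)
Lemma theta_intertwine X Y X' Y' (f : Mor (X ⊗ Y) (X ⊗ Y) -> Mor (X' ⊗ Y') (X' ⊗ Y'))
    (M : Mor (Y ⊗ dual D Y) (Y' ⊗ dual D Y')) (N : Mor (dual D X' ⊗ X') (dual D X ⊗ X)) :
  (forall v, hat D (f v) = M ∘ hat D v ∘ N) -> forall v, theta psi (f v) = f (theta psi v).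
Proof.
by move=> h v; apply: hat_inj; rewrite h !hat_theta h isotypic_multM.
Qed.

Lemma hatP X Y a (v w : Mor (X ⊗ Y) (X ⊗ Y)) : hat D (a *: v + w) = a *: hat D v + hat D w.
Proof.
by rewrite !hatE /bend /opening mtDl mtZl !cmpDl !mZl cmpDr mZr mtDr mtZr cmpDr mZr.
Qed.

Lemma theta_linear X Y : linear (theta psi (X := X) (Y := Y)).
Proof.
move=> a v w; apply: hat_inj; rewrite hatP !hat_theta hatP.
rewrite !(isotypic_mult_seq psi _ (irrs_uniq D (dual D X ⊗ X))) // scaler_sumr -big_split.
apply: eq_bigr => k _ /=.
by rewrite cmpDl mZl scalerDr !scalerA [_ * a]mulrC.
Qed.

Lemma opening_pre X X' Y Y' Y1 Z (rb : Mor tunit (Y ⊗ Y')) (a : Mor X X')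
    (b : Mor Y Y1) (g : Mor (X' ⊗ Y1) Z) :
  opening rb (g ∘ (a ⊠ b)) = opening ((b ⊠ idm Y') ∘ rb) g ∘ a.
Proof.
rewrite !openingE w21_pre mtMr -!cmpA; congr (_ ∘ _).
rewrite mt_split' -!cmpA; congr (_ ∘ _).
rewrite (cmpA (a ⊠ _)) mt_xch -!cmpA; congr (_ ∘ _).
have -> : a ⊠ idm tunit = eqm (esym (tenso1 X')) ∘ a ∘ eqm (tenso1 X).
  by rewrite -cmpA -(tensmo1 hT) cmpA eqmVK cmp1m.
by rewrite -!cmpA eqmVK cmpm1.
Qed.

Lemma hat_nat X Y X' Y' (a : Mor X X') (a' : Mor X' X) (b : Mor Y Y') (b' : Mor Y' Y) :
  exists M N, forall v, hat D ((a ⊠ b) ∘ v ∘ (a' ⊠ b')) = M ∘ hat D v ∘ N.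
Proof.
have [m hm] := cotranspose_r_ex (conj_swap (sol_conj D Y)) ((b' ⊠ idm _) ∘ solb D Y').
have [s hs] := transpose_l_ex (sol_conj D X) ((sol D X')^† ∘ (idm _ ⊠ a)).
have caps Z : cap (sol D X') Z ∘ (idm _ ⊠ (a ⊠ idm Z)) = cap (sol D X) Z ∘ (s ⊠ idm (X ⊗ Z)).
  have := congr1 (wh (tensA _ X Z) (tens1o Z)) hs; rewrite !(whM _ (tensA _ _ Z)).
  by rewrite -![wh _ _ (_ ⊠ _)]/(w22 _ Z) !w22_tens mt1.
exists (b ⊠ m), (s ⊠ a') => v; rewrite !hatE /bend opening_pre opening_post hm opening_mv.
have -> : eqm (tensA X' Y' (dual D Y')) ∘ (((a ⊠ b) ⊠ idm (dual D Y')) ∘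
      ((idm (X ⊗ Y) ⊠ m) ∘ opening (solb D Y) v) ∘ a') =
    (a ⊠ idm _) ∘ (idm X ⊠ (b ⊠ m)) ∘ (eqm (tensA X Y (dual D Y)) ∘ opening (solb D Y) v) ∘ a'.
  by rewrite !cmpA -(cmpA (eqm _)) -!mt_split (tensmA hT).
move: (eqm _ ∘ opening _ v) => W; rewrite !mtMr !cmpA caps.
rewrite -(cmpA (cap (sol D X) _)) mt_xch !cmpA cap_nat.
by rewrite -!cmpA; do 2!congr (_ ∘ _); rewrite cmpA mt_xch -cmpA -mt_split.
Qed.

Definition ltens Z X Y (v : Mor (X ⊗ Y) (X ⊗ Y)) : Mor ((Z ⊗ X) ⊗ Y) ((Z ⊗ X) ⊗ Y) :=
  eqm (esym (tensA Z X Y)) ∘ (idm Z ⊠ v) ∘ eqm (tensA Z X Y).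

Lemma w22_ltens Z X Y (v : Mor (X ⊗ Y) (X ⊗ Y)) T :
  w22 (ltens Z v) T =
  eqm (esym (tensA Z X (Y ⊗ T))) ∘ (idm Z ⊠ w22 v T) ∘ eqm (tensA Z X (Y ⊗ T)).
Proof.
have e1 : (Z ⊗ (X ⊗ Y)) ⊗ T = Z ⊗ (X ⊗ (Y ⊗ T)) by rewrite !tensA.
rewrite {1}/w22 /ltens (whM _ e1) (whM _ e1) (wh_eqm _ _ _ (tensA Z X (Y ⊗ T))).
by rewrite (wh_eqm _ _ _ (esym (tensA Z X (Y ⊗ T)))) (wh_tensl _ _ (tensA X Y T) (tensA X Y T)).
Qed.

(** The strand [Z] does not meet [v], so it can be closed before [hat D v] is applied; [w] compares
    the chosen solution for [Z ⊗ X] with the nested one. *)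
Lemma hat_ltens Z X Y : exists N, forall v, hat D (ltens Z (X := X) (Y := Y) v) = hat D v ∘ N.
Proof.
have [w hw] := cotranspose_l_ex (nest_conj (sol_conj D Z) (sol_conj D X)) (sol D (Z ⊗ X)).
have e : (dual D X ⊗ dual D Z) ⊗ (Z ⊗ X) = dual D X ⊗ (dual D Z ⊗ (Z ⊗ X)) by rewrite tensA.
exists ((idm _ ⊠ cap (sol D Z) X) ∘ eqm e ∘ (w^† ⊠ idm (Z ⊗ X))) => v.
rewrite !hatE !bend_w22 hw cap_mv -(cmpA (cap _ _)) mt_xch !cmpA; congr (_ ∘ _).
rewrite -!cmpA; set W := w22 v _ ∘ _.
have -> : w22 (ltens Z v) (dual D Y) ∘ ((idm (Z ⊗ X) ⊠ solb D Y) ∘ eqm (esym (tenso1 (Z ⊗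
  X)))) =
    eqm (esym (tensA Z X (Y ⊗ dual D Y))) ∘ (idm Z ⊠ W).
  rewrite w22_ltens -!cmpA (cmpA (eqm (tensA _ _ _))) tensA_mv /W !mtMr -!cmpA.
  by rewrite (mt_eqmr _ (congr1 (tens Z) (esym (tenso1 X)))) eqmM; do ?congr (_ ∘ _);
    exact: eqm_irr.
move: W => W; rewrite cap_nest mtMr.
have e2 : dual D X ⊗ (dual D Z ⊗ (Z ⊗ (X ⊗ (Y ⊗ dual D Y)))) =
    (dual D X ⊗ dual D Z) ⊗ (Z ⊗ (X ⊗ (Y ⊗ dual D Y))) by rewrite !tensA.
have -> : idm (dual D X ⊗ dual D Z) ⊠ (idm Z ⊠ W) =
    eqm e2 ∘ (idm (dual D X) ⊠ (idm (dual D Z) ⊠ (idm Z ⊠ W))) ∘ eqm e.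
  rewrite -[in RHS](tensA_conj (dual D X) (dual D Z) (idm Z ⊠ W)) !cmpA eqmM eqm1 cmp1m.
  by rewrite -cmpA eqmVK cmpm1.
have e3 : (dual D X ⊗ dual D Z) ⊗ (Z ⊗ (X ⊗ (Y ⊗ dual D Y))) =
  (dual D X ⊗ dual D Z) ⊗ ((Z ⊗ X) ⊗ (Y ⊗ dual D Y)) by rewrite !tensA.
rewrite (mt_eqmr _ e3) -!cmpA; congr (_ ∘ _).
rewrite (cmpA (eqm e3)) eqmM (cmpA (eqm _) (eqm _)) eqmM eqm1 cmp1m.
by rewrite !cmpA -!mtMr cap_nat.
Qed.

Lemma hat_w22 X Y Z : exists M, forall v : Mor (X ⊗ Y) (X ⊗ Y), hat D (w22 v Z) = M ∘ hat D v.
Proof.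
have [m hm] := cotranspose_r_ex (conj_swap (nest_conj (sol_conj D Y) (sol_conj D Z))) (solb D
  (Y ⊗ Z)).
set T := dual D Z ⊗ dual D Y.
have e : Y ⊗ (Z ⊗ T) = (Y ⊗ Z) ⊗ T by rewrite tensA.
have e2 : X ⊗ (Y ⊗ (Z ⊗ T)) = X ⊗ ((Y ⊗ Z) ⊗ T) by rewrite -e.
exists ((idm (Y ⊗ Z) ⊠ m) ∘ eqm e ∘ (idm Y ⊠ cup (solb D Z) (dual D Y))) => v.
have w22w22 : w22 (w22 v Z) T = eqm e2 ∘ w22 v (Z ⊗ T) ∘ eqm (esym e2).
  have e3 : (X ⊗ Y) ⊗ (Z ⊗ T) = X ⊗ ((Y ⊗ Z) ⊗ T) by rewrite !tensA.
  rewrite {1 2}/w22 (wh_wh _ _ _ _ e3 e3) /w22.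
  by rewrite (wh_eqml _ _ e3) (wh_eqmr _ _ e3).
have key : w22 (w22 v Z) (dual D (Y ⊗ Z)) ∘ (idm X ⊠ solb D (Y ⊗ Z)) =
    (idm X ⊠ ((idm (Y ⊗ Z) ⊠ m) ∘ eqm e ∘ (idm Y ⊠ cup (solb D Z) (dual D Y)))) ∘
    (w22 v (dual D Y) ∘ (idm X ⊠ solb D Y)).
  rewrite hm mtMr cmpA w22_nat w22w22 /nest.
  rewrite !mtMr (mt_eqmr _ e2) (mt_eqmr e e2) -!cmpA; congr (_ ∘ (_ ∘ _)).
  by rewrite (cmpA (eqm (esym e2))) eqmVK cmp1m !cmpA w22_nat.
by rewrite !hatE !bend_w22 key !cmpA -cap_nat -!cmpA -!mtMr !cmpA.
Qed.

End Theta.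

End HatBijection.

Section ThetaPositive.
Context {R : realType} {C : cstarTensorCategory R} (D : catChoices C).
Implicit Types A B X Y Z W S : C.
Local Notation I := (Irr D).
Local Notation X_ k := (rep (c:=D) k).
Local Notation dimk := (dimk (D := D)).
Variable psi : I -> R[i].
Local Notation theta := (theta psi).

Lemma theta_nat X Y X' Y' (a : Mor X X') (a' : Mor X' X) (b : Mor Y Y') (b' : Mor Y' Y) v :
  theta ((a ⊠ b) ∘ v ∘ (a' ⊠ b')) = (a ⊠ b) ∘ theta v ∘ (a' ⊠ b').
Proof.
have [M [N h]] := hat_nat D a a' b b'.
exact: (theta_intertwine psi (f := fun v => (a ⊠ b) ∘ v ∘ (a' ⊠ b')) h).
Qed.

Lemma theta_ltens Z X Y (v : Mor (X ⊗ Y) (X ⊗ Y)) : theta (ltens Z v) = ltens Z (theta v).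
Proof.
have [N h] := hat_ltens D Z X Y.
apply: (theta_intertwine psi (M := idm _) (N := N)) => w.
by rewrite cmp1m h.
Qed.

Lemma theta_w22 X Y Z (v : Mor (X ⊗ Y) (X ⊗ Y)) : theta (w22 v Z) = w22 (theta v) Z.
Proof.
have [M h] := hat_w22 D X Y Z.
apply: (theta_intertwine psi (f := fun v => w22 v Z) (M := M) (N := idm _)) => w.
by rewrite cmpm1 h.
Qed.

Lemma mid_ltens X1 X2 Y1 Y2 (x : Mor (X2 ⊗ Y1) (X2 ⊗ Y1)) :
  mid X1 Y2 x = ltens X1 (w22 x Y2).
Proof.
rewrite /mid /ltens /w22 wh_def !mtMr.
rewrite (mt_eqmr _ (congr1 (tens X1) (tensA X2 Y1 Y2))).
rewrite (mt_eqmr _ (congr1 (tens X1) (esym (tensA X2 Y1 Y2)))).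
rewrite !cmpA eqmM -!cmpA eqmM.
by do ?[congr (_ ∘ _) | exact: eqm_irr].
Qed.

Lemma theta_is_multiplier : is_multiplier theta.
Proof.
split=> [X Y|X Y a a' b b' x|X1 X2 Y1 Y2 x]; first exact: theta_linear.
  exact: theta_nat.
by rewrite !mid_ltens theta_ltens theta_w22.
Qed.

Variable om : fusion D -> R[i].
Hypothesis omD : {morph om : a b / a + b}.
Hypothesis omE : forall c, om c = \sum_(k \in [set: I]) psi k * dimk k * c k.
Hypothesis om_ge0 : forall X Y (x : Mor X (Y ⊗ X)), 0 <= om (kern D x x).

(* By Frobenius reciprocity, closing up with a standard solution for X_k turns f_p
   into a morphism m_p from the dual of B, and the matrix entries into values of
   the multiplier between standard solutions for B. *)
Lemma theta_vector_ge0 A B n (k : I) (b : 'I_n -> Mor (A ⊗ B) (A ⊗ B))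
    (f : 'I_n -> Mor (X_ k) (A ⊗ B)) :
  0 <= scal (\sum_p \sum_q (f p)^† ∘ theta ((b p)^† ∘ b q) ∘ f q).
Proof.
set S := \sum_p _; pose s := sol D (X_ k); pose G := dual D (X_ k).
have sk := rep_simple (c := D) k; have sU := ctc_unit C.
have iso : isomorphic (X_ k) (X_ k) by exists (idm _), (idm _); rewrite !cmp1m.
have trS : scal (s^† ∘ (idm G ⊠ S) ∘ s) = scal S * dimk k.
  by rewrite (Tr_standard D S (sol_standard D (X_ k))) scalE // {1}(scalP sk S) TrZ (Tr_iso
    iso).
rewrite -(pmulr_lge0 _ (dimk_gt0 k)) -trS.
have /(_ _)/cid-/all_sig[m hm] q := cotranspose_l_ex (sol_conj D B)
  (eqm (esym (tensA G A B)) ∘ (idm G ⊠ f q) ∘ s).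
pose b' q : Mor (dual D B ⊗ B) (G ⊗ (A ⊗ B)) :=
  (idm G ⊠ b q) ∘ eqm (tensA G A B) ∘ (m q ⊠ idm B).
pose x q := opening (solb D B) (b' q).
have term p q : scal (s^† ∘ (idm G ⊠ ((f p)^† ∘ theta ((b p)^† ∘ b q) ∘ f q)) ∘ s) =
    om (kern D (x p) (x q)).
  have -> : s^† ∘ (idm G ⊠ ((f p)^† ∘ theta ((b p)^† ∘ b q) ∘ f q)) ∘ s =
      (sol D B)^† ∘ theta ((b' p)^† ∘ b' q) ∘ sol D B.
    have -> : (b' p)^† ∘ b' q = ((m p)^† ⊠ idm B) ∘ ltens G ((b p)^† ∘ b q) ∘ (m q ⊠ idm B).
      by rewrite /b' !madjM !mtadj !madj1 eqmadj /ltens mtMr !cmpA.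
    rewrite theta_nat theta_ltens -!cmpA -hm !cmpA.
    have := congr1 (fun h => h^†) (hm p); rewrite !madjM !mtadj !madj1 eqmadj esymK => <-.
    rewrite /ltens !mtMr -!cmpA; do 2!congr (_ ∘ _).
    by rewrite !(cmpA (eqm (tensA _ _ _))) !eqmVK !cmp1m.
  rewrite (multiplier_trace (sol_standard D B) _ (theta_multiplier_of psi)) omE.
  apply: eq_fsbigr => l _; congr (_ * _).
  by rewrite /x (opening_kern D (sol_standard D B)).
have -> : scal (s^† ∘ (idm G ⊠ S) ∘ s) = om (kern D (\sum_p x p) (\sum_q x q)).
  have om0 : om 0 = 0 by apply: (addrI (om 0)); rewrite -omD !addr0.
  rewrite kern_suml (big_morph om omD om0) /S mt_sumr cmp_sumr cmp_suml scal_sum //.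
  apply: eq_bigr => p _; rewrite kern_sumr (big_morph om omD om0).
  rewrite mt_sumr cmp_sumr cmp_suml scal_sum //; apply: eq_bigr => q _.
  exact: term.
exact: om_ge0.
Qed.

Lemma theta_cp X Y : completely_positive (theta (X := X) (Y := Y)).
Proof.
move=> n a [b hb]; apply: (mx_positive_criterion (D := D)) => k f.
have lin J (r : seq J) (F : J -> Mor (X ⊗ Y) (X ⊗ Y)) :
    theta (\sum_(c <- r) F c) = \sum_(c <- r) theta (F c).
  apply: (big_morph (theta (X := X) (Y := Y))) => [v w|].
    by have := theta_linear psi 1 v w; rewrite !scale1r.
  by have := theta_linear psi (-1) (0 : Mor (X ⊗ Y) (X ⊗ Y)) 0;
    rewrite scaler0 addr0 scaleN1r addNr.
have -> : \sum_p \sum_q (f p)^† ∘ map_mx (theta (X := X) (Y := Y)) a p q ∘ f q =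
    \sum_r \sum_p \sum_q (f p)^† ∘ theta ((b r p)^† ∘ b r q) ∘ f q.
  rewrite [RHS]exchange_big; apply: eq_bigr => p _; rewrite [RHS]exchange_big;
    apply: eq_bigr => q _.
  by rewrite mxE hb lin cmp_sumr cmp_suml.
rewrite scal_sum; last exact: rep_simple.
by apply: sumr_ge0 => r _; exact: theta_vector_ge0.
Qed.

End ThetaPositive.

Lemma hdot_psd (R : realType) (H : hilbertSpace R) : psd_form (hdot H).
Proof.
split=> [a u v w|a u v w|u].
- by rewrite linearPl.
- by rewrite linearPr.
- by rewrite hdot_norm exprn_ge0.
Qed.

Lemma hdot_pnorm (R : realType) (H : hilbertSpace R) (v : H) : pnorm (hdot H) v = `|v|.
Proof. by rewrite /pnorm hdot_norm exprCK. Qed.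

(** * Positivity of the kernels of an admissible representation *)

Section FusionRepresentation.
Context {R : realType} {C : cstarTensorCategory R} (D : catChoices C).
Local Notation I := (Irr D).
Variables (H : hilbertSpace R) (pi : fusion D -> {linear H -> H}).
Hypothesis hpi : nondeg_star_rep (@fusion_mul R C D) (@fusion_star R C D) pi.

Lemma fusion_star_irr (k : I) : fusion_star (fusion_irr k) = fusion_irr (bar k).
Proof.
apply: dsumP => l /=; rewrite -![single_fun _ _]/(single (fusion_space (D := D)) _ _ _).
have [<-|kl] := eqVneq (bar k) l; first by rewrite barK !singleE rmorph1.
rewrite (single_neq _ kl) single_neq ?rmorph0 //.
by apply: contra_neq kl => ->; rewrite barK.
Qed.

Lemma fusion_expand (a : fusion D) : a = \sum_(k <- dsupp a) a k *: fusion_irr k.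
Proof.
rewrite {1}(dsum_expand a); apply: eq_bigr => k _.
apply: dsumP => l; rewrite -[RHS]/(a k *: fusion_irr k l) /fusion_irr.
have [<-|kl] := eqVneq k l; last by rewrite !single_neq ?scaler0.
by rewrite !singleE /GRing.scale /= mulr1.
Qed.

Lemma pi0 v : pi 0 v = 0.
Proof.
have := rep_linear hpi (-1) 0 0 v.
by rewrite scaler0 addr0 scaleN1r addNr.
Qed.

Lemma pi_sum J (s : seq J) P (F : J -> fusion D) v :
  pi (\sum_(a <- s | P a) F a) v = \sum_(a <- s | P a) pi (F a) v.
Proof.
apply: (big_morph (fun a => pi a v)) => [a b|]; last exact: pi0.
by have := rep_linear hpi 1 a b v; rewrite !scale1r.
Qed.

Lemma piZ c a v : pi (c *: a) v = c *: pi a v.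
Proof. by have := rep_linear hpi c a 0 v; rewrite pi0 !addr0. Qed.

Lemma fus_eqm X Y (e : X = Y) : fus D (idm X) = fus D (idm Y).
Proof. by case: Y / e. Qed.

Lemma fusion_mul1 (k : I) : fusion_mul (fusion_irr k) (fusion_irr (irr0 D)) = fusion_irr k.
Proof.
rewrite -!fus_irr -fus_tens mt1; apply: fus_eqm.
by rewrite rep0 tenso1.
Qed.

(* Non-degeneracy forces the unit of the fusion algebra to act as the identity. *)
Lemma pi_unit v : pi (fusion_irr (irr0 D)) v = v.
Proof.
apply/eqP; rewrite -subr_eq0; apply/eqP/(rep_nondeg hpi) => a.
rewrite linearB /= (fusion_expand a) !pi_sum -sumrB big1 // => k _.
by rewrite !piZ -(rep_mul hpi) fusion_mul1 subrr.
Qed.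

Lemma pi_fsum a v w :
  hdot H (pi a v) w = \sum_(k \in [set: I]) a k * hdot H (pi (fusion_irr k) v) w.
Proof.
rewrite (fsum_seq (dsupp_uniq a)) => [|k]; last first.
  by rewrite mem_dsupp negbK => /eqP ->; rewrite mul0r.
rewrite {1}(fusion_expand a) pi_sum (psd_suml (hdot_psd H)); apply: eq_bigr => k _.
by rewrite piZ linearZl_LR.
Qed.

Hypothesis adm : admissible_rep pi.

Lemma kern_ge0 X Y (x : Mor X (Y ⊗ X)) v : 0 <= hdot H (pi (kern D x x) v) v.
Proof.
have [->|v0] := eqVneq v 0; first by rewrite (psd0r (hdot_psd H)).
pose w := `|v|^-1 *: v.
have nv : 0 < `|v| by rewrite normr_gt0.
have w1 : `|w| = 1 by rewrite normrZ gtr0_norm ?invr_gt0 // mulVf // gt_eqF.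
have [_ [Th hTh [_ cp]]] := adm w1.
have vw : v = `|v| *: w by rewrite scalerA mulfV ?scale1r // gt_eqF.
have scale c a : hdot H (pi a (c *: w)) (c *: w) = `|c| ^+ 2 * hdot H (pi a w) w.
  by rewrite linearZZ (psdZl (hdot_psd H)) (psdZr (hdot_psd H)) mulrA -normCK.
rewrite vw scale mulr_ge0 ?exprn_ge0 //.
have st := standard_sym (sol_standard D X).
have [_ zz_sol] := (conj_zz _ _).1 (sol_conj D X).
have [b ->] := opening_ex x zz_sol.
rewrite (opening_kern D st) pi_fsum.
have -> : \sum_(k \in [set: I]) fus D (bend (sol D X) (sol D X) (b^† ∘ b)) k *
      hdot H (pi (fusion_irr k) w) w =
    scal ((solb D X)^† ∘ Th _ _ (b^† ∘ b) ∘ solb D X).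
  rewrite (multiplier_trace st _ hTh); apply: eq_fsbigr => k _.
  by rewrite mulfVK ?gt_eqF ?dimk_gt0 // mulrC.
(* The morphism [b] has target [Y], while [mx_positive] asks for a square of an endomorphism. *)
have [g gb] := adj_comp_pos (ctc_cstar C) b.
have [|b' hb'] := cp _ _ 1%N (const_mx (b^† ∘ b)).
  by exists (const_mx g) => p q; rewrite big_ord1 !mxE.
have := hb' 0 0; rewrite big_ord1 !mxE => ->.
have := scal_ge0 (ctc_unit C) (b' 0 0 ∘ solb D X).
by rewrite madjM !cmpA.
Qed.

End FusionRepresentation.

(** * Positivity on families of generators and vectors *)

Section KernelPositivity.
Context {R : realType} {C : cstarTensorCategory R} (D : catChoices C).
Local Notation I := (Irr D).
Local Notation X_ k := (rep (c:=D) k).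
Variable Y : C.

Definition gen := {X : C & Mor X (Y ⊗ X)}.
Definition mkgen (X : C) (x : Mor X (Y ⊗ X)) : gen := existT _ X x.
Implicit Types g h : gen.

Definition gkern h g : fusion D := kern D (projT2 h) (projT2 g).

(** Put the generators on the blocks of a direct sum; the isometries slide around the annulus and
    cancel. *)
Lemma gen_sum (s : seq gen) : exists g,
  (forall h, gkern h g = \sum_(a <- s) gkern h a) /\
  (forall h, gkern g h = \sum_(a <- s) gkern a h).
Proof.
elim: s => [|[X x] s [[X' x'] [hr hl]]].
  exists (@mkgen tunit 0).
  by split=> h; rewrite big_nil /gkern ?kern0r ?kern0l.
have [Z [u [v [uu vv _]]]] := ctc_sums X X'.
exists (@mkgen Z
  ((idm Y ⊠ u) ∘ (x ∘ u^†) + (idm Y ⊠ v) ∘ (x' ∘ v^†))).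
split=> h; rewrite big_cons ?(kernDr, kernDl) -?hr -?hl /gkern /=.
  by rewrite kernDr !kern_natr -!cmpA uu vv !cmpm1.
by rewrite kernDl !kern_natl -!cmpA uu vv !cmpm1.
Qed.

(** Absorbs into the generator the action of [c *: fusion_irr k] on the vector, which reduces a
    cyclic subspace to one vector. *)
Definition gstrand g (k : I) (c : R[i]) : gen :=
  @mkgen (projT1 g ⊗ X_ k) (c *: w12 (projT2 g) (X_ k)).

Lemma gkern_strand h l b g k a : gkern (gstrand h l b) (gstrand g k a) =
  (a * b^*) *: fusion_mul (fusion_star (fusion_irr l)) (fusion_mul (gkern h g) (fusion_irr k)).
Proof.
rewrite /gkern /= kernZl kernZr kern_strand !fus_irr fusion_star_irr scalerA.
by rewrite [a * _]mulrC.
Qed.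

Variables (H : hilbertSpace R) (pi : fusion D -> {linear H -> H}).
Hypothesis hpi : nondeg_star_rep (@fusion_mul R C D) (@fusion_star R C D) pi.
Hypothesis kern_ge0 : forall X (x : Mor X (Y ⊗ X)) v, 0 <= hdot H (pi (kern D x x) v) v.
Local Notation hH := (hdot_psd H).

Lemma vector_positive v (s : seq gen) :
  0 <= \sum_(p <- s) \sum_(q <- s) hdot H (pi (gkern q p) v) v.
Proof.
have [[X x] [hr hl]] := gen_sum s.
suff -> : \sum_(p <- s) \sum_(q <- s) hdot H (pi (gkern q p) v) v =
  hdot H (pi (kern D x x) v) v by [].
rewrite -[kern D x x]/(gkern (mkgen x) (mkgen x)) hr (pi_sum hpi) (psd_suml hH).
by apply: eq_bigr => p _; rewrite hl (pi_sum hpi) (psd_suml hH).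
Qed.

Lemma cyclic_positive v (s : seq (gen * fusion D)) :
  0 <= \sum_(p <- s) \sum_(q <- s)
    hdot H (pi (gkern q.1 p.1) (pi p.2 v)) (pi q.2 v).
Proof.
have := vector_positive v [seq gstrand p.1 k (p.2 k) | p : gen * fusion D <- s, k <- dsupp p.2].
rewrite big_allpairs_dep /=; congr (0 <= _); apply: eq_bigr => p _.
have -> : pi p.2 v = \sum_(k <- dsupp p.2) p.2 k *: pi (fusion_irr k) v.
  rewrite {1}(fusion_expand p.2) (pi_sum hpi); apply: eq_bigr => k _.
  by rewrite (piZ hpi).
under eq_bigr do rewrite big_allpairs_dep /=.
rewrite exchange_big; apply: eq_bigr => q _ /=.
rewrite linear_sum (psd_suml hH); apply: eq_bigr => k _.
rewrite [in RHS](fusion_expand q.2) (pi_sum hpi) (psd_sumr hH); apply: eq_bigr => l _.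
rewrite gkern_strand !(piZ hpi) linearZZ (psdZl hH) (psdZl hH) (psdZr hH) -mulrA.
by rewrite !(rep_mul hpi) (rep_star hpi).
Qed.

Definition lform (s : seq (gen * H)) (a b : H -> H) : R[i] :=
  \sum_(p <- s) \sum_(q <- s) hdot H (pi (gkern q.1 p.1) (a p.2)) (b q.2).

Lemma pi_bound a : exists2 c, 0 <= c & forall v, `|pi a v| <= c * `|v|.
Proof. by apply: continuous_bounded; exact: (rep_bounded hpi). Qed.

Lemma cyclic_split v0 e : 0 < e -> exists d : H -> fusion D,
  [/\ pi (d v0) v0 = v0, forall v, `|pi (d v) v0| <= `|v| *+ 2 + e
    & forall v a, `|hdot H (v - pi (d v) v0) (pi a v0)| <= e * `|pi a v0|].
Proof.
move=> e0; have := near_projection hH (fun c a b => rep_linear hpi c a b v0) _ e0.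
move=> /(_ _)/cid - /all_sig[d hd].
have hd1 v : `|pi (d v) v0| <= `|v| *+ 2 + e.
  by have [h _] := hd v; rewrite !hdot_pnorm in h.
have hd2 v a : `|hdot H (v - pi (d v) v0) (pi a v0)| <= e * `|pi a v0|.
  by have [_ /(_ a)] := hd v; rewrite hdot_pnorm.
(* At [v0] the unit of the fusion algebra is used, so the remainder of [v0] is exactly zero and the
   induction on the list can proceed. *)
exists (fun v => if v == v0 then fusion_irr (irr0 D) else d v).
split=> [|v|v a]; rewrite ?eqxx ?(pi_unit hpi) //; case: eqP => // ->.
  rewrite (pi_unit hpi) mulr2n -addrA lerDl addr_ge0 // ltW //.
by rewrite (pi_unit hpi) subrr (psd0l hH) normr0 mulr_ge0 // ltW.
Qed.

Lemma lform_split s (m : H -> H) : lform s id id =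
  lform s m m + lform s (fun v => v - m v) (fun v => v - m v) +
  (lform s m (fun v => v - m v) + lform s (fun v => v - m v) m).
Proof.
rewrite /lform -!big_split; apply: eq_bigr => p _ /=.
rewrite -!big_split; apply: eq_bigr => q _ /=.
set K := pi _; rewrite !linearB /= !(psdBl hH).
ring.
Qed.

(* Split every vector into a part in the cyclic subspace of the first one and a
   nearly orthogonal rest; the cross terms are then small. *)
Lemma list_positive (s : seq (gen * H)) : 0 <= lform s id id.
Proof.
elim: {s}(size s) {-2}s (leqnn (size s)) => [|n IH] [|[g0 v0] s] //= hs.
- by rewrite /lform big_nil.
- by rewrite /lform big_nil.
set t := (g0, v0) :: s.
have [cb hcb] : exists cb : fusion D -> R[i], forall a, 0 <= cb a /\
    forall v, `|pi a v| <= cb a * `|v|.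
  have /(_ _)/cid2-/all_sig2[cb cb0 hcb] := pi_bound.
  by exists cb => a; split; [exact: cb0|exact: hcb].
(* Bounds all cross terms; [2|v| + 1] bounds the cyclic part of [v] uniformly in [e <= 1]. *)
pose c := \sum_(p <- t) \sum_(q <- t) (cb (gkern q.1 p.1) * (`|p.2| *+ 2 + 1) +
  cb (fusion_star (gkern q.1 p.1)) * (`|q.2| *+ 2 + 1)).
have cb0 a : 0 <= cb a by case: (hcb a).
have n0 (v : H) : 0 <= `|v| *+ 2 + 1 by rewrite addr_ge0 ?mulrn_wge0.
apply: (@nearly_nonneg _ _ c).
  by do 2![apply: sumr_ge0 => ? _]; rewrite addr_ge0 ?mulr_ge0.
move=> e e0 e1; have [d [d0 d1 d2]] := cyclic_split v0 e0.
pose m v := pi (d v) v0; pose y v := v - m v.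
have dn v : `|m v| <= `|v| *+ 2 + 1 by apply: le_trans (d1 v) _; rewrite lerD2l.
exists (lform t m m + lform t y y).
  apply: addr_ge0.
    have := cyclic_positive v0 [seq (p.1, d p.2) | p <- t].
    by rewrite /lform big_map; under eq_bigr do rewrite big_map.
  (* The first remainder vanishes, so the form of the remainders is that of a shorter list. *)
  have y0 : y v0 = 0 by rewrite /y /m d0 subrr.
  have := IH [seq (p.1, y p.2) | p <- s]; rewrite size_map => /(_ hs).
  congr (0 <= _); rewrite /lform /t big_cons /= [X in _ = X + _]big1 ?add0r => [|p _];
    last first.
    by rewrite y0 linear0 (psd0l hH).
  rewrite big_map; apply: eq_bigr => p _.
  by rewrite big_map big_cons /= y0 (psd0r hH) add0r.
have -> : lform t id id - (lform t m m + lform t y y) = lform t m y + lform t y m.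
  by rewrite (lform_split _ m) addrC addKr.
rewrite /lform -big_split /c mulr_sumr; apply: le_trans (ler_norm_sum _ _ _) _.
apply: ler_sum => p _; rewrite -big_split mulr_sumr; apply: le_trans (ler_norm_sum _ _ _) _.
apply: ler_sum => q _; apply: le_trans (ler_normD _ _) _; rewrite mulrDr; apply: lerD.
  (* The operator already acts on the cyclic part, so the result stays in the orbit of [v0], to
     which remainders are nearly orthogonal. *)
  rewrite (psd_herm hH) norm_conjC -(rep_mul hpi); apply: le_trans (d2 _ _) _.
  rewrite ler_wpM2l ?(ltW e0) // (rep_mul hpi); have [_ h] := hcb (gkern q.1 p.1).
  by apply: le_trans (h _) _; apply: ler_wpM2l; [exact: cb0|exact: dn].
(* Here it acts on the remainder, and the involution first moves it to the cyclic part; this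
   explains [fusion_star] in [c]. *)
rewrite (psd_herm hH) norm_conjC -(rep_star hpi) (psd_herm hH) norm_conjC -(rep_mul hpi).
apply: le_trans (d2 _ _) _.
rewrite ler_wpM2l ?(ltW e0) // (rep_mul hpi); have [_ h] := hcb (fusion_star (gkern q.1 p.1)).
by apply: le_trans (h _) _; apply: ler_wpM2l; [exact: cb0|exact: dn].
Qed.

End KernelPositivity.

(** * Kernels of weight zero *)

Section WeightZero.
Context {R : realType} {C : cstarTensorCategory R} (D : catChoices C).
Implicit Types A B X Y Z W O : C.
Local Notation hT := (ctc_tensor C).

Lemma act_eqm O Y X (eO : O = tunit) (e : O ⊗ Y = Y ⊗ O) (eX : X = O ⊗ X) (x : Mor X (Y ⊗ X)) :
  act (eqm e) x = (idm Y ⊠ eqm eX) ∘ x ∘ eqm (esym eX).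
Proof.
case: _ / (esym eO) e eX => e eX.
have e1 : tunit ⊗ (Y ⊗ X) = Y ⊗ (tunit ⊗ X) by rewrite !tens1o.
rewrite /act /w22 (wh_eqm _ _ _ e1) (mt_eqmr _ (congr1 (tens Y) eX)).
have -> : idm tunit ⊠ x = eqm (esym (tens1o (Y ⊗ X))) ∘ x ∘ eqm (tens1o X).
  by rewrite -[x in RHS]tens1_conj !cmpA eqmVK cmp1m -cmpA eqmVK cmpm1.
by rewrite !cmpA eqmM; congr (_ ∘ _ ∘ _); exact: eqm_irr.
Qed.

Lemma kern_act_eqm O Y X X' (eO : O = tunit) (e : O ⊗ Y = Y ⊗ O) (h : Mor X' (Y ⊗ X'))
    (x : Mor X (Y ⊗ X)) : kern D h (act (eqm e) x) = kern D h x.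
Proof.
have eX : X = O ⊗ X by rewrite eO tens1o.
by rewrite (act_eqm eO e eX) -cmpA kern_natr -cmpA eqmVK cmpm1.
Qed.

Lemma fus_tens1 X (w : Mor X X) : fusion_mul (fus D w) (fus D (idm tunit)) = fus D w.
Proof.
rewrite -fus_tens.
have -> : w ⊠ idm tunit = eqm (esym (tenso1 X)) ∘ (w ∘ eqm (tenso1 X)).
  by rewrite -(tensmo1 hT) cmpA eqmVK cmp1m.
by rewrite fus_comm -cmpA eqmVK cmpm1.
Qed.

(** With [O] the unit, no strand joins [z] to the bent morphism of [h], so the loop is a tensor
    product and [fus_tens] splits it. *)
Lemma kern_weight0 O X X' (eO : O = tunit) (eX : X = O ⊗ X) (e1 : tunit = O ⊗ tunit)
    (h : Mor X' (O ⊗ X')) (z : Mor X X) :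
  kern D h (eqm eX ∘ z) = fusion_mul (kern D h (eqm e1)) (fus D z).
Proof.
have eA : dual D X' = dual D X' ⊗ O by rewrite eO tenso1.
have key Z (eZ : Z = O ⊗ Z) (y : Mor Z Z) :
    kern D h (eqm eZ ∘ y) = fusion_mul (fus D (sharp D h ∘ eqm eA)) (fus D y).
  rewrite -fus_tens /kern /loop mtMr cmpA; congr (fus D _).
  have e2 : dual D X' ⊗ Z = dual D X' ⊗ (O ⊗ Z) by rewrite -eZ.
  have -> : w21 (sharp D h) Z ∘ (idm _ ⊠ eqm eZ) = (sharp D h ∘ eqm eA) ⊠ idm Z.
    rewrite (mt_eqmr _ e2) -wh_erefl (whM _ (tensA _ O Z)) /w21; congr (_ ∘ _).
    by apply/esym; exact: wh_eqm.
  by rewrite -mt_split.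
have -> : kern D h (eqm e1) = kern D h (eqm e1 ∘ idm tunit) by rewrite cmpm1.
by rewrite !key fus_tens1.
Qed.

Lemma kern_weight0_unit O (eO : O = tunit) (e1 : tunit = O ⊗ tunit) :
  kern D (eqm e1) (eqm e1) = fusion_irr (irr0 D).
Proof.
have er : tunit = tunit ⊗ tunit :> C by rewrite tenso1.
have cr : conjugate_eqs (eqm er) (eqm er).
  suff z : zz (eqm er) (eqm er) by apply/conj_zz.
  rewrite /zz /cap eqmadj (wh_eqm _ _ _ (etrans (esym (congr1 (tens tunit) er)) (esym er))).
  by rewrite (mt_eqmr _ (congr1 (tens tunit) er)) eqmM; exact: eqm_irr.
have ef : tunit ⊗ O = tunit by rewrite eO tenso1.
have eR : tunit ⊗ (O ⊗ tunit) = tunit ⊗ tunit by rewrite -e1.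
have sh : is_sharp (eqm er) (eqm e1) (eqm ef).
  rewrite /is_sharp !eqmadj (mt_eqmr _ eR) /w21 (wh_eqm _ _ _ eR) !eqmM; exact: eqm_irr.
rewrite (kernE D (eqm e1) cr sh) /loop /w21 (wh_eqm _ _ _ eR) (mt_eqmr _ (esym eR)) eqmM eqm1.
by rewrite -fus_irr; apply: fus_eqm; rewrite rep0 tens1o.
Qed.

Lemma act_unit_vector O A (eO : O = tunit) (e : A ⊗ O = O ⊗ A) (e1 : tunit = O ⊗ tunit)
    (e2 : A ⊗ tunit = O ⊗ (A ⊗ tunit)) : act (eqm e) (eqm e1) = eqm e2.
Proof.
have e3 : A ⊗ (O ⊗ tunit) = O ⊗ (A ⊗ tunit) by rewrite -e2 -e1.
by rewrite /act /w22 (wh_eqm _ _ _ e3) (mt_eqmr _ (congr1 (tens A) e1)) eqmM; exact: eqm_irr.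
Qed.

End WeightZero.

HB.instance Definition _ (R : realType) (C : cstarTensorCategory R) (Y : C) :=
  gen_eqMixin (gen Y).
HB.instance Definition _ (R : realType) (C : cstarTensorCategory R) (Y : C) :=
  gen_choiceMixin (gen Y).

(** * The induced representation of the tube algebra *)

Section KernelForms.
Context {R : realType} {C : cstarTensorCategory R} (D : catChoices C).
Variables (H : hilbertSpace R) (pi : fusion D -> {linear H -> H}).
Hypothesis hpi : nondeg_star_rep (@fusion_mul R C D) (@fusion_star R C D) pi.
Local Notation hH := (hdot_psd H).

(** One copy of [H] per label. For generators as labels, linear relations between them become
    visible only as null vectors of the form. *)
Definition hsum (T : choiceType) := @dsum R[i] T (fun=> H).
Definition hsingle (T : choiceType) (t : T) (v : H) : hsum T :=
  single (fun=> (H : lmodType R[i])) t v.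

Section Forms.
Variables T S : choiceType.
Implicit Types (k : S -> T -> fusion D) (u : hsum T) (v : hsum S).

(** With an arbitrary kernel on two label types, relabelling generators by a tube becomes a change
    of [k], and identities of operators reduce to identities of kernels. *)
Definition bform k u v : R[i] :=
  \sum_(g <- dsupp u) \sum_(h <- dsupp v) hdot H (pi (k h g) (u g)) (v h).

Lemma bformE k u v : bform k u v =
  dlift (W := R[i]^o) (fun g w => \sum_(h <- dsupp v) hdot H (pi (k h g) w) (v h)) u.
Proof. by []. Qed.

Lemma bform_linl k a u u' v : bform k (a *: u + u') v = a * bform k u v + bform k u' v.
Proof.
rewrite !bformE; apply: (dlift_linear (W := R[i]^o)) => g b w w'.
rewrite -[RHS]/(b * _ + _) mulr_sumr -big_split; apply: eq_bigr => h _ /=.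
by rewrite linearP (psd_linl hH).
Qed.

Lemma bform_widen k u v s t : uniq s -> {subset dsupp u <= s} -> uniq t ->
  {subset dsupp v <= t} ->
  bform k u v = \sum_(g <- s) \sum_(h <- t) hdot H (pi (k h g) (u g)) (v h).
Proof.
move=> us su ut tv; rewrite /bform (dsupp_widen us su) => [|g u0]; last first.
  by rewrite big1 // => h _; rewrite u0 linear0 (psd0l hH).
apply: eq_bigr => g _; apply: dsupp_widen => // h v0.
by rewrite v0 (psd0r hH).
Qed.

Lemma bform_linr k a u v v' : bform k u (a *: v + v') = a^* * bform k u v + bform k u v'.
Proof.
pose t := undup (dsupp v ++ dsupp v' ++ dsupp (a *: v + v')).
have sub (w : hsum S) : w \in [:: v; v'; a *: v + v'] -> {subset dsupp w <= t}.
  by rewrite !inE => wv h; rewrite mem_undup !mem_cat; case/or3P: wv => /eqP ->  ->;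
    rewrite ?orbT.
rewrite !(@bform_widen k u _ (dsupp u) t) ?dsupp_uniq ?undup_uniq //; first last.
- by apply: sub; rewrite !inE eqxx ?orbT.
- by apply: sub; rewrite !inE eqxx ?orbT.
- by apply: sub; rewrite !inE eqxx ?orbT.
rewrite mulr_sumr -big_split; apply: eq_bigr => g _ /=.
by rewrite mulr_sumr -big_split; apply: eq_bigr => h _; exact: (psd_linr hH).
Qed.

Lemma bform_addl k v : {morph bform k ^~ v : u u' / u + u'}.
Proof. by move=> u u'; have := bform_linl k 1 u u' v; rewrite scale1r mul1r. Qed.

Lemma bform_addr k u : {morph bform k u : v v' / v + v'}.
Proof. by move=> v v'; have := bform_linr k 1 u v v'; rewrite scale1r rmorph1 mul1r. Qed.

Lemma bform0l k v : bform k 0 v = 0.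
Proof. by apply: (addrI (bform k 0 v)); rewrite -bform_addl !addr0. Qed.

Lemma bform0r k u : bform k u 0 = 0.
Proof. by apply: (addrI (bform k u 0)); rewrite -bform_addr !addr0. Qed.

Lemma bform_single k g h x y :
  bform k (hsingle g x) (hsingle h y) = hdot H (pi (k h g) x) y.
Proof.
have sub (U : choiceType) (t : U) z : {subset dsupp (hsingle t z) <= [:: t]}.
  move=> t'; rewrite mem_dsupp inE; apply: contraNT; rewrite eq_sym => ts.
  by rewrite /hsingle single_neq.
by rewrite (@bform_widen _ _ _ [:: g] [:: h]) // !big_seq1 /hsingle !singleE.
Qed.

Lemma bform_kernP a k k' u v :
  bform (fun h g => a *: k h g + k' h g) u v = a * bform k u v + bform k' u v.
Proof.
rewrite /bform mulr_sumr -big_split; apply: eq_bigr => g _ /=.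
rewrite mulr_sumr -big_split; apply: eq_bigr => h _ /=.
by rewrite (rep_linear hpi) (psd_linl hH).
Qed.

Lemma eq_bform k k' u v : (forall h g, k h g = k' h g) -> bform k u v = bform k' u v.
Proof. by move=> kk; apply: eq_bigr => g _; apply: eq_bigr => h _; rewrite kk. Qed.

Lemma bform_kern0 u v : bform (fun _ _ => 0) u v = 0.
Proof. by rewrite /bform big1 // => g _; rewrite big1 // => h _;
  rewrite (pi0 hpi) (psd0l hH). Qed.

Lemma bform_kern_sum J (r : seq J) (k : J -> S -> T -> fusion D) u v :
  bform (fun h g => \sum_(a <- r) k a h g) u v = \sum_(a <- r) bform (k a) u v.
Proof.
elim: r => [|a r IH].
  by rewrite big_nil -[RHS](bform_kern0 u v); apply: eq_bform => h g; rewrite big_nil.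
rewrite big_cons -IH -[bform (k a) u v]mul1r -bform_kernP; apply: eq_bform => h g.
by rewrite big_cons scale1r.
Qed.

End Forms.

Definition gmap (T S : choiceType) (f : T -> S) (u : hsum T) : hsum S :=
  dlift (fun g w => hsingle (f g) w) u.

Lemma gmap_linear (T S : choiceType) (f : T -> S) : linear (gmap f).
Proof. by apply: dlift_linear => g a u v; exact: singleP. Qed.

Lemma gmap_add (T S : choiceType) (f : T -> S) : {morph gmap f : u v / u + v}.
Proof. by move=> u v; have := gmap_linear f 1 u v; rewrite !scale1r. Qed.

Lemma gmap_single (T S : choiceType) (f : T -> S) g w :
  gmap f (hsingle g w) = hsingle (f g) w.
Proof. by apply: dlift_single => t a u v; exact: singleP. Qed.

Lemma hsum_ext (T S : choiceType) (B B' : hsum T -> hsum S -> R[i]) :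
  (forall v, {morph B ^~ v : u u' / u + u'}) -> (forall u, {morph B u : v v' / v + v'}) ->
  (forall v, {morph B' ^~ v : u u' / u + u'}) -> (forall u, {morph B' u : v v' / v + v'}) ->
  (forall g h x y, B (hsingle g x) (hsingle h y) = B' (hsingle g x) (hsingle h y)) ->
  forall u v, B u v = B' u v.
Proof.
move=> Bl Br Bl' Br' BB u v.
apply: (dsum_additive_eq (F := B^~ v) (G := B'^~ v)) => // g x.
by apply: (dsum_additive_eq (F := B _) (G := B' _)) => // h y; exact: BB.
Qed.

Lemma bform_gmapl (T T' S : choiceType) (f : T -> T') (k : S -> T' -> fusion D) u v :
  bform k (gmap f u) v = bform (fun h g => k h (f g)) u v.
Proof.
apply: (hsum_ext (B := fun u v => bform k (gmap f u) v)) => [w x y|w x y|w x y|w x y|g h x y].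
- by rewrite gmap_add bform_addl.
- exact: bform_addr.
- exact: bform_addl.
- exact: bform_addr.
by rewrite gmap_single !bform_single.
Qed.

Lemma bform_gmapr (T S S' : choiceType) (f : S -> S') (k : S' -> T -> fusion D) u v :
  bform k u (gmap f v) = bform (fun h g => k (f h) g) u v.
Proof.
apply: (hsum_ext (B := fun u v => bform k u (gmap f v))) => [w x y|w x y|w x y|w x y|g h x y].
- exact: bform_addl.
- by rewrite gmap_add bform_addr.
- exact: bform_addl.
- exact: bform_addr.
by rewrite gmap_single !bform_single.
Qed.

Local Notation I := (Irr D).
Local Notation X_ k := (rep (c:=D) k).

Definition weight_space (j : I) : lmodType R[i] := hsum (gen (X_ j)).

Definition pre_space : lmodType R[i] := dsum weight_space.
Implicit Types (u v : pre_space).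

Definition pre_form (u v : pre_space) : R[i] :=
  \sum_(j <- dsupp u) bform (@gkern _ _ D (X_ j)) (u j) (v j).

Definition actg (A Y Y' : C) (f : Mor (A ⊗ Y) (Y' ⊗ A)) (g : gen Y) : gen Y' :=
  mkgen (act f (projT2 g)).

(** Since tubes merely move labels, this depends on [x] linearly and multiplicatively only inside
    [pre_form], hence after completion. *)
Definition tube_op (x : tube D) (u : pre_space) : pre_space :=
  \sum_(t <- dsupp x) single weight_space t.1.2 (gmap (actg (x t)) (u t.1.1)).

Lemma pre_form_linl a u u' v : pre_form (a *: u + u') v = a * pre_form u v + pre_form u' v.
Proof.
apply: (dlift_linear (W := R[i]^o)
  (F := fun j w => bform (@gkern _ _ D (X_ j)) w (v j))) => j b w w'.
exact: bform_linl.
Qed.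

Lemma pre_form_linr a u v v' : pre_form u (a *: v + v') = a^* * pre_form u v + pre_form u v'.
Proof.
rewrite /pre_form mulr_sumr -big_split; apply: eq_bigr => j _.
exact: bform_linr.
Qed.

Lemma pre_form_suml J (r : seq J) (F : J -> pre_space) v :
  pre_form (\sum_(a <- r) F a) v = \sum_(a <- r) pre_form (F a) v.
Proof.
apply: (big_morph (pre_form^~ v)) => [u u'|]; last by rewrite /pre_form big1_seq // => j;
  rewrite mem_dsupp eqxx.
by have := pre_form_linl 1 u u' v; rewrite scale1r mul1r.
Qed.

Lemma pre_form_sumr J (r : seq J) (F : J -> pre_space) u :
  pre_form u (\sum_(a <- r) F a) = \sum_(a <- r) pre_form u (F a).
Proof.
apply: (big_morph (pre_form u)) => [v v'|]; last by rewrite /pre_form big1 // => j _;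
  exact: bform0r.
by have := pre_form_linr 1 u v v'; rewrite scale1r rmorph1 mul1r.
Qed.

Lemma pre_form_singlel j (w : weight_space j) v :
  pre_form (single weight_space j w) v = bform (@gkern _ _ D (X_ j)) w (v j).
Proof.
apply: (dlift_single (W := R[i]^o)
  (F := fun j w => bform (@gkern _ _ D (X_ j)) w (v j))) => i b z z'.
exact: bform_linl.
Qed.

Lemma pre_form_singler u j (w : weight_space j) :
  pre_form u (single weight_space j w) = bform (@gkern _ _ D (X_ j)) (u j) w.
Proof.
rewrite /pre_form; have [ju|] := boolP (j \in dsupp u); last first.
  rewrite mem_dsupp negbK => /eqP uj; rewrite uj bform0l big1_seq // => i /andP[_ iu].
  rewrite single_neq ?bform0r //; apply: contraTneq iu => <-.
  by rewrite mem_dsupp uj eqxx.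
rewrite (bigD1_seq j) ?dsupp_uniq // big1 => [|i ij]; last first.
  by rewrite single_neq ?bform0r // eq_sym.
by rewrite singleE /= addr0.
Qed.

Lemma tube_op_linear x : linear (tube_op x).
Proof.
move=> a u v; rewrite /tube_op scaler_sumr -big_split; apply: eq_bigr => t _.
rewrite -[RHS](singleP (V := weight_space)); congr (single _ _ _); exact: gmap_linear.
Qed.

HB.instance Definition _ x :=
  GRing.isLinear.Build R[i] pre_space pre_space *:%R (tube_op x) (tube_op_linear x).

Lemma tube_op_forml x u v : pre_form (tube_op x u) v =
  \sum_(t <- dsupp x) bform (fun h g => gkern D h (actg (x t) g)) (u t.1.1) (v t.1.2).
Proof.
rewrite pre_form_suml; apply: eq_bigr => t _.
by rewrite pre_form_singlel bform_gmapl.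
Qed.

Lemma tube_op_formr x u v : pre_form u (tube_op x v) =
  \sum_(t <- dsupp x) bform (fun h g => gkern D (actg (x t) h) g) (u t.1.2) (v t.1.1).
Proof.
rewrite pre_form_sumr; apply: eq_bigr => t _.
by rewrite pre_form_singler bform_gmapr.
Qed.

Definition tube_coef u v (t : I * I * I) (f : tube_space (D := D) t) : R[i]^o :=
  bform (fun h g => gkern D h (actg f g)) (u t.1.1) (v t.1.2).

Lemma tube_coefP u v (t : I * I * I) a (f f' : tube_space (D := D) t) :
  tube_coef u v (a *: f + f') = a *: tube_coef u v f + tube_coef u v f'.
Proof.
rewrite /tube_coef -bform_kernP; apply: eq_bform => h g.
by rewrite /gkern /= actP kernDr kernZr.
Qed.

Lemma tube_op_coef x u v : pre_form (tube_op x u) v = dlift (tube_coef u v) x.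
Proof. exact: tube_op_forml. Qed.

Lemma tube_op_lin a x y u v : pre_form (tube_op (a *: x + y) u) v =
  a * pre_form (tube_op x u) v + pre_form (tube_op y u) v.
Proof. by rewrite !tube_op_coef; apply: dlift_linear => t; exact: tube_coefP. Qed.

Definition tube_swap (t : I * I * I) : I * I * I := (t.1.2, t.1.1, bar t.2).

Lemma tube_swapK : involutive tube_swap.
Proof. by move=> [[i j] k]; rewrite /tube_swap /= barK. Qed.

Lemma tube_star_supp x t : t \in dsupp (tube_star x) -> tube_swap t \in dsupp x.
Proof.
rewrite !mem_dsupp; apply: contra_neq; case: t => [[i j] k] /= x0.
by rewrite /tube_star_fun /= x0 madj0 /mid mt0l mt0r !(m0l, m0r).
Qed.

Lemma tube_op_star x u v : pre_form (tube_op (tube_star x) u) v = pre_form u (tube_op x v).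
Proof.
pose s := [seq tube_swap t | t <- dsupp x].
rewrite tube_op_coef (@dlift_widen _ _ _ _ _ (@tube_coefP u v) _ s); first last.
- by move=> t /tube_star_supp xt; apply/mapP; exists (tube_swap t); rewrite ?tube_swapK.
- by rewrite map_inj_uniq ?dsupp_uniq //; exact: inv_inj tube_swapK.
have e : [seq tube_swap t | t <- s] = dsupp x.
  by rewrite -map_comp map_id_in // => t _ /=; exact: tube_swapK.
rewrite tube_op_formr -e [RHS]big_map; apply: eq_bigr => -[[i j] k] _.
by apply: eq_bform => h g; exact: kern_act_star.
Qed.

End KernelForms.

Section Boxes.
Context {I : choiceType}.
Implicit Types s : seq I.

Definition box s s' : seq (I * I * I) :=
  [seq (ij, k) | ij <- [seq (i, j) | i <- s, j <- s], k <- s'].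

Lemma box_uniq s s' : uniq s -> uniq s' -> uniq (box s s').
Proof.
move=> us us'; apply: allpairs_uniq => [||[? ?] [? ?] _ _ []] //; last by move=> -> ->.
by apply: allpairs_uniq => [||[? ?] [? ?] _ _ []] //; move=> -> ->.
Qed.

Lemma mem_box s s' t : t \in box s s' = [&& t.1.1 \in s, t.1.2 \in s & t.2 \in s'].
Proof.
apply/allpairsP/and3P => [[[[i j] k] /= [/allpairsP[[i' j'] /= [si sj [-> ->]]] sk ->]] //|].
case: t => [[i j] k] /= [si sj sk]; exists ((i, j), k) => /=; split=> //.
by apply/allpairsP; exists (i, j).
Qed.

Lemma big_box (W : nmodType) s s' (F : I * I * I -> W) :
  \sum_(t <- box s s') F t = \sum_(i <- s) \sum_(j <- s) \sum_(k <- s') F (i, j, k).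
Proof. by rewrite /box big_allpairs /= big_allpairs. Qed.

Lemma sum_subset (W : nmodType) s s' (F : I -> W) : uniq s -> uniq s' ->
  {subset s <= s'} -> (forall k, k \notin s -> F k = 0) ->
  \sum_(k <- s) F k = \sum_(k <- s') F k.
Proof.
move=> us us' sub F0; rewrite -(fsum_seq us F0) (fsum_seq us') // => k ks'.
by apply: F0; apply: contra ks'; exact: sub.
Qed.

End Boxes.

(** * Multiplicativity of the tube action *)

Section TubeProduct.
Context {R : realType} {C : cstarTensorCategory R} (D : catChoices C).
Variables (H : hilbertSpace R) (pi : fusion D -> {linear H -> H}).
Hypothesis hpi : nondeg_star_rep (@fusion_mul R C D) (@fusion_star R C D) pi.
Local Notation I := (Irr D).
Local Notation X_ k := (rep (c:=D) k).
Implicit Types (u v : pre_space D H) (x y : tube D).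

Lemma tube_coef0 u v (t : I * I * I) : tube_coef pi u v (0 : tube_space (D := D) t) = 0.
Proof.
have := tube_coefP hpi u v (-1) (0 : tube_space (D := D) t) 0.
by rewrite scaler0 addr0 scaleN1r addNr.
Qed.

Lemma tube_coef_sum u v (t : I * I * I) J (r : seq J) (F : J -> tube_space (D := D) t) :
  tube_coef pi u v (\sum_(a <- r) F a) = \sum_(a <- r) tube_coef pi u v (F a).
Proof.
apply: (big_morph (tube_coef pi u v (t := t))) => [f f'|]; last exact: tube_coef0.
by have := tube_coefP hpi u v 1 f f'; rewrite !scale1r.
Qed.

Lemma actg_mul0 i j a (m l : I) (f : Mor (X_ m ⊗ X_ a) (X_ j ⊗ X_ m)) (h : gen (X_ j)) (g :
  gen (X_ i)) :
  gkern D h (actg f (actg (0 : Mor (X_ l ⊗ X_ i) (X_ a ⊗ X_ l)) g)) = 0.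
Proof.
have act0 A Y Y' X (z : Mor X (Y ⊗ X)) : act (0 : Mor (A ⊗ Y) (Y' ⊗ A)) z = 0.
  by have := actP (-1) (0 : Mor (A ⊗ Y) (Y' ⊗ A)) 0 z; rewrite scaler0 addr0 scaleN1r addNr.
by rewrite /gkern /= act0 /act mt0r m0r kern0r.
Qed.

Variables (x y : tube D) (u v : pre_space D H).

Definition tube_supp : seq I := undup (flatten
  [seq [:: t.1.1; t.1.2; t.2] | t : I * I * I <- dsupp x ++ dsupp y]).
Local Notation s := tube_supp.

Lemma tube_suppP (t : I * I * I) : t \in dsupp x ++ dsupp y -> t \in box s s.
Proof.
move=> tx; rewrite mem_box !mem_undup; apply/and3P; split; apply/flatten_mapP; exists t => //;
  by rewrite !inE eqxx ?orbT.
Qed.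

Definition prod_supp : seq I :=
  undup (flatten [seq irrs D (X_ m ⊗ X_ l) | m <- s, l <- s]).

Definition coef2 (i j a m l : I) : R[i] :=
  bform pi (fun h g => gkern D h (actg (x (a, j, m)) (actg (y (i, a, l)) g))) (u i) (v j).

Lemma tube_op_iterated : pre_form pi (tube_op x (tube_op y u)) v =
  \sum_(a <- s) \sum_(j <- s) \sum_(m <- s) \sum_(i <- s) \sum_(l <- s) coef2 i j a m l.
Proof.
have us : uniq s := undup_uniq _; have ub := box_uniq us us.
rewrite (tube_op_coef pi) (dlift_widen (tube_coefP hpi _ v) ub) => [|t tx]; last first.
  by apply: tube_suppP; rewrite mem_cat tx.
rewrite big_box; apply: eq_big_seq => a sa; apply: eq_bigr => j _; apply: eq_bigr => m _.
rewrite /tube_coef /= dsum_suml.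
set k := fun h : _ => _.
rewrite (big_morph (bform pi k ^~ (v j)) (bform_addl pi k (v j)) (bform0l pi k (v j))).
pose G (t : I * I * I) := bform pi k (single (weight_space H (D:=D)) t.1.2
  (gmap (actg (y t)) (u t.1.1)) a) (v j).
have G_eq i l : G (i, a, l) = coef2 i j a m l.
  by rewrite /G singleE bform_gmapl.
rewrite -[LHS]/(\sum_(t <- dsupp y) G t) (dsupp_widen ub); first last.
- move=> [[i b] l] y0; have [e|ba] := eqVneq b a; last first.
    by rewrite /G single_neq ?bform0l.
  case: a / e sa k @G G_eq => sa k G G_eq; rewrite G_eq /coef2.
  rewrite -[RHS](bform_kern0 hpi (u i) (v j)); apply: eq_bform => h g.
  by rewrite y0 actg_mul0.
- by move=> t ty; apply: tube_suppP; rewrite mem_cat ty orbT.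
rewrite big_box; apply: eq_bigr => i _; rewrite (bigD1_seq a) //= [X in _ + X]big1 ?addr0.
  by apply: eq_bigr => l _; exact: G_eq.
by move=> b ba; rewrite big1 // => l _; rewrite /G single_neq ?bform0l.
Qed.

Lemma tube_coef_term i j k a m l :
  tube_coef pi u v (t := (i, j, k)) (tube_mul_term x y i j k a m l) =
  bform pi (fun h g => \sum_(V <- onb k (X_ m ⊗ X_ l))
    gkern D h (actg ((idm (X_ j) ⊠ V^†) ∘ eqm (tensA (X_ j) (X_ m) (X_ l))
    ∘ (x (a, j, m) ⊠ idm (X_ l)) ∘ eqm (esym (tensA (X_ m) (X_ a) (X_ l)))
    ∘ (idm (X_ m) ⊠ y (i, a, l)) ∘ eqm (tensA (X_ m) (X_ l) (X_ i))
    ∘ (V ⊠ idm (X_ i))) g)) (u i) (v j).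
Proof. by rewrite bform_kern_sum // /tube_mul_term tube_coef_sum. Qed.

Lemma sum_tube_coef_term i j a m l : m \in s -> l \in s ->
  \sum_(k <- prod_supp) tube_coef pi u v (t := (i, j, k)) (tube_mul_term x y i j k a m l) =
  coef2 i j a m l.
Proof.
move=> sm sl; rewrite -(sum_subset (irrs_uniq D (X_ m ⊗ X_ l))); first last.
- move=> k kn; rewrite /tube_mul_term big1_seq ?tube_coef0 // => V _.
  by rewrite (irrsP kn V) mt0l m0r.
- move=> k kn; rewrite mem_undup; apply/flattenP; exists (irrs D (X_ m ⊗ X_ l)) => //.
  by apply/allpairsP; exists (m, l).
- exact: undup_uniq.
under eq_bigr do rewrite tube_coef_term.
rewrite -(bform_kern_sum hpi); apply: eq_bform => h g.
exact: kern_compress.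
Qed.

Lemma tube_mul_term_supp i j k a m l : tube_mul_term x y i j k a m l != 0 ->
  [/\ (a, j, m) \in dsupp x, (i, a, l) \in dsupp y & k \in irrs D (X_ m ⊗ X_ l)].
Proof.
rewrite !mem_dsupp => h; split; apply: contraNT h.
- rewrite negbK => /eqP x0; rewrite /tube_mul_term x0 big1 // => V _.
  by rewrite mt0l m0r !m0l.
- rewrite negbK => /eqP y0; rewrite /tube_mul_term y0 big1 // => V _.
  by rewrite mt0r m0r !m0l.
move=> kn; rewrite /tube_mul_term big1_seq // => V _.
by rewrite (irrsP kn V) mt0l m0r.
Qed.

Lemma tube_mul_box i j k : tube_mul x y (i, j, k) =
  \sum_(w <- box s s) tube_mul_term x y i j k w.1.1 w.1.2 w.2.
Proof.
have us : uniq s := undup_uniq _; apply: fsum_seq => [|[[a m] l] /=]; first exact: box_uniq.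
move=> wn; apply/eqP; apply: contraNT wn => /tube_mul_term_supp[xs ys _].
have := @tube_suppP (a, j, m); have := @tube_suppP (i, a, l).
rewrite !mem_cat xs ys orbT !mem_box /= => /(_ isT)/and3P[_ sa sl] /(_ isT)/and3P[_ _ sm].
by rewrite sa sm sl.
Qed.

Lemma tube_mul_supp_ex i j k : (i, j, k) \in dsupp (tube_mul x y) -> exists a m l,
  [/\ (a, j, m) \in dsupp x, (i, a, l) \in dsupp y & k \in irrs D (X_ m ⊗ X_ l)].
Proof.
rewrite mem_dsupp tube_mul_box => h.
have [[[a m] l] wb /tube_mul_term_supp] : exists2 w, w \in box s s &
    tube_mul_term x y i j k w.1.1 w.1.2 w.2 != 0; last by exists a, m, l.
apply: contrapT => no; case/eqP: h; rewrite big1_seq // => w /= wb.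
by apply/eqP; apply: contrapT => w0; apply: no; exists w => //; apply/negP.
Qed.

Lemma tube_mul_supp t : t \in dsupp (tube_mul x y) -> t \in box s prod_supp.
Proof.
case: t => [[i j] k] /tube_mul_supp_ex[a [m [l [xs ys kml]]]]; rewrite mem_box /=.
have := @tube_suppP (a, j, m); have := @tube_suppP (i, a, l).
rewrite !mem_cat xs ys orbT !mem_box /= => /(_ isT)/and3P[si sa sl] /(_ isT)/and3P[_ sj sm].
rewrite si sj mem_undup; apply/flattenP; exists (irrs D (X_ m ⊗ X_ l)) => //.
by apply/allpairsP; exists (m, l).
Qed.

(** Both sides are expanded over one finite box of indices containing both supports; term by term,
    the sum over [k] is then [kern_compress]. *)
Lemma tube_op_product : pre_form pi (tube_op (tube_mul x y) u) v =
  pre_form pi (tube_op x (tube_op y u)) v.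
Proof.
have us : uniq s := undup_uniq _.
have ub' : uniq (box s prod_supp) := box_uniq us (undup_uniq _).
rewrite (tube_op_coef pi) (dlift_widen (tube_coefP hpi u v) ub' tube_mul_supp) big_box.
rewrite tube_op_iterated.
transitivity (\sum_(i <- s) \sum_(j <- s) \sum_(a <- s) \sum_(m <- s) \sum_(l <- s)
  coef2 i j a m l).
  apply: eq_bigr => i _; apply: eq_bigr => j _.
  transitivity (\sum_(w <- box s s) coef2 i j w.1.1 w.1.2 w.2); last by rewrite big_box.
  under eq_bigr do rewrite tube_mul_box tube_coef_sum.
  rewrite exchange_big; apply: eq_big_seq => -[[a m] l]; rewrite mem_box => /and3P[_ sm sl].
  exact: sum_tube_coef_term.
under eq_bigr do rewrite exchange_big.
rewrite exchange_big; apply: eq_bigr => a _ /=.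
rewrite exchange_big; apply: eq_bigr => j _ /=.
by rewrite exchange_big.
Qed.

End TubeProduct.

(** * Positivity of the form and boundedness of the tubes *)

Section TubeOperators.
Context {R : realType} {C : cstarTensorCategory R} (D : catChoices C).
Variables (H : hilbertSpace R) (pi : fusion D -> {linear H -> H}).
Hypothesis hpi : nondeg_star_rep (@fusion_mul R C D) (@fusion_star R C D) pi.
Hypothesis pos : forall (Y X : C) (x : Mor X (Y ⊗ X)) v,
  0 <= hdot H (pi (kern D x x) v) v.
Local Notation I := (Irr D).
Local Notation X_ k := (rep (c:=D) k).
Implicit Types (u v : pre_space D H) (x y : tube D).

Lemma bform_ge0 Y (w : hsum H (gen Y)) : 0 <= bform pi (@gkern _ _ D Y) w w.
Proof.
have := list_positive hpi (@pos Y) [seq (g, w g) | g <- dsupp w].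
rewrite /lform big_map; congr (0 <= _); apply: eq_bigr => g _.
by rewrite big_map.
Qed.

Lemma pre_form_psd : psd_form (pre_form (D := D) (H := H) pi).
Proof.
split=> [a u v w|a u v w|u].
- exact: pre_form_linl.
- exact: pre_form_linr.
by apply: sumr_ge0 => j _; exact: bform_ge0.
Qed.

Lemma pre_form_component u i :
  bform pi (@gkern _ _ D (X_ i)) (u i) (u i) <= pre_form pi u u.
Proof.
have [iu|] := boolP (i \in dsupp u); last first.
  by rewrite mem_dsupp negbK => /eqP ->; rewrite bform0l (psd_ge0 pre_form_psd).
rewrite /pre_form (bigD1_seq i) ?dsupp_uniq //= lerDl.
by apply: sumr_ge0 => j _; exact: bform_ge0.
Qed.

Lemma homogeneous_bound (t : I * I * I) (f : tube_space (D := D) t) :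
  exists2 c, 0 <= c & forall u,
    pnorm (pre_form pi) (single (weight_space H (D := D)) t.1.2 (gmap (actg f) (u t.1.1)))
      <= c * pnorm (pre_form pi) u.
Proof.
have [c c0 [W [b hb]]] := act_bound D f (rep_simple (c := D) t.1.2).
exists (sqrtC c) => [|u]; first by rewrite sqrtC_ge0.
have hQ := pre_form_psd; apply: (pnorm_le hQ).
  apply: mulr_ge0; first by rewrite sqrtC_ge0. exact: (pnorm_ge0 hQ u).
rewrite exprMn sqrtCK (pnorm_sqr (pre_form pi)) pre_form_singlel singleE.
apply: le_trans (ler_wpM2l c0 (pre_form_component u t.1.1)).
rewrite bform_gmapl bform_gmapr.
have -> : c * bform pi (@gkern _ _ D (X_ t.1.1)) (u t.1.1) (u t.1.1) =
   bform pi (fun h g => gkern D (actg f h) (actg f g)) (u t.1.1) (u t.1.1) +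
   bform pi (fun h g => gkern D (actg b h) (actg b g)) (u t.1.1) (u t.1.1).
  rewrite -[c * _]addr0 -(bform_kern0 hpi (u t.1.1) (u t.1.1)) -(bform_kernP hpi).
  rewrite -[X in _ = X + _]mul1r -(bform_kernP hpi); apply: eq_bform => h g.
  by rewrite addr0 scale1r /gkern hb.
by rewrite lerDl; have := bform_ge0 (gmap (actg b) (u t.1.1)); rewrite bform_gmapl bform_gmapr.
Qed.

Lemma tube_op_bound x : exists2 c, 0 <= c &
  forall u, pnorm (pre_form pi) (tube_op x u) <= c * pnorm (pre_form pi) u.
Proof.
have hQ := pre_form_psd.
have /(_ _ _)/cid2 hb := homogeneous_bound.
pose c t := s2val (hb t (x t)).
exists (\sum_(t <- dsupp x) c t) => [|u].
  by apply: sumr_ge0 => t _; rewrite /c; case: (hb _ _).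
rewrite /tube_op mulr_suml; apply: le_trans (pnorm_sum hQ _ _ _) _.
by apply: ler_sum => t _; rewrite /c; case: (hb _ _) => /= c' _; apply.
Qed.

End TubeOperators.

(** * Extension of identities by density *)

Section Extension.
Context {R : realType} (K : hilbertSpace R) (V : lmodType R[i]) (j : {linear V -> K}).
Hypothesis jd : forall (f : K) e, 0 < e -> exists v, `|f - j v| < e.

Lemma lipschitz_ext (W : normedZmodType R[i]) (P : K -> W) c : 0 <= c ->
  (forall f g, `|P f - P g| <= c * `|f - g|) -> (forall v, P (j v) = 0) ->
  forall f, P f = 0.
Proof.
move=> c0 lipP Pj f; apply/eqP; rewrite -normr_eq0; apply/eqP/small_eq0 => e e0.
have c1 : 0 < c + 1 by rewrite ltr_wpDl.
have [v hv] := jd f (divr_gt0 e0 c1).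
rewrite normr_id -[P f]subr0 -(Pj v); apply: le_lt_trans (lipP _ _) _.
move: hv; rewrite ltr_pdivlMr // mulrC; apply: le_lt_trans.
by rewrite ler_wpM2r // lerDl.
Qed.

Lemma dense_dot0 (f : K) : (forall v, hdot K f (j v) = 0) -> f = 0.
Proof.
move=> h; have hK := hdot_psd K.
have all0 : forall g, hdot K f g = 0.
  apply: (@lipschitz_ext _ (fun g => hdot K f g : R[i]) `|f|) => // g g'.
  rewrite -(psdBr hK); apply: le_trans (psd_cauchy_schwarz hK _ _) _.
  by rewrite !hdot_pnorm.
by apply/eqP; rewrite -normr_eq0 -sqrf_eq0 -hdot_norm all0.
Qed.

Definition bdd (W W' : normedZmodType R[i]) (P : W -> W') :=
  exists2 c, 0 <= c & forall f, `|P f| <= c * `|f|.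

Lemma bddD (W W' : normedZmodType R[i]) (P Q : W -> W') : bdd P -> bdd Q -> bdd (P \+ Q).
Proof.
move=> [c c0 hP] [d d0 hQ]; exists (c + d) => [|f]; first exact: addr_ge0.
by apply: le_trans (ler_normD _ _) _; rewrite mulrDl lerD.
Qed.

Lemma bddN (W W' : normedZmodType R[i]) (P Q : W -> W') : bdd P -> bdd Q -> bdd (P \- Q).
Proof.
move=> [c c0 hP] [d d0 hQ]; exists (c + d) => [|f]; first exact: addr_ge0.
by apply: le_trans (ler_normB _ _) _; rewrite mulrDl lerD.
Qed.

Lemma bddZ (W : normedZmodType R[i]) (W' : normedModType R[i]) a (P : W -> W') :
  bdd P -> bdd (a \*: P).
Proof.
move=> [c c0 hP]; exists (`|a| * c) => [|f]; first exact: mulr_ge0.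
by rewrite /= normrZ -mulrA ler_wpM2l.
Qed.

Lemma bdd_comp (W W' W'' : normedZmodType R[i]) (Q : W' -> W'') (P : W -> W') :
  bdd Q -> bdd P -> bdd (Q \o P).
Proof.
move=> [d d0 hQ] [c c0 hP]; exists (d * c) => [|f]; first exact: mulr_ge0.
by apply: le_trans (hQ _) _; rewrite -mulrA ler_wpM2l.
Qed.

Lemma dense_eq0 (T : {linear K -> K}) : bdd T -> (forall v, T (j v) = 0) -> forall f, T f = 0.
Proof.
by move=> [c c0 hT] Tj; apply: (lipschitz_ext c0) => // f g; rewrite -linearB.
Qed.

Lemma adjoint_ext (S T : {linear K -> K}) : bdd S -> bdd T ->
  (forall v w, hdot K (S (j v)) (j w) = hdot K (j v) (T (j w))) ->
  forall f g, hdot K (S f) g = hdot K f (T g).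
Proof.
move=> [s s0 hS] [t t0 hT] h; have hK := hdot_psd K.
have cs a b : `|hdot K a b| <= `|a| * `|b|.
  by have := psd_cauchy_schwarz hK a b; rewrite !hdot_pnorm.
have h1 v g : hdot K (S (j v)) g = hdot K (j v) (T g).
  apply/eqP; rewrite -subr_eq0; apply/eqP.
  pose P g := hdot K (S (j v)) g - hdot K (j v) (T g) : R[i].
  apply: (@lipschitz_ext _ P (`|S (j v)| + `|j v| * t)) => [|f f'|w].
  - by rewrite addr_ge0 // mulr_ge0.
  - have -> : P f - P f' = hdot K (S (j v)) (f - f') - hdot K (j v) (T (f - f')).
      have -> : T (f - f') = T f - T f' by exact: linearB.
      by rewrite !(psdBr hK) /P; ring.
    apply: le_trans (ler_normB _ _) _; rewrite mulrDl lerD //.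
    by apply: le_trans (cs _ _) _; rewrite -mulrA ler_wpM2l.
  by rewrite /P h subrr.
move=> f g; apply/eqP; rewrite -subr_eq0; apply/eqP.
pose P f := hdot K (S f) g - hdot K f (T g) : R[i].
apply: (@lipschitz_ext _ P (s * `|g| + `|T g|)) => [|f1 f2|w].
- by rewrite addr_ge0 // mulr_ge0.
- have -> : P f1 - P f2 = hdot K (S (f1 - f2)) g - hdot K (f1 - f2) (T g).
    have -> : S (f1 - f2) = S f1 - S f2 by exact: linearB.
    by rewrite !(psdBl hK) /P; ring.
  apply: le_trans (ler_normB _ _) _; rewrite mulrDl lerD //.
    by apply: le_trans (cs _ _) _; rewrite mulrAC ler_wpM2r.
  by apply: le_trans (cs _ _) _; rewrite mulrC.
by rewrite /P h1 subrr.
Qed.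

End Extension.

(** * The weight zero part of the induced representation *)

Section VacuumVectors.
Context {R : realType} {C : cstarTensorCategory R} (D : catChoices C).
Variables (H : hilbertSpace R) (pi : fusion D -> {linear H -> H}).
Hypothesis hpi : nondeg_star_rep (@fusion_mul R C D) (@fusion_star R C D) pi.
Local Notation I := (Irr D).
Local Notation X_ k := (rep (c:=D) k).
Local Notation O := (X_ (irr0 D)).
Local Notation V := (pre_space D H).
Local Notation Q := (pre_form (D := D) (H := H) pi).
Implicit Types (u v w : V).

Lemma weight0_eq (X : C) : X = O ⊗ X. Proof. by rewrite rep0 tens1o. Qed.

Definition vacuum_gen : gen O := mkgen (eqm (weight0_eq tunit)).

Definition vacuum (xi : H) : V :=
  single (weight_space H (D := D)) (irr0 D) (hsingle vacuum_gen xi).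

Lemma vacuum_linear : linear vacuum.
Proof.
move=> a xi eta; rewrite /vacuum -[RHS](singleP (V := weight_space H (D := D))).
by congr (single _ _ _); exact: singleP.
Qed.
HB.instance Definition _ :=
  GRing.isLinear.Build R[i] H V *:%R vacuum vacuum_linear.

Definition weight0_fus (g : gen O) : fusion D :=
  fus D (eqm (esym (weight0_eq (projT1 g))) ∘ projT2 g).

Lemma gkern_weight0 (h g : gen O) :
  gkern D h g = fusion_mul (gkern D h vacuum_gen) (weight0_fus g).
Proof.
rewrite {1}/gkern.
have -> : projT2 g = eqm (weight0_eq (projT1 g)) ∘ (eqm (esym (weight0_eq (projT1 g))) ∘
  projT2 g).
  by rewrite cmpA eqmVK cmp1m.
exact: kern_weight0 (rep0 D) _ _ _ _.
Qed.

(** Modulo null vectors, a weight zero generator paired with [xi] equals the vacuum generator paired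
    with [pi (weight0_fus g) xi]; this is the resulting map back to [H]. *)
Definition to_vacuum (v : V) : H := dlift (fun g xi => pi (weight0_fus g) xi) (v (irr0 D)).

Lemma to_vacuum_linear : linear to_vacuum.
Proof. by move=> a u v; apply: dlift_linear => g b x y; exact: linearP. Qed.
HB.instance Definition _ :=
  GRing.isLinear.Build R[i] V H *:%R to_vacuum to_vacuum_linear.

Lemma vacuum_form xi eta : Q (vacuum xi) (vacuum eta) = hdot H xi eta.
Proof.
rewrite pre_form_singlel singleE bform_single /gkern.
by rewrite (kern_weight0_unit D (rep0 D)) (pi_unit hpi).
Qed.

(** In [gkern_weight0] the class of [g] is a right factor of the kernel, so [pi] moves it onto the
    vector. *)
Lemma weight0_form (a b : hsum H (gen O)) :
  bform pi (@gkern _ _ D O) a b =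
  bform pi (@gkern _ _ D O)
    (hsingle vacuum_gen (dlift (fun g xi => pi (weight0_fus g) xi) a)) b.
Proof.
have lin g c x y : pi (weight0_fus g) (c *: x + y) =
    c *: pi (weight0_fus g) x + pi (weight0_fus g) y by exact: linearP.
pose L (z : hsum H (gen O)) := dlift (fun g xi => pi (weight0_fus g) xi) z.
have LD : {morph L : x y / x + y}.
  by move=> x y; have := dlift_linear lin 1 x y; rewrite !scale1r.
apply: (hsum_ext (B := bform pi (@gkern _ _ D O))
  (B' := fun a b => bform pi (@gkern _ _ D O) (hsingle vacuum_gen (L a)) b)).
- exact: bform_addl.
- exact: bform_addr.
- move=> z x y; rewrite LD -[RHS](bform_addl pi (@gkern _ _ D O) z); congr (bform _ _ _ _).
  have := singleP (V := fun=> (H : lmodType R[i])) (t := vacuum_gen) 1 (L x) (L y).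
  by rewrite !scale1r.
- move=> z; exact: bform_addr.
move=> g h x y; rewrite /L (dlift_single lin) !bform_single gkern_weight0.
by rewrite (rep_mul hpi).
Qed.

Lemma tube_op_single (t : I * I * I) (f : tube_space (D := D) t) u v :
  Q (tube_op (single (tube_space (D := D)) t f) u) v =
  bform pi (fun h g => gkern D h (actg f g)) (u t.1.1) (v t.1.2).
Proof.
by rewrite tube_op_coef; apply: dlift_single => s; exact: tube_coefP.
Qed.

Lemma tube_op_p k u v :
  Q (tube_op (tube_p k) u) v = bform pi (@gkern _ _ D (X_ k)) (u k) (v k).
Proof.
rewrite tube_op_single; apply: eq_bform => h g.
exact: kern_act_eqm (rep0 D) _ _ _.
Qed.

Lemma tube_op_p0 u v : Q (tube_op (tube_p (irr0 D)) u) v = Q (vacuum (to_vacuum u)) v.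
Proof. by rewrite tube_op_p weight0_form pre_form_singlel. Qed.

Lemma to_vacuumK xi : to_vacuum (vacuum xi) = xi.
Proof.
rewrite /to_vacuum singleE dlift_single => [|g b x y]; last exact: linearP.
by rewrite /weight0_fus /= eqmVK -(fus_eqm D (rep0 D)) fus_irr (pi_unit hpi).
Qed.

Lemma tube_op_irr k xi v : Q (tube_op (tube_irr k) (vacuum xi)) v =
  Q (vacuum (pi (fusion_irr k) xi)) v.
Proof.
rewrite tube_op_single pre_form_singlel /vacuum.
rewrite (@singleE _ _ (weight_space H (D := D)) (irr0 D) (hsingle vacuum_gen xi)).
rewrite -[LHS](bform_gmapl pi (actg (eqm (esym (tube_unit_subproof k)))) (@gkern _ _ D O)).
rewrite gmap_single [LHS]weight0_form dlift_single; last first.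
  by move=> g b x y; exact: linearP.
rewrite /weight0_fus /actg /=.
rewrite (act_unit_vector (rep0 D) _ _ (weight0_eq (X_ k ⊗ tunit))) eqmVK.
rewrite (_ : fus D _ = fusion_irr k) //.
by rewrite -fus_irr; apply: fus_eqm; rewrite tenso1.
Qed.

End VacuumVectors.

Section AdmissibleExtension.
Context {R : realType} {C : cstarTensorCategory R} (D : catChoices C).
Variables (H : hilbertSpace R) (pi : fusion D -> {linear H -> H}).
Hypothesis hpi : nondeg_star_rep (@fusion_mul R C D) (@fusion_star R C D) pi.
Hypothesis adm : admissible_rep pi.
Local Notation Q := (pre_form (D := D) (H := H) pi).
Let pos (Y X : C) (x : Mor X (Y ⊗ X)) v := kern_ge0 hpi adm x v.

Theorem admissible_extension :
  exists (K : hilbertSpace R) (rho : tube D -> {linear K -> K}),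
    nondeg_star_rep (@tube_mul R C D) (@tube_star R C D) rho /\ restricts_to rho pi.
Proof.
have hQ : psd_form Q := pre_form_psd hpi pos.
have [K [j [jQ jd]]] := hilbert_completion hQ.
have hK := hdot_psd K.
have jn u : `|j u| = pnorm Q u by rewrite -hdot_pnorm /pnorm jQ.
(* Equality in [K] is tested inside the form, where the identities of [tube_op] hold. *)
have weak u v : (forall w, Q u w = Q v w) -> j u = j v.
  move=> h; apply/eqP; rewrite -subr_eq0; apply/eqP/(dense_dot0 jd) => w.
  by rewrite (psdBl hK) !jQ h subrr.
have /(_ _)/cid-/all_sig[rho hrho] x : exists T : {linear K -> K}, bdd T /\
    forall u, T (j u) = j (tube_op x u).
  have [c c0 hc] := tube_op_bound hpi pos x.
  have [|T [hT Tj]] := bounded_extension (L := j \o tube_op x) c0 jd.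
    by move=> u /=; rewrite !jn.
  by exists T; split=> //; exists c.
have rb x : bdd (rho x) by case: (hrho x).
have rj x u : rho x (j u) = j (tube_op x u) by case: (hrho x).
have star x f g : hdot K (rho (tube_star x) f) g = hdot K f (rho x g).
  by apply: (adjoint_ext jd) => // v w; rewrite !rj !jQ (tube_op_star hpi).
have eq_ext (S T : {linear K -> K}) : bdd S -> bdd T -> (forall u, S (j u) = T (j u)) -> S =1 T.
  move=> hS hT ST f; apply/eqP; rewrite -subr_eq0; apply/eqP.
  by apply: (dense_eq0 (T := S \- T) jd) => [|u] /=; [exact: bddN|rewrite ST subrr].
have lin c x y f : rho (c *: x + y) f = c *: rho x f + rho y f.
  apply: (eq_ext (rho (c *: x + y)) ((c \*: rho x) \+ rho y)) => // [|u].
    by apply: bddD => //; apply: bddZ.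
  rewrite /= !rj -linearP; apply: weak => w.
  by rewrite (tube_op_lin hpi) -(psd_linl hQ).
have sumr J (s : seq J) (F : J -> tube D) f : rho (\sum_(a <- s) F a) f = \sum_(a <- s) rho (F
  a) f.
  have r0 : rho 0 f = 0.
    by have := lin (-1) 0 0 f; rewrite scaler0 addr0 scaleN1r addNr.
  apply: (big_morph (fun x => rho x f)) => // x y.
  by have := lin 1 x y f; rewrite !scale1r.
have scaler c x f : rho (c *: x) f = c *: rho x f.
  have := lin c x 0 f; have := sumr nat [::] (fun=> 0) f; rewrite !big_nil => ->.
  by rewrite !addr0.
have mul x y f : rho (tube_mul x y) f = rho x (rho y f).
  apply: (eq_ext (rho (tube_mul x y)) (rho x \o rho y)) => // [|u].
    exact: bdd_comp.
  by rewrite /= !rj; apply: weak => w; exact: tube_op_product.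
exists K, rho; split.
  split=> // [x|f h]; first by have [c c0 hc] := rb x; exact: bounded_continuous hc.
  apply: (dense_dot0 jd) => v.
  (* The projections [tube_p k] sum to the identity on each finitely supported vector, which yields
     non-degeneracy. *)
  have -> : j v = \sum_(k <- dsupp v) rho (tube_p k) (j v).
    under eq_bigr do rewrite rj.
    rewrite -linear_sum; apply: weak => w; rewrite (psd_suml hQ).
    by apply: eq_bigr => k _; rewrite tube_op_p.
  rewrite (psd_sumr hK) big1 // => k _.
  by rewrite -star h (psd0l hK).
have iso xi eta : hdot K (j (vacuum D xi)) (j (vacuum D eta)) = hdot H xi eta.
  by rewrite jQ (vacuum_form hpi).
have p0 u : rho (tube_p (irr0 D)) (j u) = j (vacuum D (to_vacuum pi u)).
  by rewrite rj; apply: weak => w; exact: tube_op_p0.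
have norm_iso xi : `|j (vacuum D xi)| = `|xi|.
  by rewrite -hdot_pnorm /pnorm iso -[LHS]/(pnorm (hdot H) xi) hdot_pnorm.
have [c c0 hc] := rb (tube_p (irr0 D)).
(* The extension [T] factors the projection as [U \o T]; together with [to_vacuumK] this identifies
   its range with that of [U]. *)
have [|T [hT Tj]] := bounded_extension (L := to_vacuum pi) c0 jd.
  by move=> u; rewrite -norm_iso -p0.
pose U : {linear H -> K} := j \o vacuum D (H := H).
have UT : U \o T =1 rho (tube_p (irr0 D)).
  apply: (eq_ext (U \o T)) => // [|u]; last by rewrite p0 -Tj.
  apply: bdd_comp; last by exists c.
  by exists 1 => // xi; rewrite /U /= norm_iso mul1r.
exists U; split=> //.
  apply/seteqP; split=> [_ [xi _ <-]|_ [f _ <-]].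
    exists (U xi) => //; rewrite -UT; congr (U _).
    exact: etrans (Tj _) (to_vacuumK hpi xi).
  by exists (T f) => //; rewrite -UT.
move=> a xi; rewrite /fusion_tube (fsum_seq (dsupp_uniq a)) => [|k]; last first.
  by rewrite mem_dsupp negbK => /eqP ->; rewrite scale0r.
rewrite sumr [in RHS](fusion_expand a) (pi_sum hpi) linear_sum; apply: eq_bigr => k _.
rewrite (piZ hpi) linearZZ scaler /U /= rj; congr (_ *: _).
by apply: weak => w; exact: tube_op_irr.
Qed.

End AdmissibleExtension.

(** * Positivity of the kernels of a restriction *)

Section RestrictionPositivity.
Context {R : realType} {C : cstarTensorCategory R} (D : catChoices C).
Variables (H : hilbertSpace R) (pi : fusion D -> {linear H -> H}).
Hypothesis hpi : nondeg_star_rep (@fusion_mul R C D) (@fusion_star R C D) pi.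
Local Notation I := (Irr D).
Local Notation X_ k := (rep (c:=D) k).
Local Notation O := (X_ (irr0 D)).
Local Notation V := (pre_space D H).
Local Notation Q := (pre_form (D := D) (H := H) pi).

Lemma simple_eqm_scalar (A B B' : C) (f : Mor B B') (eB : B = A) (eB' : B' = A)
    (e : B = B') : simple A -> exists c, f = c *: eqm e.
Proof.
case: _ / (esym eB) f e; case: _ / (esym eB') => f e sA.
by rewrite eqm1; exists (scal f); exact: scalP.
Qed.

Lemma single0 (T : choiceType) (W : T -> lmodType R[i]) t : single W t 0 = 0.
Proof.
by have := singleP (V := W) (t := t) (-1) 0 0; rewrite scaler0 addr0 scaleN1r addNr.
Qed.

Lemma act_vacuum A Y (eA : A ⊗ O = A) (e1 : tunit = O ⊗ tunit) (eo : A = A ⊗ tunit)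
    (f : Mor A (Y ⊗ A)) :
  act (f ∘ eqm eA) (eqm e1) = (idm Y ⊠ eqm eo) ∘ (f ∘ eqm (esym eo)).
Proof.
have e2 : A ⊗ (O ⊗ tunit) = A ⊗ O by rewrite -e1 rep0.
have e3 : Y ⊗ A = Y ⊗ (A ⊗ tunit) by rewrite tenso1.
rewrite /act /w22 (wh_unitE _ _ e2 e3) (mt_eqmr _ (congr1 (tens A) e1)) (mt_eqmr _ e3).
rewrite !cmpA -!cmpA !eqmM; congr (_ ∘ (_ ∘ _)); exact: eqm_irr.
Qed.

Variables (i : I) (X : C) (x : Mor X (X_ i ⊗ X)).

Lemma vacuum_eq (k : I) : X_ k ⊗ O = X_ k. Proof. by rewrite rep0 tenso1. Qed.

(** Kernels see no more of [x] than these blocks: in [x ∘ V ∘ V^†] the last factor slides around the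
    annulus to the front. *)
Definition diag_block (k : I) : Mor (X_ k) (X_ i ⊗ X_ k) :=
  \sum_(V <- onb k X) (idm (X_ i) ⊠ V^†) ∘ (x ∘ V).

(* The element of A_{0,i} sending the vacuum to the generator x. *)
Definition gen_tube : tube D :=
  \sum_(k <- irrs D X) single (tube_space (D := D)) (irr0 D, i, k)
    (diag_block k ∘ eqm (vacuum_eq k)).

Definition gen_supp : seq (I * I * I) := [seq (irr0 D, i, k) | k <- irrs D X].

Lemma gen_supp_uniq : uniq gen_supp.
Proof. by rewrite map_inj_uniq ?irrs_uniq // => k l []. Qed.

Lemma gen_tube_supp : {subset dsupp gen_tube <= gen_supp}.
Proof.
move=> t; rewrite mem_dsupp dsum_suml; apply: contraNT => ts.
rewrite big1_seq // => k /andP[_ kX]; rewrite single_neq //.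
by apply: contraNneq ts => <-; apply/mapP; exists k.
Qed.

Lemma gen_tubeE k : k \in irrs D X ->
  gen_tube (irr0 D, i, k) = diag_block k ∘ eqm (vacuum_eq k).
Proof.
move=> kX; rewrite dsum_suml (bigD1_seq k) ?irrs_uniq // big1 => [|l lk].
  by rewrite singleE [LHS]addr0.
by rewrite single_neq //; apply: contra_neq lk => -[].
Qed.

Definition block_gen (k : I) : gen (X_ i) :=
  actg (diag_block k ∘ eqm (vacuum_eq k)) (vacuum_gen D).

Lemma sum_block_genl h : \sum_(k <- irrs D X) gkern D h (block_gen k) = gkern D h (mkgen x).
Proof.
have -> : gkern D h (mkgen x) = kern D (projT2 h)
    (\sum_(k <- irrs D X) \sum_(V <- onb k X) (x ∘ V) ∘ V^†).
  rewrite /gkern /= -{1}[x]cmpm1 (idm_onb D) cmp_sumr; congr (kern D _ _).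
  by apply: eq_bigr => k _; rewrite cmp_sumr; apply: eq_bigr => V0 _; rewrite cmpA.
rewrite kern_sumr; apply: eq_bigr => k _; rewrite kern_sumr /gkern /=.
have eo : X_ k = X_ k ⊗ tunit by rewrite tenso1.
rewrite (act_vacuum _ _ eo) kern_natr -cmpA eqmVK cmpm1 /diag_block kern_sumr.
by apply: eq_bigr => V0 _; rewrite kern_natr.
Qed.

Lemma sum_block_genr g : \sum_(k <- irrs D X) gkern D (block_gen k) g = gkern D (mkgen x) g.
Proof.
have -> : gkern D (mkgen x) g = kern D
    (\sum_(k <- irrs D X) \sum_(V <- onb k X) (x ∘ V) ∘ V^†) (projT2 g).
  rewrite /gkern /= -{1}[x]cmpm1 (idm_onb D) cmp_sumr; congr (kern D _ _).
  by apply: eq_bigr => k _; rewrite cmp_sumr; apply: eq_bigr => V0 _; rewrite cmpA.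
rewrite kern_suml; apply: eq_bigr => k _; rewrite kern_suml /gkern /=.
have eo : X_ k = X_ k ⊗ tunit by rewrite tenso1.
rewrite (act_vacuum _ _ eo) kern_natl -cmpA eqmVK cmpm1 /diag_block kern_suml.
by apply: eq_bigr => V0 _; rewrite kern_natl.
Qed.

Lemma bform_singlel (T S : choiceType) (k : S -> T -> fusion D) g (xi : H) (v : hsum H S) :
  bform pi k (hsingle g xi) v = \sum_(h <- dsupp v) hdot H (pi (k h g) xi) (v h).
Proof.
rewrite bformE; apply: (dlift_single (W := R[i]^o)) => g' b u w.
rewrite -[RHS]/(b * _ + _) mulr_sumr -big_split; apply: eq_bigr => h _ /=.
by rewrite linearP (psd_linl (hdot_psd H)).
Qed.

Lemma tube_op_formr_widen (y : tube D) s u v : uniq s -> {subset dsupp y <= s} ->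
  Q u (tube_op y v) =
  \sum_(t <- s) bform pi (fun h g => gkern D (actg (y t) h) g) (u t.1.2) (v t.1.1).
Proof.
move=> us sub; rewrite tube_op_formr; apply: dsupp_widen => // t y0.
rewrite -[RHS](bform_kern0 hpi (u t.1.2) (v t.1.1)); apply: eq_bform => h g.
by rewrite y0 /gkern /actg /= /act /w22 -(scale0r (0 : Mor _ _)) whZ scale0r m0l kern0l.
Qed.

Lemma vacuumE (xi : H) : vacuum D xi (irr0 D) = hsingle (vacuum_gen D) xi.
Proof. exact: singleE. Qed.

(** Positivity of [pre_form] is not yet available; only its compatibility with the product and the
    involution is used. *)
Lemma gen_tube_norm xi : Q (tube_op (tube_mul (tube_star gen_tube) gen_tube) (vacuum D xi))
    (vacuum D xi) = hdot H (pi (kern D x x) xi) xi.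
Proof.
rewrite (tube_op_product hpi) (tube_op_star hpi).
rewrite tube_op_coef (dlift_widen (tube_coefP hpi _ _) gen_supp_uniq gen_tube_supp) big_map.
pose w := tube_op gen_tube (vacuum D xi) i : hsum H (gen (X_ i)).
transitivity (bform pi (@gkern _ _ D (X_ i)) (hsingle (mkgen x) xi) w).
  transitivity (\sum_(k <- irrs D X) bform pi (@gkern _ _ D (X_ i)) (hsingle (block_gen k) xi)
    w).
    apply: eq_big_seq => k kX; rewrite /tube_coef (gen_tubeE kX).
    by rewrite -[LHS](bform_gmapl pi (actg _) (@gkern _ _ D (X_ i))) vacuumE gmap_single.
  rewrite bform_singlel; under eq_bigr do rewrite bform_singlel.
  rewrite exchange_big; apply: eq_bigr => h _.
  by rewrite -sum_block_genl (pi_sum hpi) (psd_suml (hdot_psd H)).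
rewrite -(pre_form_singlel pi) (tube_op_formr_widen _ _ gen_supp_uniq gen_tube_supp) big_map.
transitivity (\sum_(k <- irrs D X) hdot H (pi (gkern D (block_gen k) (mkgen x)) xi) xi).
  apply: eq_big_seq => k kX; rewrite (gen_tubeE kX) vacuumE singleE.
  by rewrite bform_single.
by rewrite -(psd_suml (hdot_psd H)) -(pi_sum hpi) sum_block_genr.
Qed.

Variables (K : hilbertSpace R) (rho : tube D -> {linear K -> K}).
Hypothesis hrho : nondeg_star_rep (@tube_mul R C D) (@tube_star R C D) rho.
Variable U : {linear H -> K}.
Hypothesis U_iso : forall v w : H, hdot K (U v) (U w) = hdot H v w.
Hypothesis U_fus : forall (a : fusion D) (v : H), rho (fusion_tube a) (U v) = U (pi a v).

Lemma rho_sum J (s : seq J) (F : J -> tube D) v :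
  rho (\sum_(a <- s) F a) v = \sum_(a <- s) rho (F a) v.
Proof.
apply: (big_morph (fun a => rho a v)) => [a b|].
  by have := rep_linear hrho 1 a b v; rewrite !scale1r.
by have := rep_linear hrho (-1) 0 0 v; rewrite scaler0 addr0 scaleN1r addNr.
Qed.

Lemma fusion_tube_irr k : fusion_tube (fusion_irr k) = tube_irr k :> tube D.
Proof.
rewrite /fusion_tube (fsum_seq (s := [:: k])) // => [|l]; last first.
  by rewrite inE eq_sym => lk; rewrite /fusion_irr single_neq ?scale0r.
by rewrite big_seq1 /fusion_irr singleE scale1r.
Qed.

(** By simplicity of [X_k] this component is spanned by [tube_irr k], whose matrix coefficients are
    given by [pi] on both sides. *)
Lemma weight0_matrix_coef (t : I * I * I) (f : tube_space (D := D) t) xi :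
  t.1 = (irr0 D, irr0 D) ->
  hdot K (rho (single (tube_space (D := D)) t f) (U xi)) (U xi) =
  Q (tube_op (single (tube_space (D := D)) t f) (vacuum D xi)) (vacuum D xi).
Proof.
case: t f => [[i' j'] k] f /= [ei ej]; case: _ / (esym ei) f => f; case: _ / (esym ej) f => f.
have eO : O ⊗ X_ k = X_ k by rewrite rep0 tens1o.
have [c ->] := simple_eqm_scalar f (vacuum_eq k) eO (esym (tube_unit_subproof k)) (rep_simple
  (c := D) k).
have -> : single (tube_space (D := D)) (irr0 D, irr0 D, k)
    (c *: eqm (esym (tube_unit_subproof k))) = c *: tube_irr k.
  by rewrite -[c *: eqm _]addr0 singleP single0 addr0.
have rhoZ y v : rho (c *: y) v = c *: rho y v.
  have := rep_linear hrho c y 0 v.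
  by have := rho_sum (J := unit) [::] (fun=> 0) v; rewrite !big_nil => ->; rewrite !addr0.
rewrite rhoZ -fusion_tube_irr U_fus (psdZl (hdot_psd K)) U_iso fusion_tube_irr.
rewrite tube_op_coef -[c *: _]addr0 dlift_linear; last first.
  by move=> s a y y'; exact: tube_coefP.
rewrite -!tube_op_coef (tube_op_irr hpi) (vacuum_form hpi).
by rewrite tube_op_coef /dlift [X in _ + X]big1_seq ?addr0 // => s; rewrite mem_dsupp eqxx.
Qed.

Lemma restriction_kern_ge0 xi : 0 <= hdot H (pi (kern D x x) xi) xi.
Proof.
rewrite -gen_tube_norm.
set z := tube_mul _ _.
have -> : Q (tube_op z (vacuum D xi)) (vacuum D xi) = hdot K (rho z (U xi)) (U xi).
  rewrite {2}(dsum_expand z) rho_sum (psd_suml (hdot_psd K)) tube_op_coef.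
  apply: eq_big_seq => t tz; rewrite weight0_matrix_coef; last first.
    (* The generator tube starts at weight zero, so its product with its adjoint lies in the corner
       of weight zero. *)
    case: t tz => [[i' j'] k] /tube_mul_supp_ex[a [m [l [/tube_star_supp/gen_tube_supp]]]].
    by move=> /mapP[? _ [-> _ _]] /gen_tube_supp/mapP[? _ [-> _ _]].
  by rewrite tube_op_single.
rewrite (rep_mul hrho) (rep_star hrho).
exact: psd_ge0 (hdot_psd K) _.
Qed.

End RestrictionPositivity.

Section RestrictionAdmissible.
Context {R : realType} {C : cstarTensorCategory R} (D : catChoices C).
Variables (H : hilbertSpace R) (pi : fusion D -> {linear H -> H}).
Hypothesis hpi : nondeg_star_rep (@fusion_mul R C D) (@fusion_star R C D) pi.
Local Notation X_ k := (rep (c:=D) k).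

(** Reduces (P) to simple [Y], the case in which [x] comes from an element of the tube algebra. *)
Lemma kern_decomp X Y (x : Mor X (Y ⊗ X)) :
  kern D x x = \sum_(i <- irrs D Y) \sum_(V <- onb i Y)
    kern D ((V^† ⊠ idm X) ∘ x) ((V^† ⊠ idm X) ∘ x).
Proof.
transitivity (kern D x (\sum_(i <- irrs D Y) \sum_(V <- onb i Y)
    (V ⊠ idm X) ∘ ((V^† ⊠ idm X) ∘ x))).
  congr (kern D x _); rewrite -{1}[x]cmp1m -mt1 (idm_onb D) mt_suml cmp_suml.
  apply: eq_bigr => i _; rewrite mt_suml cmp_suml; apply: eq_bigr => V _.
  by rewrite mtMl cmpA.
rewrite kern_sumr; apply: eq_bigr => i _; rewrite kern_sumr; apply: eq_bigr => V _.
by rewrite -kern_post.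
Qed.

Lemma restriction_admissible (K : hilbertSpace R) (rho : tube D -> {linear K -> K}) :
  nondeg_star_rep (@tube_mul R C D) (@tube_star R C D) rho -> restricts_to rho pi ->
  admissible_rep pi.
Proof.
move=> hrho [U [Uiso _ Ufus]] v v1; set phi := fun k => _; split.
  by rewrite /phi (pi_unit hpi) hdot_norm v1 expr1n.
pose psi k := phi k / (sdim D (X_ k))%:C%C.
exists (theta psi); first exact: theta_multiplier_of.
split=> [|X Y]; first exact: theta_is_multiplier.
have hH := hdot_psd H.
apply: (theta_cp (om := fun c => hdot H (pi c v) v)) => [a b|c|{}X {}Y x].
- have := rep_linear hpi 1 a b v; rewrite !scale1r => ->.
  exact: (psdDl hH).
- rewrite (pi_fsum hpi); apply: eq_fsbigr => k _.
  (* The dimension weight of the trace cancels the division by [sdim] in [psi]. *)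
  by rewrite /psi mulfVK ?gt_eqF ?dimk_gt0 // mulrC.
rewrite kern_decomp (pi_sum hpi) (psd_suml hH); apply: sumr_ge0 => i _.
rewrite (pi_sum hpi) (psd_suml hH); apply: sumr_ge0 => W _.
exact: (restriction_kern_ge0 hpi _ hrho Uiso Ufus).
Qed.

End RestrictionAdmissible.

Theorem corollary6p7 (R : realType) (C : cstarTensorCategory R)
    (D : catChoices C) (H : hilbertSpace R)
    (pi : fusion D -> {linear H -> H})
    (pi_rep : nondeg_star_rep (@fusion_mul R C D) (@fusion_star R C D) pi) :
  (exists (K : hilbertSpace R) (rho : tube D -> {linear K -> K}),
      nondeg_star_rep (@tube_mul R C D) (@tube_star R C D) rho /\
      restricts_to rho pi)
  <-> admissible_rep pi.
Proof.
split=> [[K [rho [hrho hres]]]|adm]; first exact: restriction_admissible hrho hres.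
exact: admissible_extension.
Qed.
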